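(* Let $T_A$ and $T_B$ be the rearrangement groups of the Airplane and of the Basilica limit spaces, respectively, and let $\alpha,\beta,\gamma,\delta\in T_A$ be the elements described in the context. Then $T_B\simeq\langle\alpha,\beta,\gamma,\delta\rangle\le T_A$.
   Context: The Airplane rearrangement group $T_A$. Graphs are finite directed multigraphs with edges coloured red or blue. The base graph $\Gamma$ has vertices $l,a,b,r$, blue edges $e_L:a\to l$ and $e_R:b\to r$, and red edges $e_U:b\to a$ and $e_D:a\to b$. Replacement rules: a red edge from $v_i$ to $v_t$ is replaced by the graph with vertices $v_i,v_t$ and two new vertices $m,w$, with red edges $\mathsf r_1:v_i\to m$, $\mathsf r_2:m\to v_t$ and a blue edge $\mathsf s:m\to w$; a blue edge from $v_i$ to $v_t$ is replaced by the graph with vertices $v_i,v_t$ and two new vertices $x,y$, with blue edges $\mathsf b_-:x\to v_i$, $\mathsf b_+:y\to v_t$ and red edges $\mathsf u:y\to x$, $\mathsf d:x\to y$. An expansion is any graph obtained from $\Gamma$ by finitely many (possibly zero) replacements of single edges. Each edge of an expansion is named by the finite word $e_0e_1\cdots e_k$ recording the edge $e_0$ of $\Gamma$ from which it descends and the successive edges of replacement graphs. Let $\Gamma_0=\Gamma$, and let $\Gamma_{n+1}$ be obtained from $\Gamma_n$ by replacing every edge. Let $\Omega$ be the set of infinite words all of whose finite nonempty prefixes name edges (topologized as a subspace of a product of finite discrete sets). Two such words $e_0e_1\cdots$ and $f_0f_1\cdots$ are equivalent if for every $n$ the edges $e_0\cdots e_n$ and $f_0\cdots f_n$ of $\Gamma_n$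 share at least one vertex; this is an equivalence relation, and the Airplane limit space $A$ is the quotient of $\Omega$ by it, with the quotient topology. The cell $\chi(e)$ of an edge $e$ is the set of points of $A$ represented by words beginning with $e$. A cellular partition is a cover of $A$ by finitely many cells with pairwise disjoint interiors. If $e,e'$ are edges of the same colour, the canonical homeomorphism $\chi(e)\to\chi(e')$ sends the class of $ew$ to the class of $e'w$. A rearrangement is a homeomorphism $f:A\to A$ for which there is a cellular partition such that $f$ restricts on each of its cells to a canonical homeomorphism onto some cell. Rearrangements form a group $T_A$ under composition. The elements $\alpha,\beta,\gamma,\delta$. Below, $e\mapsto e'$ means that the element maps $\chi(e)$ onto $\chi(e')$ canonically, and $e\mapsto e'$ (rev), for blue edges, means that it maps $\chi(e)$ onto $\chi(e')$ by the orientation-reversed map sending the classes of $e\mathsf b_\pm w$, $e\mathsf u w$, $e\mathsf d w$ to those of $e'\mathsf b_\mp w$, $e'\mathsf d w$, $e'\mathsf u w$. - $\alpha$: $e_L\mathsf b_+\mapsto e_L$, $e_L\mathsf d\mapsto e_U$, $e_L\mathsf u\mapsto e_D$, $e_L\mathsf b_-\mapsto e_R\mathsf b_-$ (rev), $e_U\mapsto e_R\mathsf u$, $e_D\mapsto e_R\mathsf d$, $e_R\mapsto e_R\mathsf b_+$. - $\beta$: $e_L\mapsto e_U\mathsf s$, $e_U\mapsto e_U\mathsf r_1$, $e_D\mathsf r_1\mapsto e_U\mathsf r_2$, $e_D\mathsf r_2\mapsto e_D$, $e_D\mathsf s\mapsto e_L$, $e_R\mapsto e_R$. - $\gamma$: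 $e_L\mapsto e_L$, $e_D\mapsto e_D$, $e_R\mapsto e_R$, $e_U\mathsf r_1\mapsto e_U\mathsf r_1\mathsf r_1$, $e_U\mathsf s\mapsto e_U\mathsf r_1\mathsf s$, $e_U\mathsf r_2\mathsf r_1\mapsto e_U\mathsf r_1\mathsf r_2$, $e_U\mathsf r_2\mathsf s\mapsto e_U\mathsf s$, $e_U\mathsf r_2\mathsf r_2\mapsto e_U\mathsf r_2$. - $\delta$: $e_L\mapsto e_R$, $e_R\mapsto e_L$, $e_U\mapsto e_D$, $e_D\mapsto e_U$. The Basilica rearrangement group $T_B$ is defined by the same construction from the following one-colour replacement system: the base graph has two vertices $p,q$ and four edges, namely $p\to q$, $q\to p$, a loop at $p$ and a loop at $q$; an edge from $v_i$ to $v_t$ (possibly $v_i=v_t$) is replaced by the graph with vertices $v_i,v_t$ and one new vertex $m$, with edges $v_i\to m$, $m\to v_t$ and a loop at $m$. Words, the limit space $B$ (quotient of the space of infinite words by the relation ''for every $n$ the length-$(n+1)$ prefixes are edges of the $n$-th full expansion sharing at least one vertex''), cells and cellular partitions are defined as for $A$; the canonical homeomorphism $\chi(e)\to\chi(e')$, $[ew]\mapsto[e'w]$, is defined when $e,e'$ are both loops or both non-loops. $T_B$ is the group of homeomorphisms of $B$ that restrict to canonical homeomorphisms onto cells on each cell of some cellular partition. *)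

(* Defs.v *)
From HB Require Import structures.
From mathcomp Require Import all_boot all_classical.
From mathcomp Require Import topology.

Set Implicit Arguments.
Unset Strict Implicit.
Unset Printing Implicit Defensive.

Local Open Scope classical_set_scope.
Local Open Scope quotient_scope.
Local Open Scope group_scope.

Record arc (L V C : Type) := Arc { lab : L; src : V; tgt : V; col : C }.

Definition arc_tuple (L V C : Type) (a : arc L V C) :=
  (lab a, src a, tgt a, col a).
Definition tuple_arc (L V C : Type) (t : L * V * V * C) :=
  let: (l, v, w, c) := t in Arc l v w c.
Lemma arc_tupleK (L V C : Type) :
  cancel (@arc_tuple L V C) (@tuple_arc L V C).
Proof. by case. Qed.
HB.instance Definition _ (L V C : eqType) :=
  Equality.copy (arc L V C) (can_type (@arc_tupleK L V C)).

Definition adjacent (L C : Type) (V : eqType) (a b : arc L V C) : bool :=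
  (src a \in [:: src b; tgt b]) || (tgt a \in [:: src b; tgt b]).

Definition is_loop (L C : Type) (V : eqType) (a : arc L V C) : bool :=
  src a == tgt a.

(* [Init] and [Term] are the vertices v_i and v_t of a replacement graph. *)
Inductive rvertex (N : Type) := Init | Term | New of N.
Arguments Init {N}.
Arguments Term {N}.

Definition rvertex_option (N : Type) (v : rvertex N) : option (option N) :=
  match v with Init => None | Term => Some None | New x => Some (Some x) end.
Definition option_rvertex (N : Type) (o : option (option N)) : rvertex N :=
  match o with None => Init | Some None => Term | Some (Some x) => New x end.
Lemma rvertex_optionK (N : Type) :
  cancel (@rvertex_option N) (@option_rvertex N).
Proof. by case. Qed.
HB.instance Definition _ (N : eqType) :=
  Equality.copy (rvertex N) (can_type (@rvertex_optionK N)).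

Definition is_new (N : Type) (v : rvertex N) : bool :=
  if v is New _ then true else false.

(* The last three fields make the gluing relation below an equivalence. *)
Record replacement_system := ReplacementSystem {
  colour : eqType;
  letter : finType;
  bvertex : eqType;
  nvertex : eqType;
  base_graph : seq (arc letter bvertex colour);
  rule : colour -> seq (arc letter (rvertex nvertex) colour);
  base_uniq : uniq (map (@lab _ _ _) base_graph);
  rule_uniq : forall c, uniq (map (@lab _ _ _) (rule c));
  rule_sep : forall c, all (fun a => is_new (src a) || is_new (tgt a)) (rule c)
}.

(* The new vertex x created by replacing the edge named w is [inr (w, x)]. *)
Definition edge (S : replacement_system) :=
  arc (seq (letter S)) (bvertex S + seq (letter S) * nvertex S)%type (colour S).

Section ReplacementSystem.
Context (S : replacement_system).
Implicit Types (e f : edge S) (G : seq (edge S)) (w : seq (letter S)).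

Definition root_graph : seq (edge S) :=
  [seq Arc [:: lab a] (inl (src a)) (inl (tgt a)) (col a) | a <- base_graph S].

Definition place e (v : rvertex (nvertex S)) :
    bvertex S + seq (letter S) * nvertex S :=
  match v with
  | Init => src e
  | Term => tgt e
  | New x => inr (lab e, x)
  end.

Definition replacement e : seq (edge S) :=
  [seq Arc (rcons (lab e) (lab a)) (place e (src a)) (place e (tgt a)) (col a)
     | a <- rule (col e)].

Inductive expansion : seq (edge S) -> Prop :=
| expansion_root : expansion root_graph
| expansion_replace G1 e G2 :
    expansion (G1 ++ e :: G2) -> expansion (G1 ++ replacement e ++ G2).

Definition full_expansion (n : nat) : seq (edge S) :=
  iter n (fun G => flatten (map replacement G)) root_graph.

Definition is_edge : set (edge S) :=
  [set e | exists2 G, expansion G & e \in G].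

Definition names_edge w : Prop := exists2 e, is_edge e & lab e = w.

Definition infinite_words :
    set (prod_topology (fun _ : nat => discrete_topology (letter S))) :=
  [set u | forall n, names_edge (mkseq u n.+1)].

Definition Omega : topologicalType := set_type infinite_words.

Definition letter_at (u : Omega) : nat -> letter S := val u.

Definition glued (u v : Omega) : Prop :=
  forall n, exists e f,
    [/\ e \in full_expansion n /\ lab e = mkseq (letter_at u) n.+1,
        f \in full_expansion n /\ lab f = mkseq (letter_at v) n.+1
      & adjacent e f].

Lemma full_expansionS n :
  full_expansion n.+1 = flatten (map replacement (full_expansion n)).
Proof. by []. Qed.

Lemma full_expansion_replacement n e f :
  e \in full_expansion n -> f \in replacement e -> f \in full_expansion n.+1.
Proof. by move=> en fe; apply/flatten_mapP; exists e. Qed.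

Lemma full_expansion_pred n f : f \in full_expansion n.+1 ->
  exists2 e, e \in full_expansion n & f \in replacement e.
Proof. by move/flatten_mapP. Qed.

Lemma size_replacement e f : f \in replacement e -> size (lab f) = (size (lab e)).+1.
Proof. by case/mapP => a _ -> /=; rewrite size_rcons. Qed.

Lemma size_full n e : e \in full_expansion n -> size (lab e) = n.+1.
Proof.
elim: n e => [|n IHn] e; first by case/mapP => a _ ->.
by case/full_expansion_pred => f /IHn <- /size_replacement ->.
Qed.

Lemma is_edge_full e : is_edge e -> e \in full_expansion (size (lab e)).-1.
Proof.
case=> G expG; elim: expG e => {G} [|G1 f G2 _ IH] e.
  by move=> eG; case/mapP: (eG) => a _ e_eq; rewrite e_eq in eG *.
rewrite !mem_cat => /or3P[eG1|ef|eG2].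
- by apply: IH; rewrite mem_cat eG1.
- have ff := IH f; rewrite mem_cat mem_head orbT in ff.
  have {}ff := ff isT; have sf := size_full ff.
  rewrite (size_replacement ef) sf /=.
  by rewrite sf /= in ff; exact: full_expansion_replacement ff ef.
- by apply: IH; rewrite mem_cat in_cons eG2 !orbT.
Qed.

Lemma lab_full_inj n : {in full_expansion n &, forall e f, lab e = lab f -> e = f}.
Proof.
have labP (L V C : eqType) (s : seq (arc L V C)) : uniq (map (@lab _ _ _) s) ->
    {in s &, forall a b, lab a = lab b -> a = b}.
  elim: s => [//|x s IHs] /= /andP[xs us] a b; rewrite !in_cons.
  case/predU1P=> [->|ha] /predU1P[->|hb] // eqab.
  - by case/mapP: xs; exists b.
  - by case/mapP: xs; exists a.
  - exact: IHs.
elim: n => [|n IHn] e f.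
  case/mapP=> a aB -> /mapP[b bB ->] /= [eqab].
  by rewrite (labP _ _ _ _ (base_uniq S) a b).
case/full_expansion_pred => e' e'n /mapP[a aR ->].
case/full_expansion_pred => f' f'n /mapP[b bR ->] /=.
move/rcons_inj => [/(IHn _ _ e'n f'n) eqef eqab]; rewrite -eqef in bR *.
by rewrite (labP _ _ _ _ (rule_uniq (col e')) a b).
Qed.

Definition incident e (v : bvertex S + seq (letter S) * nvertex S) : bool :=
  v \in [:: src e; tgt e].

Lemma adjacentP e f :
  reflect (exists2 v, incident e v & incident f v) (adjacent e f).
Proof.
rewrite /adjacent /incident; apply: (iffP orP) => [[h|h]|[v]].
- by exists (src e); rewrite // in_cons eqxx.
- by exists (tgt e); rewrite // !in_cons eqxx orbT.
- by rewrite [v \in _]in_cons mem_seq1 => /orP[] /eqP-> ->; [left|right].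
Qed.

Definition edge_at (u : Omega) n e :=
  e \in full_expansion n /\ lab e = mkseq (letter_at u) n.+1.

Lemma edge_at_exists (u : Omega) n : exists e, edge_at u n e.
Proof.
case: u => u uP; have /set_mem/(_ n)[e /is_edge_full] := uP.
by move=> eF le; exists e; split; rewrite // le size_mkseq in eF.
Qed.

Lemma edge_at_uniq (u : Omega) n e f : edge_at u n e -> edge_at u n f -> e = f.
Proof. by move=> [en le] [fn lf]; apply: (lab_full_inj en fn); rewrite le. Qed.

Lemma edge_atS (u : Omega) n f : edge_at u n.+1 f ->
  exists2 e, edge_at u n e & f \in replacement e.
Proof.
case=> /full_expansion_pred[e en fe] lf; exists e => //; split=> //.
case/mapP: fe lf => a _ -> /=; rewrite /mkseq -addn1 iotaD map_cat cats1.
by move/rcons_inj => [].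
Qed.

Lemma size_vertex n e x v : e \in full_expansion n -> incident e (inr (x, v)) ->
  size x <= n.
Proof.
elim: n e => [|n IHn] e.
  by case/mapP => a _ ->; rewrite /incident !in_cons.
case/full_expansion_pred => f fn /mapP[a _ ->]; rewrite /incident /= !in_cons orbF.
have aux y : inr (x, v) == place f y -> size x <= n.+1.
  case: y => [||y] /= /eqP h.
  - by apply/leqW/(IHn f) => //; rewrite /incident h mem_head.
  - by apply/leqW/(IHn f) => //; rewrite /incident h !in_cons eqxx orbT.
  - by case: h => -> _; rewrite (size_full fn).
by case/orP; exact: aux.
Qed.

Lemma incident_child n e0 f0 e f v :
  e0 \in full_expansion n -> f0 \in full_expansion n -> e0 <> f0 ->
  e \in replacement e0 -> f \in replacement f0 ->
  incident e v -> incident f v -> incident e0 v /\ incident f0 v.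
Proof.
move=> e0n f0n ef /mapP[a _ ->] /mapP[b _ ->].
have aux g x : g \in full_expansion n -> v = place g x ->
    incident g v \/ exists y, v = inr (lab g, y).
  move=> gn ->; case: x => [||x] /=.
  - by left; rewrite /incident mem_head.
  - by left; rewrite /incident !in_cons eqxx orbT.
  - by right; exists x.
have aux2 g x y : g \in full_expansion n ->
    incident (Arc (rcons (lab g) (lab x)) (place g (src x)) (place g (tgt x)) y : edge S) v ->
    incident g v \/ exists y, v = inr (lab g, y).
  by move=> gn; rewrite /incident /= !in_cons orbF => /orP[]/eqP; exact: aux.
move=> /(aux2 _ _ _ _ e0n) ev /(aux2 _ _ _ _ f0n) fv.
case: ev fv => [ev|[y ->]] [fv|[z]].
- by [].
- move=> hv; rewrite hv in ev.
  by have := size_vertex e0n ev; rewrite (size_full f0n) ltnn.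
- by have := size_vertex f0n fv; rewrite (size_full e0n) ltnn.
- by case=> /(lab_full_inj e0n f0n).
Qed.

(* A child meets at most one of the endpoints of its parent. *)
Lemma child_one_end n e0 e v v' : e0 \in full_expansion n ->
  e \in replacement e0 -> incident e0 v -> incident e0 v' ->
  incident e v -> incident e v' -> v = v'.
Proof.
move=> e0n /mapP[a aR ->] v0 w0.
have /allP/(_ _ aR) := rule_sep (col e0).
have new x y : incident e0 x -> x == place e0 y -> ~~ is_new y.
  case: y => //= y; move=> h /eqP hx; rewrite hx in h.
  by have := size_vertex e0n h; rewrite (size_full e0n) ltnn.
rewrite /incident /= !in_cons !orbF.
move=> sep /orP[] hv /orP[] hw; rewrite ?(eqP hv) ?(eqP hw) //.
- by case/orP: sep => h; [have := new _ _ v0 hv|have := new _ _ w0 hw]; rewrite h.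
- by case/orP: sep => h; [have := new _ _ w0 hw|have := new _ _ v0 hv]; rewrite h.
Qed.

Lemma gluedP (u v : Omega) : glued u v <->
  forall n e f, edge_at u n e -> edge_at v n f -> adjacent e f.
Proof.
split=> [uv n e f eu fv|uv n].
  have [e' [f' [/(edge_at_uniq eu) <- /(edge_at_uniq fv) <-]]] := uv n.
  by [].
have [[e eu] [f fv]] := (edge_at_exists u n, edge_at_exists v n).
by exists e, f; split=> //; exact: uv _ _ _ eu fv.
Qed.

Lemma glued_refl u : glued u u.
Proof.
apply/gluedP => n e f eu /(edge_at_uniq eu) <-.
by rewrite /adjacent mem_head.
Qed.

Lemma adjacent_sym e f : adjacent e f = adjacent f e.
Proof. by apply/adjacentP/adjacentP => -[v ? ?]; exists v. Qed.

Lemma glued_sym u v : glued u v -> glued v u.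
Proof.
by move/gluedP=> uv; apply/gluedP => n e f ev fu; rewrite adjacent_sym; exact: uv _ _ _ fu ev.
Qed.

Lemma glued_trans (u v w : Omega) : glued u v -> glued v w -> glued u w.
Proof.
move=> /gluedP uv /gluedP vw; apply/gluedP => n e g eu gw.
have [f fv] := edge_at_exists v n.
have [->|/eqP ef] := eqVneq e f; first exact: vw _ _ _ fv gw.
have [<-|/eqP fg] := eqVneq f g; first exact: uv _ _ _ eu fv.
have [[e1 e1u] [f1 f1v]] := (edge_at_exists u n.+1, edge_at_exists v n.+1).
have [g1 g1w] := edge_at_exists w n.+1.
have [e' /(edge_at_uniq eu) <- e1e] := edge_atS e1u.
have [f' /(edge_at_uniq fv) <- f1f] := edge_atS f1v.
have [g' /(edge_at_uniq gw) <- g1g] := edge_atS g1w.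
have [[en _] [fn _]] := (eu, fv); have [gn _] := gw.
have /adjacentP[x xe1 xf1] := uv _ _ _ e1u f1v.
have /adjacentP[y yf1 yg1] := vw _ _ _ f1v g1w.
have [xe xf] := incident_child en fn ef e1e f1f xe1 xf1.
have [yf yg] := incident_child fn gn fg f1f g1g yf1 yg1.
apply/adjacentP; exists x => //.
by rewrite (child_one_end fn f1f xf yf xf1 yf1).
Qed.

Definition glueb : rel Omega := fun u v => `[< glued u v >].

Lemma glueb_refl : reflexive glueb.
Proof. by move=> u; apply/asboolP; exact: glued_refl. Qed.

Lemma glueb_sym : symmetric glueb.
Proof. by move=> u v; apply/asboolP/asboolP; exact: glued_sym. Qed.

Lemma glueb_trans : transitive glueb.
Proof.
by move=> v u w /asboolP uv /asboolP vw; apply/asboolP; exact: glued_trans uv vw.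
Qed.

Canonical glue_equiv := EquivRel glueb glueb_refl glueb_sym glueb_trans.

Definition limit_space : topologicalType :=
  quotient_topology {eq_quot glue_equiv}.

Definition point_of (u : Omega) : limit_space := \pi_({eq_quot glue_equiv}) u.

Definition cell w : set limit_space :=
  [set p | exists2 u : Omega, mkseq (letter_at u) (size w) = w & p = point_of u].

Definition cellular_partition (P : set (edge S)) : Prop :=
  [/\ finite_set P,
      P `<=` is_edge,
      \bigcup_(e in P) cell (lab e) = [set: limit_space]
    & trivIset P (fun e => (cell (lab e))°)].

Definition prepend w (x : nat -> letter S) : nat -> letter S :=
  fun n => nth (x (n - size w)%N) w n.

(* [f] sends the class of [w x] to that of [w' x]; this is meaningful when the
   same infinite words [x] can follow [w] and [w']. *)
Definition maps_canonically (f : limit_space -> limit_space) w w' : Prop :=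
  forall (x : nat -> letter S) (u v : Omega),
    letter_at u =1 prepend w x -> letter_at v =1 prepend w' x -> f (point_of u) = point_of v.

End ReplacementSystem.

Record homeo (X : topologicalType) := Homeo {
  homeo_fun :> X -> X;
  homeo_inv : X -> X;
  homeo_funK : cancel homeo_fun homeo_inv;
  homeo_invK : cancel homeo_inv homeo_fun;
  homeo_cont : continuous homeo_fun;
  homeo_inv_cont : continuous homeo_inv
}.

Lemma homeo_eq (X : topologicalType) (f g : homeo X) : f =1 g -> f = g.
Proof.
case: f g => [f f' fK f'K cf cf'] [g g' gK g'K cg cg'] /= /funext fg.
case: _ / fg in gK g'K cg *.
have fg' : f' = g' by apply/funext => x; rewrite -{1}(g'K x) fK.
case: _ / fg' in gK g'K cg' *.
by congr Homeo; exact: Prop_irrelevance.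
Qed.

Section HomeoGroup.
Context (X : topologicalType).

Definition homeo_one : homeo X.
Proof. by refine (@Homeo X id id _ _ _ _) => // x; exact: cvg_id. Defined.

Definition homeo_V (f : homeo X) : homeo X :=
  Homeo (@homeo_invK X f) (@homeo_funK X f)
        (@homeo_inv_cont X f) (@homeo_cont X f).

Definition homeo_mul (f g : homeo X) : homeo X.
Proof.
refine (@Homeo X (f \o g) (homeo_inv g \o homeo_inv f) _ _ _ _).
- exact: can_comp (@homeo_funK X f) (@homeo_funK X g).
- exact: can_comp (@homeo_invK X g) (@homeo_invK X f).
- by move=> x; apply: continuous_comp; exact: homeo_cont.
- by move=> x; apply: continuous_comp; exact: homeo_inv_cont.
Defined.

HB.instance Definition _ := gen_eqMixin (homeo X).
HB.instance Definition _ := gen_choiceMixin (homeo X).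

Lemma homeo_mulA : associative homeo_mul.
Proof. by move=> f g h; exact: homeo_eq. Qed.
Lemma homeo_mul1 : left_id homeo_one homeo_mul.
Proof. by move=> f; exact: homeo_eq. Qed.
Lemma homeo_mulr1 : right_id homeo_one homeo_mul.
Proof. by move=> f; exact: homeo_eq. Qed.
Lemma homeo_mulV : left_inverse homeo_one homeo_V homeo_mul.
Proof. by move=> f; apply: homeo_eq => x /=; exact: homeo_funK. Qed.
Lemma homeo_mulrV : right_inverse homeo_one homeo_V homeo_mul.
Proof. by move=> f; apply: homeo_eq => x /=; exact: homeo_invK. Qed.

HB.instance Definition _ := isGroup.Build (homeo X)
  homeo_mulA homeo_mul1 homeo_mulr1 homeo_mulV homeo_mulrV.

End HomeoGroup.

Definition is_subgroup (G : groupType) (H : set G) : Prop :=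
  group_closed (mem H).

Definition generated (G : groupType) (A : set G) : set G :=
  smallest (@is_subgroup G) A.

Definition subgroup_iso (G K : groupType) (H : set G) (L : set K) : Prop :=
  [/\ is_subgroup H, is_subgroup L
    & exists phi : G -> K,
        set_bij H L phi /\ {in H &, {morph phi : x y / x * y}}].

(* [same_type e e'] tells between which cells there is a canonical
   homeomorphism. *)
Definition rearrangements (S : replacement_system) (same_type : rel (edge S)) :
    set (homeo (limit_space S)) :=
  [set f | exists2 P, cellular_partition P
     & forall e, P e -> exists e',
         [/\ is_edge e', same_type e e' & maps_canonically f (lab e) (lab e')]].

Inductive air_colour := Red | Blue.
Inductive air_base := v_l | v_a | v_b | v_r.
Inductive air_new := n_m | n_w | n_x | n_y.
Inductive air_letter :=
| e_L | e_R | e_U | e_D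
| r_1 | r_2 | l_s
| b_minus | b_plus | l_u | l_d.

Lemma air_colour_dec : comparable air_colour.
Proof. by rewrite /comparable /decidable; decide equality. Defined.
HB.instance Definition _ := hasDecEq.Build air_colour (compareP air_colour_dec).

Lemma air_base_dec : comparable air_base.
Proof. by rewrite /comparable /decidable; decide equality. Defined.
HB.instance Definition _ := hasDecEq.Build air_base (compareP air_base_dec).

Lemma air_new_dec : comparable air_new.
Proof. by rewrite /comparable /decidable; decide equality. Defined.
HB.instance Definition _ := hasDecEq.Build air_new (compareP air_new_dec).

Lemma air_letter_dec : comparable air_letter.
Proof. by rewrite /comparable /decidable; decide equality. Defined.
HB.instance Definition _ := hasDecEq.Build air_letter (compareP air_letter_dec).

Definition air_letters :=
  [:: e_L; e_R; e_U; e_D; r_1; r_2; l_s; b_minus; b_plus; l_u; l_d].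
Lemma air_letterK : pcancel (index^~ air_letters) (onth air_letters).
Proof. by case. Qed.
HB.instance Definition _ := Countable.copy air_letter (pcan_type air_letterK).
Lemma air_letter_fin : Finite.axiom air_letters.
Proof. by case. Qed.
HB.instance Definition _ := isFinite.Build air_letter air_letter_fin.

Definition air_base_graph : seq (arc air_letter air_base air_colour) :=
  [:: Arc e_L v_a v_l Blue; Arc e_R v_b v_r Blue;
      Arc e_U v_b v_a Red;  Arc e_D v_a v_b Red].

Definition air_rule (c : air_colour) :
    seq (arc air_letter (rvertex air_new) air_colour) :=
  match c with
  | Red => [:: Arc r_1 Init (New n_m) Red; Arc r_2 (New n_m) Term Red;
               Arc l_s (New n_m) (New n_w) Blue]
  | Blue => [:: Arc b_minus (New n_x) Init Blue; Arc b_plus (New n_y) Term Blue;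
                Arc l_u (New n_y) (New n_x) Red; Arc l_d (New n_x) (New n_y) Red]
  end.

Lemma air_base_uniq : uniq (map (@lab _ _ _) air_base_graph).
Proof. by []. Qed.
Lemma air_rule_uniq c : uniq (map (@lab _ _ _) (air_rule c)).
Proof. by case: c. Qed.
Lemma air_rule_sep c :
  all (fun a => is_new (src a) || is_new (tgt a)) (air_rule c).
Proof. by case: c. Qed.

Definition airplane_system : replacement_system :=
  ReplacementSystem air_base_uniq air_rule_uniq air_rule_sep.

Definition airplane : topologicalType := limit_space airplane_system.

Definition T_A : set (homeo airplane) :=
  @rearrangements airplane_system (fun e e' => col e == col e').

Notation "f `: w |-> w'" := (@maps_canonically airplane_system f w w')
  (at level 70, w at next level).

Definition maps_reversed (f : airplane -> airplane) (w w' : seq air_letter) :=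
  [/\ f `: rcons w b_minus |-> rcons w' b_plus,
      f `: rcons w b_plus |-> rcons w' b_minus,
      f `: rcons w l_u |-> rcons w' l_d
    & f `: rcons w l_d |-> rcons w' l_u].

Definition is_alpha (f : airplane -> airplane) : Prop :=
  [/\ [/\ f `: [:: e_L; b_plus] |-> [:: e_L],
          f `: [:: e_L; l_d] |-> [:: e_U],
          f `: [:: e_L; l_u] |-> [:: e_D]
        & maps_reversed f [:: e_L; b_minus] [:: e_R; b_minus]],
      f `: [:: e_U] |-> [:: e_R; l_u],
      f `: [:: e_D] |-> [:: e_R; l_d]
    & f `: [:: e_R] |-> [:: e_R; b_plus]].

Definition is_beta (f : airplane -> airplane) : Prop :=
  [/\ f `: [:: e_L] |-> [:: e_U; l_s],
      f `: [:: e_U] |-> [:: e_U; r_1],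
      [/\ f `: [:: e_D; r_1] |-> [:: e_U; r_2],
          f `: [:: e_D; r_2] |-> [:: e_D]
        & f `: [:: e_D; l_s] |-> [:: e_L]]
    & f `: [:: e_R] |-> [:: e_R]].

Definition is_gamma (f : airplane -> airplane) : Prop :=
  [/\ f `: [:: e_L] |-> [:: e_L],
      f `: [:: e_D] |-> [:: e_D],
      f `: [:: e_R] |-> [:: e_R]
    & [/\ f `: [:: e_U; r_1] |-> [:: e_U; r_1; r_1],
          f `: [:: e_U; l_s] |-> [:: e_U; r_1; l_s],
          f `: [:: e_U; r_2; r_1] |-> [:: e_U; r_1; r_2],
          f `: [:: e_U; r_2; l_s] |-> [:: e_U; l_s]
        & f `: [:: e_U; r_2; r_2] |-> [:: e_U; r_2]]].

Definition is_delta (f : airplane -> airplane) : Prop :=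
  [/\ f `: [:: e_L] |-> [:: e_R],
      f `: [:: e_R] |-> [:: e_L],
      f `: [:: e_U] |-> [:: e_D]
    & f `: [:: e_D] |-> [:: e_U]].

Inductive bas_base := v_p | v_q.
Inductive bas_letter :=
| e_pq | e_qp | e_p | e_q
| l_in | l_out | l_loop.

Lemma bas_base_dec : comparable bas_base.
Proof. by rewrite /comparable /decidable; decide equality. Defined.
HB.instance Definition _ := hasDecEq.Build bas_base (compareP bas_base_dec).

Lemma bas_letter_dec : comparable bas_letter.
Proof. by rewrite /comparable /decidable; decide equality. Defined.
HB.instance Definition _ := hasDecEq.Build bas_letter (compareP bas_letter_dec).

Definition bas_letters := [:: e_pq; e_qp; e_p; e_q; l_in; l_out; l_loop].
Lemma bas_letterK : pcancel (index^~ bas_letters) (onth bas_letters).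
Proof. by case. Qed.
HB.instance Definition _ := Countable.copy bas_letter (pcan_type bas_letterK).
Lemma bas_letter_fin : Finite.axiom bas_letters.
Proof. by case. Qed.
HB.instance Definition _ := isFinite.Build bas_letter bas_letter_fin.

Definition bas_base_graph : seq (arc bas_letter bas_base unit) :=
  [:: Arc e_pq v_p v_q tt; Arc e_qp v_q v_p tt;
      Arc e_p v_p v_p tt; Arc e_q v_q v_q tt].

Definition bas_rule (_ : unit) : seq (arc bas_letter (rvertex unit) unit) :=
  [:: Arc l_in Init (New tt) tt; Arc l_out (New tt) Term tt;
      Arc l_loop (New tt) (New tt) tt].

Lemma bas_base_uniq : uniq (map (@lab _ _ _) bas_base_graph).
Proof. by []. Qed.
Lemma bas_rule_uniq c : uniq (map (@lab _ _ _) (bas_rule c)).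
Proof. by []. Qed.
Lemma bas_rule_sep c :
  all (fun a => is_new (src a) || is_new (tgt a)) (bas_rule c).
Proof. by []. Qed.

Definition basilica_system : replacement_system :=
  ReplacementSystem bas_base_uniq bas_rule_uniq bas_rule_sep.

Definition basilica : topologicalType := limit_space basilica_system.

Definition T_B : set (homeo basilica) :=
  @rearrangements basilica_system (fun e e' => is_loop e == is_loop e').

(* Main.v *)
Require Import Defs.
From mathcomp Require Import all_boot all_classical.
From mathcomp Require Import topology.
From HB Require Import structures.
Require Import Defs.

Set Implicit Arguments.
Unset Strict Implicit.
Unset Printing Implicit Defensive.

Local Open Scope classical_set_scope.
Local Open Scope quotient_scope.

(** The basilica is what remains of the airplane once each segment joining two
    neighbouring circles is shrunk to a point.  In the airplane a blue cell
    hanging from a circle consists of a segment (its subcell [b_minus]), a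
    circle (its subcells [l_u] and [l_d]) and a blue cell hanging from the far
    point of that circle (its subcell [b_plus]).  When the segment is shrunk, the
    circle touches the circle from which it hung: blue cells become loops of
    the basilica and red cells become its other cells.  On words this is a
    letter by letter substitution ([collapse_seq]), and it respects the gluing
    relations ([collapse_eqv]), so it gives a surjection [collapse] from the
    airplane onto the basilica.

    The four generators permute the shrunken segments and act on each of them
    canonically or by reversal ([rigid]).  Hence every element of the group H
    that they generate descends along [collapse] to an element of T_B
    ([descends]).  The resulting homomorphism from H to T_B is an isomorphism:

    - It is injective.  An element of H over the identity fixes canonically
      every cell that avoids the segments, because the collapse is injective on
      such words; it then fixes the end points of every segment, and rigidity
      leaves no choice on the segment itself ([kernel_trivial]).

    - It is surjective, because T_B is generated by the images of the four
      generators ([T_B_generated]).  Call a cell of a loop a half-space.  The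
      involution iota, the product of the images of delta and alpha, exchanges
      the half-space of [e_p] and its complement.  An element of T_B maps the
      half-space of [e_p] to a half-space or to the complement of one, since it
      preserves the two sides of a cut point ([half_space]); the generated group
      is transitive on half-spaces ([to_loop]), so it suffices to treat an
      element g preserving the half-space of [e_p].  On the circle of that
      half-space g is given by two binary subdivisions with the same number of
      arcs; each is carried to a standard subdivision, the vine, by tree
      rotations, which are words in the generators ([normalize],
      [spine_match]).  After correction by such a word, g fixes the circle
      pointwise and preserves each half-space attached to it.  A conjugate of
      its restriction to one of these half-spaces is again an element preserving
      the half-space of [e_p], but canonical at a smaller depth, and induction
      concludes ([localize]).

    Two general facts support this.  A homeomorphism of a limit space is a
    rearrangement exactly when it is canonical on every edge of some full
    expansion ([rearrangementP]), which makes rearrangements a group.  And a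
    finite table of pairs of words defines a homeomorphism as soon as both
    columns are the edges of subdivisions and the incidences between
    end points agree, a condition decided by computation ([table_homeo]). *)

(** * Infinite words and their prefixes *)

Section Words.
Context (T : eqType).
Implicit Types (u v : nat -> T) (w : seq T).

Definition pre w u : nat -> T := fun n => nth (u (n - size w)%N) w n.
Definition suff n u : nat -> T := fun i => u (n + i).
Definition begins u w := mkseq u (size w) == w.

Lemma mkseq_pre w u k : mkseq (pre w u) (size w + k) = w ++ mkseq u k.
Proof.
rewrite /mkseq iotaD map_cat add0n; congr cat.
  apply: (@eq_from_nth _ (u 0)); rewrite size_map size_iota // => i iw.
  rewrite (nth_map 0) ?size_iota // nth_iota // /pre add0n.
  by apply: set_nth_default.
rewrite -[X in iota X]addn0 iotaDl -map_comp; apply: eq_map => i /=.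
by rewrite /pre nth_default ?leq_addr // addKn.
Qed.

Lemma mkseqD u n k : mkseq u (n + k) = mkseq u n ++ mkseq (suff n u) k.
Proof.
rewrite /mkseq iotaD map_cat add0n; congr cat.
by rewrite -[X in iota X]addn0 iotaDl -map_comp.
Qed.

Lemma mkseqS u n : mkseq u n.+1 = rcons (mkseq u n) (u n).
Proof. by rewrite -addn1 mkseqD cats1 /= /suff addn0. Qed.

Lemma mkseq_suff n u : pre (mkseq u n) (suff n u) = u.
Proof.
apply/funext => i; rewrite /pre size_mkseq; case: (ltnP i n) => h.
  by rewrite nth_mkseq.
by rewrite nth_default ?size_mkseq // /suff subnKC.
Qed.

Lemma pre_cat w1 w2 u : pre (w1 ++ w2) u = pre w1 (pre w2 u).
Proof.
apply/funext => i; rewrite /pre nth_cat size_cat subnDA.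
by case: ltnP => h; [exact: set_nth_default|rewrite [RHS]nth_default].
Qed.

Lemma pre_inj w u v : pre w u = pre w v -> u = v.
Proof.
move=> h; apply/funext => i; have := congr1 (@^~ (size w + i)) h.
by rewrite /pre !nth_default ?leq_addr // addKn.
Qed.

Lemma cat_neq0 w w' : w != [::] -> w ++ w' != [::].
Proof. by case: w. Qed.

Lemma begins_pre w u : begins (pre w u) w.
Proof. by rewrite /begins -{1}[size w]addn0 mkseq_pre cats0. Qed.

Lemma beginsP u w : begins u w -> u = pre w (suff (size w) u).
Proof. by move/eqP=> {1}<-; rewrite mkseq_suff. Qed.

Lemma begins_mkseq u n : begins u (mkseq u n).
Proof. by rewrite /begins size_mkseq. Qed.

Lemma begins_cat u w1 w2 : begins u (w1 ++ w2) ->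
  begins u w1 /\ begins (suff (size w1) u) w2.
Proof.
rewrite /begins size_cat mkseqD eqseq_cat ?size_mkseq //.
by case/andP.
Qed.

Lemma begins_prefix u w1 w2 : begins u w1 -> begins u w2 ->
  size w1 <= size w2 -> prefix w1 w2.
Proof.
move=> /eqP h1 /eqP h2 s; rewrite -h2 -(subnKC s) mkseqD h1.
exact: prefix_prefix.
Qed.

Lemma begins_comparable u w1 w2 : begins u w1 -> begins u w2 ->
  prefix w1 w2 \/ prefix w2 w1.
Proof.
move=> h1 h2; case/orP: (leq_total (size w1) (size w2)) => s.
  by left; exact: begins_prefix h1 h2 s.
by right; exact: begins_prefix h2 h1 s.
Qed.

Lemma prefix_begins u w1 w2 : prefix w1 w2 -> begins u w2 -> begins u w1.
Proof. by case/prefixP=> y -> /begins_cat[]. Qed.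

Lemma begins_pre_cat w1 w2 u : begins (pre w1 u) (w1 ++ w2) = begins u w2.
Proof.
by rewrite /begins size_cat mkseq_pre eqseq_cat // eqxx.
Qed.

Lemma suff_pre w u : suff (size w) (pre w u) = u.
Proof. by apply: (@pre_inj w); rewrite -beginsP ?begins_pre. Qed.

End Words.

Lemma prependE (S : replacement_system) (w : seq (letter S)) x :
  prepend w x = pre w x.
Proof. by []. Qed.

(** * Edges named by words *)

Section Decode.
Context (S : replacement_system).
Implicit Types (e f : edge S) (w : seq (letter S)) (u v : nat -> letter S).

Definition pickarc (L V C : eqType) (s : seq (arc L V C)) c :=
  ohead [seq a <- s | lab a == c].

Lemma pickarcP (L V C : eqType) (s : seq (arc L V C)) c a :
  pickarc s c = Some a -> a \in s /\ lab a = c.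
Proof.
rewrite /pickarc; case E: [seq a <- s | lab a == c] => [//|b s'] [ba].
have : b \in [seq a <- s | lab a == c] by rewrite E mem_head.
by rewrite mem_filter ba => /andP[/eqP].
Qed.

Lemma pickarc_mem (L V C : eqType) (s : seq (arc L V C)) a :
  uniq (map (@lab _ _ _) s) -> a \in s -> pickarc s (lab a) = Some a.
Proof.
rewrite /pickarc; elim: s => [//|b s IH] /= /andP[bs us].
rewrite in_cons => /predU1P[->|as_]; first by rewrite eqxx.
case: eqP => [ba|_]; last exact: IH.
by move: bs; rewrite ba => /mapP[]; exists a.
Qed.

Definition child e c : option (edge S) :=
  omap (fun a => Arc (rcons (lab e) c) (place e (src a)) (place e (tgt a)) (col a))
    (pickarc (rule (col e)) c).

Definition base c : option (edge S) :=
  omap (fun a => Arc [:: c] (inl (src a)) (inl (tgt a)) (col a))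
    (pickarc (base_graph S) c).

Definition extend (o : option (edge S)) w :=
  foldl (fun o c => obind (child^~ c) o) o w.

(** A word names at most one edge, and that edge is computed letter by letter;
    this replaces membership in an expansion by a computation. *)
Definition decode w : option (edge S) :=
  if w is c :: w' then extend (base c) w' else None.

Lemma decode_rcons w c : w != [::] ->
  decode (rcons w c) = obind (child^~ c) (decode w).
Proof. by case: w => //= a w _; rewrite /extend -cats1 foldl_cat. Qed.

Lemma decode_cat w y : w != [::] -> decode (w ++ y) = extend (decode w) y.
Proof. by case: w => //= a w _; rewrite /extend foldl_cat. Qed.

Lemma child_lab e c f : child e c = Some f -> lab f = rcons (lab e) c.
Proof. by rewrite /child; case: pickarc => //= a [<-]. Qed.

Lemma childP e c f : child e c = Some f -> f \in replacement e.
Proof.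
rewrite /child; case E: pickarc => [a|] //= [<-].
have [ar ac] := pickarcP E; apply/mapP; exists a => //.
by rewrite ac.
Qed.

Lemma decode_full w e : decode w = Some e ->
  lab e = w /\ e \in full_expansion S (size w).-1.
Proof.
elim/last_ind: w e => [//|w c IH] e.
have [->|w0] := eqVneq w [::].
  rewrite /= /base; case E: pickarc => [a|] //= [<-] /=; split => //.
  have [ab ac] := pickarcP E; apply/mapP; exists a => //.
  by rewrite ac.
rewrite decode_rcons //; case E: (decode w) => [f|] //= h.
have [fw ff] := IH _ E; split; first by rewrite (child_lab h) fw.
rewrite size_rcons; case: w w0 {IH E} ff fw => //= b w _ ff fw.
exact: (full_expansion_replacement ff (childP h)).
Qed.

Lemma full_decode n e : e \in full_expansion S n -> decode (lab e) = Some e.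
Proof.
elim: n e => [|n IH] e.
  case/mapP => a ab -> /=; rewrite /base pickarc_mem //; exact: base_uniq.
case/full_expansion_pred => f fn ef.
have fl := IH _ fn; have := size_full fn.
case/mapP: ef => a ar -> /= sf.
rewrite decode_rcons -?size_eq0 ?sf // fl /= /child pickarc_mem //.
exact: rule_uniq.
Qed.

Lemma decode_lab w e : decode w = Some e -> lab e = w.
Proof. by case/decode_full. Qed.

Lemma expansion_full G1 G2 : expansion (G1 ++ G2) ->
  expansion (flatten (map (@replacement S) G1) ++ G2).
Proof.
elim/last_ind: G1 G2 => [//|G1 e IH] G2.
rewrite cat_rcons => h.
have {}h := expansion_replace h.
by move: (IH _ h); rewrite map_rcons flatten_rcons catA.
Qed.

Lemma full_is_expansion n : expansion (full_expansion S n).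
Proof.
elim: n => [|n IH]; first exact: expansion_root.
rewrite full_expansionS -[flatten _]cats0; apply: expansion_full.
by rewrite cats0.
Qed.

Lemma is_edgeP e : is_edge e <-> decode (lab e) = Some e.
Proof.
split=> [/is_edge_full/full_decode //|/decode_full[_ h]].
by exists (full_expansion S (size (lab e)).-1) => //; exact: full_is_expansion.
Qed.

Lemma decode_edge w e : decode w = Some e -> is_edge e.
Proof. by move=> h; apply/is_edgeP; rewrite (decode_lab h). Qed.

Definition valid u := forall n, decode (mkseq u n.+1).

Lemma validP u : valid u <-> infinite_words u.
Proof.
split=> h n; have := h n.
  case E: decode => [e|] // _; exists e; first exact: decode_edge E.
  exact: decode_lab E.
by case=> e /is_edgeP; move=> he <-; rewrite he.
Qed.

Lemma decode_prefix w y : w != [::] -> decode (w ++ y) -> decode w.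
Proof.
by move=> w0; rewrite decode_cat //; case: (decode w) => //; elim: y.
Qed.

Definition inc (o : option (edge S)) x := if o is Some e then incident e x else false.

(** The infinite word shrinks to the vertex x. *)
Definition ends u x := exists N, forall n, N <= n -> inc (decode (mkseq u n.+1)) x.

(** A generic word is the only name of its point: gluing happens only at
    vertices.  Generic words detect which cells contain a point. *)
Definition generic u := valid u /\ forall x, ~ ends u x.

Lemma letter_valid (U : Omega S) : valid (letter_at U).
Proof. by apply/validP; case: U => u uP; exact: set_mem uP. Qed.

Lemma edge_at_decode (U : Omega S) n e :
  edge_at U n e <-> decode (mkseq (letter_at U) n.+1) = Some e.
Proof.
split=> [[en le]|h]; first by rewrite -le (full_decode en).
by have [h1 h2] := decode_full h; split => //; rewrite size_mkseq in h2.
Qed.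

(** A child meets at most one end of its parent. *)
Lemma ends_unique u x y : ends u x -> ends u y -> x = y.
Proof.
move=> [N hN] [M hM].
set n := maxn N M.
have := hN _ (leq_maxl _ _ : N <= n); have := hM _ (leq_maxr _ _ : M <= n).
have := hN _ (leqW (leq_maxl _ _) : N <= n.+1).
have := hM _ (leqW (leq_maxr _ _) : M <= n.+1).
rewrite (mkseqS u n.+1) decode_rcons //.
case E: (decode (mkseq u n.+1)) => [e|] //=.
case F: (child e (u n.+1)) => [f|] //= fy fx ey ex.
exact: child_one_end (decode_full E).2 (childP F) ex ey fx fy.
Qed.

(** Once two words have separated, a vertex shared by their edges at one level
    is shared by the parents as well, and a child meets at most one end of its
    parent; hence the shared vertex never changes from that level on. *)
Lemma glued_ends (U V : Omega S) : glued U V <->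
  letter_at U = letter_at V \/
  exists x, ends (letter_at U) x /\ ends (letter_at V) x.
Proof.
set u := letter_at U; set v := letter_at V.
have down n : (forall m, n <= m -> forall e f, edge_at U m e -> edge_at V m f ->
    adjacent e f) -> glued U V.
  elim: n => [|n IH] h; first by apply/gluedP => m e f; apply: h.
  apply: IH => m; rewrite leq_eqVlt => /predU1P[<-|]; last exact: h.
  move=> e f eU fV.
  have [->|/eqP ef] := eqVneq e f; first by rewrite /adjacent mem_head.
  have [[e1 e1U] [f1 f1V]] := (edge_at_exists U n.+1, edge_at_exists V n.+1).
  have [e' /(edge_at_uniq eU) <- e1e] := edge_atS e1U.
  have [f' /(edge_at_uniq fV) <- f1f] := edge_atS f1V.
  have /adjacentP[x xe xf] := h _ (leqnn _) _ _ e1U f1V.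
  have [? ?] := incident_child eU.1 fV.1 ef e1e f1f xe xf.
  by apply/adjacentP; exists x.
split; last first.
  case=> [uv|[x [[N hN] [M hM]]]].
    have -> : U = V by apply: val_inj.
    exact: glued_refl.
  apply: (down (maxn N M)) => m; rewrite geq_max => /andP[Nm Mm] e f.
  move=> /edge_at_decode eU /edge_at_decode fV.
  have := hN _ Nm; have := hM _ Mm; rewrite eU fV /= => fx ex.
  by apply/adjacentP; exists x.
move/gluedP => UV.
have [uv|/eqP uv] := eqVneq (u : nat -> letter S) v; [by left|right].
have [k uvk] : exists k, u k <> v k.
  by apply/not_existsP => h; apply: uv; apply/funext => k; apply: contrapT; exact: h.
have diff n e f : k <= n -> edge_at U n e -> edge_at V n f -> e <> f.
  move=> kn [_ le] [_ lf] ef; apply: uvk; move: le; rewrite ef lf.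
  move/(congr1 (nth (u 0) ^~ k)); rewrite !nth_mkseq //.
have [e eU] := edge_at_exists U k; have [f fV] := edge_at_exists V k.
have step n x : k < n -> 
  (forall e f, edge_at U n e -> edge_at V n f -> incident e x /\ incident f x) ->
  (forall e f, edge_at U n.+1 e -> edge_at V n.+1 f -> incident e x /\ incident f x).
  case: n => // n kn h e1 f1 e1U f1V.
  have [e0 e0U e1e0] := edge_atS e1U.
  have [f0 f0V f1f0] := edge_atS f1V.
  have [g gU e0g] := edge_atS e0U.
  have [g' gV f0g] := edge_atS f0V.
  have [ex fx] := h _ _ e0U f0V.
  have /adjacentP[y ye yf] := UV _ _ _ e1U f1V.
  have nef : e0 <> f0 by apply: (diff n.+1) => //; apply: ltnW.
  have [e0y f0y] := incident_child e0U.1 f0V.1 nef e1e0 f1f0 ye yf.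
  have ngg : g <> g' by apply: (diff n).
  have [gy gy'] := incident_child gU.1 gV.1 ngg e0g f0g e0y f0y.
  have [gx gx'] := incident_child gU.1 gV.1 ngg e0g f0g ex fx.
  by rewrite (child_one_end gU.1 e0g gx gy ex e0y).
have [e1 e1U] := edge_at_exists U k.+1; have [f1 f1V] := edge_at_exists V k.+1.
have /adjacentP[x xe xf] := UV _ _ _ e1U f1V.
have all n : k < n -> forall e f, edge_at U n e -> edge_at V n f ->
    incident e x /\ incident f x.
  elim: n => // n IH; rewrite ltnS leq_eqVlt => /predU1P[<-|kn]; last first.
    exact: step kn (IH kn).
  by move=> e' f' /(edge_at_uniq e1U) <- /(edge_at_uniq f1V) <-.
exists x; split; exists k.+1 => n kn;
  have [e' eU'] := edge_at_exists U n; have [f' fV'] := edge_at_exists V n;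
  have [? ?] := all _ kn _ _ eU' fV'.
  by move/edge_at_decode: eU' => ->.
by move/edge_at_decode: fV' => ->.
Qed.

End Decode.

(** * The topology of the space of words *)

Section Topology.
Context (S : replacement_system).
Implicit Types (U V : Omega S) (A : set (Omega S)).

Definition cylinder U M : set (Omega S) :=
  [set V | mkseq (letter_at V) M = mkseq (letter_at U) M].

Lemma mkseq_eq (T : Type) (u v : nat -> T) n i :
  mkseq u n = mkseq v n -> i < n -> u i = v i.
Proof.
by move=> h i_n; move/(congr1 (nth (u 0) ^~ i)): h; rewrite !nth_mkseq.
Qed.

(** The product of discrete topologies is generated by cylinders; in this form
    continuity of letter exchanges is a statement on prefixes. *)
Lemma nbhs_cylinder U A : nbhs U A <-> exists M, cylinder U M `<=` A.
Proof.
split=> [|[M]].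
  pose P := prod_topology (fun _ : nat => discrete_topology (letter S)).
  pose G : set_system P := [set B : set P | exists M, forall v : P,
    mkseq v M = mkseq (val U) M -> B v].
  have GF : Filter G.
    split=> [|B C [M hM] [N hN]|B C BC [M hM]].
    - by exists 0.
    - exists (maxn M N) => v h; split.
        apply: hM; apply/eq_in_map => i; rewrite mem_iota add0n => /andP[_ iM].
        by apply: mkseq_eq h _; rewrite leq_max iM.
      apply: hN; apply/eq_in_map => i; rewrite mem_iota add0n => /andP[_ iM].
      by apply: mkseq_eq h _; rewrite leq_max iM orbT.
    - by exists M => v /hM; exact: BC.
  have GU : G --> (val U : P).
    apply/cvg_sup => n B [C [[W oW <-] WfN WU]].
    exists n.+1 => v h; apply: WU => /=.
    by rewrite (mkseq_eq h (ltnSn n)).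
  case=> B [[C oC <-] CU sub].
  have /GU[M hM] : nbhs (val U : P) C by rewrite nbhsE; exists C.
  by exists M => V h; apply: sub; exact: hM.
elim: M A => [|M IH] A sub; first by apply: filterS sub _; apply: filterS filterT.
have cM : nbhs U [set V | letter_at V M = letter_at U M].
  have c1 : continuous (val : Omega S -> _) by exact: initial_continuous.
  have c2 := @proj_continuous nat (fun _ => discrete_topology (letter S)) M.
  have := @continuous_comp _ _ _ _ _ U (c1 U) (c2 (val U)).
  by move/(_ _ (discrete_set1 _)).
have := IH _ (@subset_refl _ (cylinder U M)).
move/(filterI cM); apply: filterS => V [/= h1 h2]; apply: sub.
by rewrite /cylinder /= !mkseqS h1 h2.
Qed.

End Topology.

Lemma continuous_cylinder (S S' : replacement_system) (F : Omega S -> Omega S') :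
  (forall U M, exists N, forall V, cylinder U N V -> cylinder (F U) M (F V)) ->
  continuous F.
Proof.
move=> h U A /nbhs_cylinder[M sub]; have [N hN] := h U M.
by apply/nbhs_cylinder; exists N => V /hN /sub.
Qed.

(** * Points of the limit space *)

Section Points.
Context (S : replacement_system) (u0 : Omega S).
Implicit Types (e : edge S) (w : seq (letter S)) (u v : nat -> letter S).
Implicit Types (f g : limit_space S -> limit_space S) (p q : limit_space S).

Definition omega u (uv : valid u) : Omega S := exist _ u (mem_set ((validP u).1 uv)).

(** Total on raw sequences so that prefixes can be exchanged freely; an invalid
    sequence is sent to the arbitrary point named by [u0]. *)
Definition pt u : limit_space S :=
  match pselect (valid u) with left h => point_of (omega h) | right _ => point_of u0 end.

Lemma pt_valid u (uv : valid u) : pt u = point_of (omega uv).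
Proof. by rewrite /pt; case: pselect => // h; congr point_of; exact: val_inj. Qed.

Lemma pt_letter (U : Omega S) : pt (letter_at U) = point_of U.
Proof. by rewrite (pt_valid (letter_valid U)); congr point_of; exact: val_inj. Qed.

Lemma ptP p : exists2 u, valid u & p = pt u.
Proof.
exists (letter_at (repr (p : {eq_quot glue_equiv S}))); first exact: letter_valid.
by rewrite pt_letter /point_of reprK.
Qed.

Lemma point_of_eq (U V : Omega S) : point_of U = point_of V <-> glued U V.
Proof.
rewrite /point_of; split => [|h].
  by move/(eqmodP (glue_equiv S)) => /asboolP.
by apply/(eqmodP (glue_equiv S))/asboolP.
Qed.

Lemma pt_eq u v : valid u -> valid v ->
  pt u = pt v <-> u = v \/ exists x, ends u x /\ ends v x.
Proof.
by move=> uv vv; rewrite (pt_valid uv) (pt_valid vv) point_of_eq glued_ends.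
Qed.

Lemma pt_generic u v : generic u -> valid v -> pt u = pt v -> u = v.
Proof.
by case=> uv ue vv /(pt_eq uv vv)[//|[x [/ue]]].
Qed.

Lemma pt_ends u v x y : valid u -> valid v -> ends u x -> ends v y ->
  pt u = pt v <-> x = y.
Proof.
move=> uv vv ux vy; rewrite pt_eq //; split=> [[uv'|[z [uz vz]]]|xy].
- by rewrite uv' in ux; exact: ends_unique ux vy.
- by rewrite (ends_unique ux uz) (ends_unique vy vz).
- by right; exists x; rewrite {2}xy.
Qed.

Lemma cellP w p : cell w p <-> exists u, [/\ valid u, begins u w & p = pt u].
Proof.
split=> [[U /eqP Uw ->]|[u [uv /eqP uw ->]]].
  by exists (letter_at U); split; rewrite ?pt_letter //; exact: letter_valid.
by exists (omega uv); rewrite ?(pt_valid uv).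
Qed.

Lemma cell_pt u w : valid u -> begins u w -> cell w (pt u).
Proof. by move=> uv uw; apply/cellP; exists u. Qed.

Lemma cell_generic u w : generic u -> cell w (pt u) -> begins u w.
Proof.
by move=> ug /cellP[v [vv vw]] /(pt_generic ug vv) ->.
Qed.

Lemma valid_far u N : (forall n, N <= n -> decode (mkseq u n.+1)) -> valid u.
Proof.
move=> h n; have := h _ (leq_maxl N n).
rewrite -(subnKC (leq_maxr N n)) -addSn mkseqD; exact: decode_prefix.
Qed.

Lemma canonP f w w' : maps_canonically f w w' <->
  forall x, valid (pre w x) -> valid (pre w' x) -> f (pt (pre w x)) = pt (pre w' x).
Proof.
split=> [h x v1 v2|h x u v /funext hu /funext hv].
  by rewrite (pt_valid v1) (pt_valid v2); exact: h.
by rewrite -!pt_letter hu hv; apply: h; rewrite -prependE -?hu -?hv; exact: letter_valid.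
Qed.

Lemma open_generic (A : set (limit_space S)) u : open A -> valid u -> A (pt u) ->
  exists M, forall v, valid v -> begins v (mkseq u M) -> A (pt v).
Proof.
move=> oA uv Au.
have : nbhs (omega uv) [set V | A (point_of V)].
  apply: (open_nbhs_nbhs (conj _ _)); last by rewrite /= -pt_valid.
  exact: oA.
case/nbhs_cylinder => M sub; exists M => v vv /eqP hv.
rewrite (pt_valid vv); apply: sub; rewrite /cylinder /= -[RHS]hv size_mkseq.
by [].
Qed.

End Points.

(** * Rearrangements form a group *)

Section Rearrangements.
Context (S : replacement_system) (u0 : Omega S) (R : rel (edge S)).
Hypothesis R_refl : reflexive R.
Hypothesis R_sym : symmetric R.
Hypothesis R_trans : transitive R.
Hypothesis R_child : forall e e' c f, decode (lab e) = Some e ->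
  decode (lab e') = Some e' -> R e e' -> child e c = Some f ->
  exists2 f', child e' c = Some f' & R f f'.
Hypothesis generic_in : forall w : seq (letter S), decode w ->
  exists2 u : nat -> letter S, generic u & begins u w.
Implicit Types (e : edge S) (w y : seq (letter S)) (u v : nat -> letter S).
Implicit Types (f g : limit_space S -> limit_space S) (p q : limit_space S).
Local Notation pt := (pt u0).

(** The same infinite tails can follow two alike words, so there is a
    canonical map between their cells. *)
Definition alike w w' :=
  exists e e', [/\ decode w = Some e, decode w' = Some e' & R e e'].

Lemma decode_neq0 w : decode w -> w != [::]. Proof. by case: w. Qed.

Lemma alike_refl w : decode w -> alike w w.
Proof. by case E: decode => [e|] // _; exists e, e. Qed.

Lemma alike_sym w w' : alike w w' -> alike w' w.
Proof. by move=> [e [e' [h h' r]]]; exists e', e; rewrite R_sym. Qed.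

Lemma alike_trans w1 w2 w3 : alike w1 w2 -> alike w2 w3 -> alike w1 w3.
Proof.
move=> [e1 [e2 [h1 h2 r]]] [e2' [e3 [h2' h3 r']]]; exists e1, e3; split => //.
by move: h2'; rewrite h2 => -[?]; subst; exact: R_trans r r'.
Qed.

Lemma alike_decode w w' : alike w w' -> decode w.
Proof. by move=> [e [e' [-> _ _]]]. Qed.

Lemma alike_decode' w w' : alike w w' -> decode w'.
Proof. by move=> [e [e' [_ -> _]]]. Qed.

Lemma alike_cat w w' y : alike w w' -> decode (w ++ y) -> alike (w ++ y) (w' ++ y).
Proof.
move=> h; have w0 := decode_neq0 (alike_decode h).
have w0' := decode_neq0 (alike_decode' h).
elim/last_ind: y => [|y c IH]; first by rewrite !cats0.
rewrite -!rcons_cat => d.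
have wy0 : w ++ y != [::] by exact: cat_neq0.
have wy0' : w' ++ y != [::] by exact: cat_neq0.
move: d; rewrite decode_rcons //; case E: (decode (w ++ y)) => [e|] //=.
case F: child => [e1|] // _.
have := IH; rewrite E => /(_ isT)[e2 [e2' [E2 E2' r]]].
have ee : e = e2 by move: E; rewrite E2 => -[].
rewrite -ee in r.
have le : decode (lab e) = Some e by rewrite (decode_lab E).
have le' : decode (lab e2') = Some e2' by rewrite (decode_lab E2').
have [f' cf' rf'] := R_child le le' r F.
by exists e1, f'; rewrite !decode_rcons // E2' E /= F cf'.
Qed.

Lemma alike_valid w w' x : alike w w' -> valid (pre w x) -> valid (pre w' x).
Proof.
move=> h; have w0 := decode_neq0 (alike_decode h).
have w0' := decode_neq0 (alike_decode' h) => vx.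
apply: (@valid_far _ _ (size w')) => n wn.
have {vx} := vx (size w + (n - size w')); rewrite -addnS mkseq_pre => d.
by have := alike_decode' (alike_cat h d); rewrite -mkseq_pre addnS subnKC.
Qed.

Definition maps f w w' := alike w w' /\
  forall x, valid (pre w x) -> f (pt (pre w x)) = pt (pre w' x).

Lemma mapsP f w w' : maps f w w' <-> alike w w' /\ maps_canonically f w w'.
Proof.
split=> -[h fm]; split => //.
  by apply/(canonP u0) => x vx _; exact: fm.
by move=> x vx; apply: ((canonP u0 f w w').1 fm) => //; exact: alike_valid vx.
Qed.

Lemma maps_cat f w w' y : maps f w w' -> decode (w ++ y) -> maps f (w ++ y) (w' ++ y).
Proof.
move=> [h fm] d; split; first exact: alike_cat h d.
by move=> x; rewrite !pre_cat; exact: fm.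
Qed.

Lemma maps_comp f g w w' w'' : maps g w w' -> maps f w' w'' -> maps (f \o g) w w''.
Proof.
move=> [h gm] [h' fm]; split; first exact: alike_trans h h'.
by move=> x vx /=; rewrite gm // fm //; exact: alike_valid h vx.
Qed.

Lemma maps_inv f g w w' : cancel f g -> maps f w w' -> maps g w' w.
Proof.
move=> fg [h fm]; split; first exact: alike_sym.
move=> x vx; rewrite -fm ?fg //; exact: alike_valid (alike_sym h) vx.
Qed.

Lemma maps_id w : decode w -> maps id w w.
Proof. by move=> d; split; first exact: alike_refl. Qed.

Definition level_maps n f := forall w, size w = n.+1 -> decode w -> exists w', maps f w w'.

Lemma level_maps_le n m f : n <= m -> level_maps n f -> level_maps m f.
Proof.
move=> nm h w sw dw; have nw : n.+1 <= size w by rewrite sw.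
have d1 : decode (take n.+1 w).
  by apply: (@decode_prefix _ _ (drop n.+1 w)); rewrite ?cat_take_drop // -size_eq0 size_takel.
have [w' hw'] := h _ (size_takel nw) d1.
exists (w' ++ drop n.+1 w); rewrite -{1}(cat_take_drop n.+1 w); apply: maps_cat => //.
by rewrite cat_take_drop.
Qed.

Lemma maps_cell f w w' u : maps f w w' -> valid u -> begins u w ->
  exists v, [/\ valid v, begins v w' & f (pt u) = pt v].
Proof.
move=> [h fm] uv uw; exists (pre w' (suff (size w) u)); split.
- by apply: alike_valid h _; rewrite -beginsP.
- exact: begins_pre.
- by rewrite {1}(beginsP uw) fm // -beginsP.
Qed.

(** A generic word in the cell of w is the only name of its point, so any cell
    containing this point has a name comparable with w. *)
Lemma cover_prefix (P : set (seq (letter S))) N w :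
  (forall p, exists y v, [/\ valid v, p = pt v, P y & begins v y]) ->
  (forall y, P y -> size y <= N) -> decode w -> N <= size w ->
  exists2 y, P y & prefix y w.
Proof.
move=> cov sz dw Nw; have [x xg xw] := generic_in dw.
have [y [v [vv pe Py vy]]] := cov (pt x).
have xv := pt_generic xg vv pe; rewrite -xv in vy.
exists y => //; exact: begins_prefix vy xw (leq_trans (sz _ Py) Nw).
Qed.

Lemma bounded_witnesses (Q : seq (letter S) -> seq (letter S) -> Prop) (s : seq (seq (letter S))) :
  {in s, forall w, exists w', Q w w'} ->
  exists M, {in s, forall w, exists2 w', Q w w' & size w' <= M}.
Proof.
elim: s => [|w s IH] h; first by exists 0.
have [M hM] : exists M, {in s, forall w, exists2 w', Q w w' & size w' <= M}.
  by apply: IH => x xs; apply: h; rewrite in_cons xs orbT.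
have [w' qw] := h w (mem_head _ _).
exists (maxn (size w') M) => x; rewrite in_cons => /predU1P[->|/hM[x' qx sx]].
  by exists w' => //; rewrite leq_maxl.
by exists x' => //; rewrite leq_max sx orbT.
Qed.

Lemma level_maps_comp n m f g :
  level_maps n g -> level_maps m f -> level_maps (n + m) (f \o g).
Proof.
move=> gn fm w sw dw.
have nw : n.+1 <= size w by rewrite sw ltnS leq_addr.
have w0 : take n.+1 w != [::] by rewrite -size_eq0 size_takel.
have d1 : decode (take n.+1 w).
  by apply: (@decode_prefix _ _ (drop n.+1 w)); rewrite ?cat_take_drop.
have [w1 h1] := gn _ (size_takel nw) d1.
have := maps_cat (y := drop n.+1 w) h1; rewrite cat_take_drop => /(_ dw) h2.
have d2 := alike_decode' h2.1.
have sz : m.+1 <= size (w1 ++ drop n.+1 w).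
  rewrite size_cat size_drop sw subSS addKn -addn1 addnC leq_add2r lt0n size_eq0.
  exact: decode_neq0 (alike_decode' h1.1).
have [w2 h3] : exists w2, maps f (w1 ++ drop n.+1 w) w2.
  have := @level_maps_le m (size (w1 ++ drop n.+1 w)).-1 f.
  have e : (size (w1 ++ drop n.+1 w)).-1.+1 = size (w1 ++ drop n.+1 w).
    by rewrite prednK //; exact: leq_ltn_trans sz.
  by rewrite -ltnS e => /(_ sz fm) /(_ _ (esym e) d2).
by exists w2; exact: maps_comp h2 h3.
Qed.

Lemma full_mem_decode n w : w \in map (@lab _ _ _) (full_expansion S n) ->
  decode w /\ size w = n.+1.
Proof. by case/mapP => e en ->; rewrite (full_decode en) (size_full en). Qed.

Lemma decode_full_mem n w : decode w -> size w = n.+1 ->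
  w \in map (@lab _ _ _) (full_expansion S n).
Proof.
case E: decode => [e|] // _ sw; apply/mapP; exists e; last by rewrite (decode_lab E).
by have := (decode_full E).2; rewrite sw.
Qed.

(** The images of the edges of a full expansion cover the space, so they are
    refined by every sufficiently deep full expansion. *)
Lemma level_maps_inv n f g : cancel f g -> cancel g f ->
  level_maps n f -> exists m, level_maps m g.
Proof.
move=> fg gf fn.
have [M hM] : exists M, {in map (@lab _ _ _) (full_expansion S n),
    forall w, exists2 w', maps f w w' & size w' <= M}.
  by apply: bounded_witnesses => w /full_mem_decode[dw sw]; exact: fn.
exists M => w sw dw.
pose P := [set w' : seq (letter S) | size w' <= M /\ exists w0, maps f w0 w'].
have [w' [_ [w0 h]] /prefixP[y wy]] : exists2 w', P w' & prefix w' w.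
  apply: (@cover_prefix P M) => //; last 2 first.
  - by move=> w' [].
  - by rewrite sw leqW.
  move=> p; have [u uv gp] := ptP u0 (g p).
  have [|w' hw' sw'] := hM (mkseq u n.+1).
    by apply: decode_full_mem; rewrite ?size_mkseq; first exact: uv.
  have [v [vv vw' fv]] := maps_cell hw' uv (begins_mkseq _ _).
  exists w', v; split => //; first by rewrite -fv -gp gf.
  by split => //; exists (mkseq u n.+1).
exists (w0 ++ y); rewrite wy; apply: maps_cat; first exact: maps_inv h.
by rewrite -wy.
Qed.

(** A cellular partition is refined by every deep full expansion, by
    [cover_prefix].  Conversely the cells of a full expansion have disjoint
    interiors: a common interior point would give a generic word beginning with
    the names of both edges. *)
Lemma rearrangementP (f : homeo (limit_space S)) :
  rearrangements R f <-> exists n, level_maps n f.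
Proof.
split=> [[P [finP PE cov _] Pm]|[n fn]].
  have [s Ps] := (finite_seqP (P : set (edge S))).1 finP.
  pose N := \max_(e <- s) size (lab e).
  have sz e : P e -> size (lab e) <= N.
    by rewrite Ps /= => es; rewrite /N; apply: (@leq_bigmax_seq _ _ _ (fun e => size (lab e))).
  exists N => w sw dw.
  have [||||w0 [e Pe <-] /prefixP[y wy]] := @cover_prefix [set lab e | e in P] N w.
  - move=> p; have : (\bigcup_(e in P) cell (lab e)) p by rewrite cov.
    case=> e Pe /(cellP u0)[v [vv vw ->]]; exists (lab e), v; split => //.
    by exists e.
  - by move=> _ [e Pe <-]; exact: sz.
  - by [].
  - by rewrite sw.
  have [e' [e'E Ree' hm]] := Pm e Pe.
  have h : maps f (lab e) (lab e').
    apply/mapsP; split => //; exists e, e'; split => //; first exact/is_edgeP/PE.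
    exact/is_edgeP.
  by exists (lab e' ++ y); rewrite wy; apply: maps_cat => //; rewrite -wy.
exists [set` full_expansion S n].
  split.
  - exact: finite_seq.
  - by move=> e /= en; exists (full_expansion S n) => //; exact: full_is_expansion.
  - apply/seteqP; split=> // p _; have [u uv ->] := ptP u0 p.
    have := uv n; case E: decode => [e|] // _.
    have [le en] := decode_full E.
    exists e; first by move: en; rewrite size_mkseq.
    by apply: cell_pt => //; rewrite le; exact: begins_mkseq.
  - apply/trivIsetP => e e' /= en en' ee'; apply: contrapT => /eqP/set0P[p [pe pe']].
    move: ee'; apply/negP; rewrite negbK; apply/eqP.
    have [u uv pu] := ptP u0 p.
    pose A := (cell (lab e))° `&` (cell (lab e'))°.
    have oA : open A by apply: openI; exact: open_interior.
    have [M hM] := open_generic (u0 := u0) oA uv (ltac:(by rewrite -pu) : A (pt u)).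
    have [x xg xu] := generic_in (uv M).
    have [xe xe'] : A (pt x).
      apply: hM; first by case: xg.
      by apply: prefix_begins xu; rewrite mkseqS prefix_rcons.
    have b := cell_generic xg (interior_subset xe).
    have b' := cell_generic xg (interior_subset xe').
    apply: (lab_full_inj en en'); rewrite -(eqP b) -(eqP b').
    by rewrite (size_full en) (size_full en').
move=> e /= en; have de : decode (lab e) by rewrite (full_decode en).
have [w' /mapsP[[e1 [e' [E1 E' r]]] h]] := fn _ (size_full en) de.
exists e'; split; first exact: decode_edge E'.
- by move: E1; rewrite (full_decode en) => -[->].
- by rewrite (decode_lab E').
Qed.

Lemma rearrangements_subgroup : is_subgroup (rearrangements R).
Proof.
split.
  apply/mem_set/rearrangementP; exists 0 => w sw dw; exists w.
  exact: maps_id.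
move=> f g /set_mem/rearrangementP[n fn] /set_mem/rearrangementP[m gm].
apply/mem_set/rearrangementP.
have [k gk] := level_maps_inv (@homeo_funK _ g) (@homeo_invK _ g) gm.
by exists (k + n); exact: level_maps_comp gk fn.
Qed.

End Rearrangements.

(** * Homeomorphisms given by finite tables *)

Lemma prefix_total (T : eqType) (a b c : seq T) : prefix a c -> prefix b c ->
  prefix a b \/ prefix b a.
Proof.
have aux (x y : seq T) : size x <= size y -> prefix x c -> prefix y c -> prefix x y.
  rewrite !prefixE => s /eqP hx /eqP hy; rewrite -{1}hy take_takel //.
  exact/eqP.
move=> ha hb; case/orP: (leq_total (size a) (size b)) => s.
  by left; exact: aux.
by right; exact: aux.
Qed.

Section Tables.
Context (S : replacement_system).
Implicit Types (e : edge S) (w y : seq (letter S)) (u v : nat -> letter S).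
Local Notation word := (seq (letter S)).
Implicit Types (p q : word * word) (t : seq (word * word)).

Definition same_col : rel (edge S) := fun e e' => col e == col e'.

Lemma same_col_child e e' c f : decode (lab e) = Some e ->
  decode (lab e') = Some e' -> same_col e e' -> child e c = Some f ->
  exists2 f', child e' c = Some f' & same_col f f'.
Proof.
rewrite /child => _ _ /eqP ->; case: pickarc => [a|] //= [<-].
by eexists; first by []; rewrite /same_col.
Qed.

(** A vertex remembers the word of the edge in whose replacement it was
    created, and it is incident only to proper descendants of that edge. *)
Lemma decode_new w e (z : word) n : decode w = Some e -> incident e (inr (z, n)) ->
  prefix z w && (size z < size w).
Proof.
elim/last_ind: w e => [//|w c IH] e.
have [->|w0] := eqVneq w [::].
  rewrite /= /base; case: pickarc => [a|] //= [<-].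
  by rewrite /incident /= !in_cons.
rewrite decode_rcons //; case E: (decode w) => [f|] //=.
have lf := decode_lab E.
rewrite /child; case: pickarc => [a|] //= [<-]; rewrite /incident /= !inE size_rcons.
have aux r : inr (z, n) == place f r -> prefix z (rcons w c) && (size z < (size w).+1).
  case: r => [||k] /= /eqP h.
  - have /andP[h1 h2] : prefix z w && (size z < size w).
      by apply: IH E _; rewrite /incident h mem_head.
    by rewrite (prefix_trans h1 (prefix_rcons _ _)) ltnW // ltnS ltnW.
  - have /andP[h1 h2] : prefix z w && (size z < size w).
      by apply: IH E _; rewrite /incident h !inE eqxx orbT.
    by rewrite (prefix_trans h1 (prefix_rcons _ _)) ltnW // ltnS ltnW.
  - by case: h => -> _; rewrite lf prefix_rcons ltnSn.
by case/orP; exact: aux.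
Qed.

Definition endpoint (b : bool) e := if b then src e else tgt e.

Definition word_end b w := omap (endpoint b) (decode w).

Definition entry_ok p :=
  if (decode p.1, decode p.2) is (Some e, Some e') then col e == col e' else false.

(** Words of different entries are incomparable, and a vertex shared on the
    left is shared at the same ends on the right. *)
Definition pair_ok p q :=
  [&& prefix p.1 q.1 ==> (p == q) &
    all (fun b => all (fun c =>
      (word_end b p.1 == word_end c q.1) ==> (word_end b p.2 == word_end c q.2))
      [:: true; false]) [:: true; false]].

Definition covering N t :=
  all (fun e => has (fun p => prefix p.1 (lab e)) t) (full_expansion S N).

Definition half_ok N t :=
  [&& all entry_ok t, all (fun p => all (pair_ok p) t) t & covering N t].

Definition swap t := map (fun p => (p.2, p.1)) t.

(** The two halves express that the table and its inverse are well defined. *)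
Definition table_ok N t := half_ok N t && half_ok N (swap t).

(** The effect of the entry p on vertices: an end goes to the corresponding
    end, a vertex created inside the cell to the one created at the same
    place. *)
Definition vrel p x x' :=
  [\/ exists2 b, word_end b p.1 = Some x & word_end b p.2 = Some x'
    | exists y n, x = inr (p.1 ++ y, n) /\ x' = inr (p.2 ++ y, n)].

Lemma vrel_cat p y f : entry_ok p -> decode (p.1 ++ y) = Some f ->
  exists f', [/\ decode (p.2 ++ y) = Some f', col f = col f',
    vrel p (src f) (src f') & vrel p (tgt f) (tgt f')].
Proof.
case: p => w w'; rewrite /entry_ok /=.
case E: (decode w) => [e|] //; case E': (decode w') => [e'|] // /eqP ce.
have w0 : w != [::] by case: (w) E.
have w0' : w' != [::] by case: (w') E'.
elim/last_ind: y f => [|y c IH] f.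
  rewrite !cats0 E => -[<-]; exists e'; split=> //; left.
    by exists true; rewrite /word_end ?E ?E'.
  by exists false; rewrite /word_end ?E ?E'.
have wy0 : w ++ y != [::] by exact: cat_neq0.
have wy0' : w' ++ y != [::] by exact: cat_neq0.
rewrite -!rcons_cat decode_rcons //; case F: decode => [g|] //=.
have [g' [G cg vs vt]] := IH _ F.
rewrite /child; case A: pickarc => [a|] //= [<-].
rewrite decode_rcons // G /= /child -cg A /=; eexists; split; first by [].
- by [].
- case: (src a) => [||k] //=; right; exists y, k.
  by rewrite (decode_lab F) (decode_lab G).
- case: (tgt a) => [||k] //=; right; exists y, k.
  by rewrite (decode_lab F) (decode_lab G).
Qed.

Lemma word_end_incident b w x : word_end b w = Some x ->
  exists2 e, decode w = Some e & incident e x.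
Proof.
rewrite /word_end; case: decode => [e|] //= [<-]; exists e => //.
by rewrite /incident !inE /endpoint; case: b; rewrite eqxx ?orbT.
Qed.

Section Half.
Context (N : nat) (t : seq (word * word)).
Hypothesis ok : half_ok N t.

Lemma half_entry p : p \in t -> entry_ok p.
Proof. by case/and3P: ok => /allP h _ _; exact: h. Qed.

Lemma half_pair p q : p \in t -> q \in t -> pair_ok p q.
Proof. by case/and3P: ok => _ /allP h _ /h /allP; apply. Qed.

Lemma half_prefix p q : p \in t -> q \in t -> prefix p.1 q.1 -> p = q.
Proof. by move=> pt /(half_pair pt)/andP[/implyP h _] /h/eqP. Qed.

Lemma half_end p q b c x : p \in t -> q \in t ->
  word_end b p.1 = Some x -> word_end c q.1 = Some x ->
  word_end b p.2 = word_end c q.2.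
Proof.
move=> pt /(half_pair pt)/andP[_ /allP h] hx hy.
have /allP/(_ c) := h b ltac:(by case: (b)).
by rewrite hx hy eqxx /= => /(_ ltac:(by case: (c)))/eqP.
Qed.

(** Two entries agree on a common vertex: it is an end for both of them, or was
    created inside both, and then the entries coincide. *)
Lemma vrel_fun p q x x1 x2 : p \in t -> q \in t ->
  vrel p x x1 -> vrel q x x2 -> x1 = x2.
Proof.
have aux r s b y n : r \in t -> s \in t ->
    word_end b r.1 = Some (inr (s.1 ++ y, n)) -> False.
  move=> rt st /word_end_incident[e de /(decode_new de)/andP[h1 h2]].
  have rs : s = r.
    by apply: half_prefix => //; exact: prefix_trans (prefix_prefix _ _) h1.
  by move: h2; rewrite rs size_cat ltnNge leq_addr.
move=> pt qt [[b h1 h2]|[y [n [h1 h2]]]] [[c h3 h4]|[y' [m [h3 h4]]]].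
- have := half_end pt qt h1 h3.
  by rewrite h2 h4 => -[].
- by rewrite h3 in h1; case: (aux _ _ _ _ _ pt qt h1).
- by rewrite h1 in h3; case: (aux _ _ _ _ _ qt pt h3).
- have e : inr (p.1 ++ y, n) = inr (q.1 ++ y', m) :> bvertex S + _ by rewrite -h1.
  case: e => e nm.
  have pq : p = q.
    have := prefix_prefix p.1 y; have := prefix_prefix q.1 y'; rewrite -e => b a.
    by case: (prefix_total a b) => h; [|apply/esym]; apply: half_prefix.
  move: e; rewrite h2 h4 pq nm => /eqP; rewrite eqseq_cat // eqxx /= => /eqP ->.
  by [].
Qed.

Definition entry_of u := nth ([::], [::]) t (find (fun p => begins u p.1) t).

Definition exchange u := pre (entry_of u).2 (suff (size (entry_of u).1) u).

Lemma entry_ofP u : valid u -> entry_of u \in t /\ begins u (entry_of u).1.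
Proof.
move=> uv; have := uv N; case E: decode => [e|] // _.
have [le en] := decode_full E; rewrite size_mkseq in en.
case/and3P: ok => _ _ /allP/(_ _ en)/hasP[p pt pe].
have h : has (fun p => begins u p.1) t.
  apply/hasP; exists p => //; apply: prefix_begins pe _.
  by rewrite le begins_mkseq.
by split; [rewrite mem_nth // -has_find | exact: (nth_find ([::], [::]) h)].
Qed.

Lemma entry_of_uniq u p : p \in t -> begins u p.1 -> entry_of u = p.
Proof.
move=> pt up.
have h : has (fun p => begins u p.1) t by apply/hasP; exists p.
have b : begins u (entry_of u).1 := nth_find ([::], [::]) h.
have et : entry_of u \in t by rewrite mem_nth // -has_find.
by case: (begins_comparable b up) => h'; [|apply/esym]; apply: half_prefix.
Qed.

Lemma exchange_pre p x : p \in t -> exchange (pre p.1 x) = pre p.2 x.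
Proof.
move=> pt; rewrite /exchange (@entry_of_uniq _ p) ?begins_pre //.
by rewrite suff_pre.
Qed.

Lemma exchangeP u : valid u ->
  exists p x, [/\ p \in t, u = pre p.1 x & exchange u = pre p.2 x].
Proof.
move=> /entry_ofP[et eb]; exists (entry_of u), (suff (size (entry_of u).1) u).
by split => //; exact: beginsP.
Qed.

Lemma half_alike p : p \in t -> alike same_col p.1 p.2.
Proof.
move/half_entry; rewrite /entry_ok; case E: decode => [e|] //.
by case E': decode => [e'|] // h; exists e, e'.
Qed.

Lemma exchange_valid u : valid u -> valid (exchange u).
Proof.
move=> uv; have [p [x [pt ux ->]]] := exchangeP uv.
by apply: (alike_valid same_col_child (half_alike pt)); rewrite -ux.
Qed.

Lemma ends_vrel p x z : p \in t -> ends (pre p.1 z) x ->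
  exists2 x', vrel p x x' & ends (pre p.2 z) x'.
Proof.
move=> pt [M hM].
have step k : M <= size p.1 + k -> exists2 x', vrel p x x' &
    inc (decode (mkseq (pre p.2 z) (size p.2 + k).+1)) x'.
  move=> Mk; have := hM _ Mk; rewrite -!addnS !mkseq_pre.
  case E: decode => [f|] //= fx.
  have [f' [-> _ vs vt]] := vrel_cat (half_entry pt) E.
  move: fx; rewrite /incident !inE => /orP[]/eqP->.
    by exists (src f') => //=; rewrite /incident !inE eqxx.
  by exists (tgt f') => //=; rewrite /incident !inE eqxx orbT.
have [x' vx' _] := step M (leq_addl _ _).
exists x' => //; exists (size p.2 + M) => n hn.
have h2 : size p.2 <= n := leq_trans (leq_addr _ _) hn.
have [|x'' vx''] := step (n - size p.2).
  apply: leq_trans (leq_addl _ _).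
  by rewrite -(leq_add2l (size p.2)) subnKC.
by rewrite subnKC // (vrel_fun pt pt vx' vx'').
Qed.

(** This is what makes prefix exchange compatible with gluing. *)
Lemma exchange_ends u v x : valid u -> valid v -> ends u x -> ends v x ->
  exists x', ends (exchange u) x' /\ ends (exchange v) x'.
Proof.
move=> uv vv.
have [p [y [pt -> ->]]] := exchangeP uv; have [q [z [qt -> ->]]] := exchangeP vv.
move=> /(ends_vrel pt)[x1 r1 e1] /(ends_vrel qt)[x2 r2 e2].
by exists x1; split => //; rewrite (vrel_fun pt qt r1 r2).
Qed.

Lemma exchange_local u n : valid u -> exists M, forall v,
  mkseq v M = mkseq u M -> mkseq (exchange v) n = mkseq (exchange u) n.
Proof.
move=> /entry_ofP[et eb]; set p := entry_of u in et eb.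
exists (size p.1 + n) => v h.
have vb : begins v p.1.
  rewrite /begins; apply/eqP; rewrite -(eqP eb).
  by move/eqP: h; rewrite !mkseqD eqseq_cat ?size_mkseq // => /andP[/eqP].
rewrite /exchange (entry_of_uniq et vb) -/p.
apply/eq_in_map => i; rewrite mem_iota add0n => /andP[_ i_n].
rewrite /pre; case: (ltnP i (size p.2)) => s; first exact: set_nth_default.
rewrite !nth_default // /suff; apply: mkseq_eq h _.
by rewrite ltn_add2l; apply: leq_ltn_trans (leq_subr _ _) i_n.
Qed.

End Half.

Section TableHomeo.
Context (u0 : Omega S).

Definition table_fun t (p : limit_space S) : limit_space S :=
  pt u0 (exchange t (letter_at (repr (p : {eq_quot glue_equiv S})))).

Lemma table_fun_pt N t u : half_ok N t -> valid u ->
  table_fun t (pt u0 u) = pt u0 (exchange t u).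
Proof.
move=> ok uv; rewrite /table_fun; set U := repr _.
have Uv := letter_valid U.
have : pt u0 (letter_at U) = pt u0 u by rewrite pt_letter /point_of reprK.
move/(pt_eq u0 Uv uv) => h.
apply/pt_eq; [exact: exchange_valid ok _ Uv|exact: exchange_valid ok _ uv|].
case: h => [->|[x [ux vx]]]; [by left|right].
exact: exchange_ends ok _ _ _ Uv uv ux vx.
Qed.

Lemma exchangeK N t u : table_ok N t -> valid u -> exchange (swap t) (exchange t u) = u.
Proof.
case/andP => ok ok' uv; have [p [x [pt -> ->]]] := exchangeP ok uv.
by rewrite (exchange_pre (p := (p.2, p.1)) ok') //; apply/mapP; exists p.
Qed.

Lemma table_funK N t : table_ok N t -> cancel (table_fun t) (table_fun (swap t)).
Proof.
move=> /[dup] tok /andP[ok ok'] p; have [u uv ->] := ptP u0 p.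
rewrite (table_fun_pt ok uv) (table_fun_pt ok') ?(exchangeK tok) //.
exact: exchange_valid ok _ uv.
Qed.

Lemma swapK t : swap (swap t) = t.
Proof. by rewrite /swap -map_comp map_id_in // => -[]. Qed.

Lemma table_fun_continuous N t : half_ok N t -> continuous (table_fun t).
Proof.
move=> ok.
pose F (U : Omega S) := omega (exchange_valid ok (letter_valid U)).
have FE : table_fun t \o \pi_({eq_quot glue_equiv S}) =
    \pi_({eq_quot glue_equiv S}) \o F.
  apply/funext => U /=; have := table_fun_pt ok (letter_valid U).
  rewrite pt_letter (pt_valid _ (exchange_valid ok (letter_valid U))).
  by [].
apply/(@quotient_continuous _ {eq_quot glue_equiv S}); rewrite FE.
move=> U; apply: continuous_comp; last exact: pi_continuous.
apply: continuous_cylinder => V M.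
have [K hK] := exchange_local ok M (letter_valid V).
by exists K => W; rewrite /cylinder /= => /hK.
Qed.

Lemma table_homeo N t : table_ok N t -> exists f : homeo (limit_space S),
  forall p, p \in t -> maps_canonically f p.1 p.2.
Proof.
move=> /[dup] tok /andP[ok ok'].
have tok' : table_ok N (swap t) by rewrite /table_ok swapK ok ok'.
have K' : cancel (table_fun (swap t)) (table_fun t).
  by have := table_funK tok'; rewrite swapK.
exists (Homeo (table_funK tok) K' (table_fun_continuous ok) (table_fun_continuous ok')).
move=> p pt; apply/(canonP u0) => x vx _ /=.
by rewrite (table_fun_pt ok) // (exchange_pre ok).
Qed.

End TableHomeo.
End Tables.

(** * Words of the basilica *)

Section WordEnds.
Context (S : replacement_system).
Implicit Types (w : seq (letter S)) (u : nat -> letter S).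

Lemma inc_word_end w x :
  inc (decode w) x = (word_end true w == Some x) || (word_end false w == Some x).
Proof.
rewrite /word_end; case: decode => [e|] //=.
by rewrite /incident !inE !(inj_eq Some_inj) ![x == _]eq_sym.
Qed.

Lemma word_end_new b w z n : word_end b w = Some (inr (z, n)) -> size z < size w.
Proof. by case/word_end_incident => e /decode_new h /h/andP[]. Qed.

Lemma word_end_decode b w x : word_end b w = Some x -> decode w.
Proof. by rewrite /word_end; case: decode. Qed.

Lemma decode_word_end b w : decode w -> exists x, word_end b w = Some x.
Proof. by rewrite /word_end; case: decode => [e|] // _; exists (endpoint b e). Qed.

Lemma ends_limit w u x : valid (pre w u) ->
  (forall n, inc (decode (w ++ mkseq u n)) x) -> ends (pre w u) x.
Proof.
move=> v h; exists (size w) => n hn.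
by rewrite -(subnKC hn) -addnS mkseq_pre; exact: h.
Qed.

End WordEnds.

Section Basilica.
Local Notation word := (seq bas_letter).
Local Notation B := basilica_system.
Implicit Types (w y : seq (letter basilica_system)) (u v : nat -> letter basilica_system).

Lemma bas_child (e : edge B) c : child e c =
  match c with
  | l_in => Some (Arc (rcons (lab e) l_in) (src e) (inr (lab e, tt)) tt)
  | l_out => Some (Arc (rcons (lab e) l_out) (inr (lab e, tt)) (tgt e) tt)
  | l_loop => Some (Arc (rcons (lab e) l_loop) (inr (lab e, tt)) (inr (lab e, tt)) tt)
  | _ => None
  end.
Proof. by case: c. Qed.

Definition bas_tail (c : bas_letter) := c \in [:: l_in; l_out; l_loop].

Lemma bas_decode_rcons w c : w != [::] ->
  decode (rcons w c : seq (letter B)) = (decode w && bas_tail c) :> bool.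
Proof.
move=> w0; rewrite decode_rcons //; case: decode => [e|] //=.
by rewrite bas_child; case: c.
Qed.

Lemma bas_decode_cat w y : w != [::] -> decode (w ++ y) = (decode w && all bas_tail y) :> bool.
Proof.
move=> w0; elim/last_ind: y => [|y c IH]; first by rewrite cats0 andbT.
rewrite -rcons_cat bas_decode_rcons ?IH ?all_rcons.
  by rewrite -andbA; congr (_ && _); rewrite andbC.
exact: cat_neq0.
Qed.

Lemma bas_valid w u : decode w -> valid (pre w u) <-> forall n, bas_tail (u n).
Proof.
move=> dw; have w0 : w != [::] by case: w dw.
split=> [v n|h].
  have := v (size w + n); rewrite -addnS mkseq_pre bas_decode_cat // => /andP[_].
  by rewrite (mkseqS u n) all_rcons => /andP[].
apply: (@valid_far _ _ (size w)) => n hn.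
rewrite -(subnKC hn) -addnS mkseq_pre bas_decode_cat // dw andTb.
by apply/allP => c /mapP[i _ ->].
Qed.

Lemma bas_word_end_rcons b w c : decode w ->
  word_end b (rcons w c : seq (letter B)) =
  match c with
  | l_in => if b then word_end b w else Some (inr (w, tt))
  | l_out => if b then Some (inr (w, tt)) else word_end b w
  | l_loop => Some (inr (w, tt))
  | _ => None
  end.
Proof.
rewrite /word_end; case: (eqVneq w [::]) => [->//|w0].
rewrite decode_rcons //; case E: decode => [e|] // _ /=.
by rewrite bas_child (decode_lab E); case: c; case: b.
Qed.

Definition end_tail (b : bool) : nat -> letter B := fun=> if b then l_in else l_out.

Lemma end_tailP b n : bas_tail (end_tail b n). Proof. by case: b. Qed.

Lemma word_end_tail b w n : decode w ->
  word_end b (w ++ mkseq (end_tail b) n) = word_end b w.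
Proof.
move=> dw; have w0 : w != [::] by case: w dw.
elim: n => [|n IH]; first by rewrite cats0.
rewrite mkseqS -rcons_cat bas_word_end_rcons; first by rewrite IH; case: (b).
by rewrite bas_decode_cat // dw; apply/allP => c /mapP[i _ ->]; exact: end_tailP.
Qed.

Lemma valid_end_tail b w : decode w -> valid (pre w (end_tail b)).
Proof. by move=> dw; apply/bas_valid => // n; exact: end_tailP. Qed.

Lemma ends_end_tail b w x : word_end b w = Some x -> ends (pre w (end_tail b)) x.
Proof.
move=> h; have dw := word_end_decode h; apply: ends_limit; first exact: valid_end_tail.
by move=> n; rewrite inc_word_end; case: b h => h; rewrite word_end_tail // h eqxx ?orbT.
Qed.

Lemma bas_ends_step u x N n : valid u ->
  (forall n, N <= n -> inc (decode (mkseq u n.+1)) x) -> N <= n ->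
  exists b, u n.+1 = end_tail b n /\ word_end b (mkseq u n.+2) = Some x.
Proof.
move=> uv h Nn; have := h _ Nn; have := h _ (leqW Nn).
have := uv n.+1; rewrite (mkseqS u n.+1) bas_decode_rcons //.
set w := mkseq u n.+1 => /andP[dw]; rewrite !inc_word_end.
have new : (Some (inr (w, tt)) == Some x) = false \/ ~~ inc (decode w) x.
  case: eqP => [|_]; [move=> [<-]; right|by left].
  rewrite inc_word_end; apply/negP => /orP[]/eqP /word_end_new; rewrite ltnn //.
rewrite inc_word_end in new.
rewrite !bas_word_end_rcons //.
case: (u n.+1) => // _.
- case: new => [->|/negbTE->] //; rewrite orbF => /eqP hx _.
  by exists true; split => //; rewrite bas_word_end_rcons.
- case: new => [->|/negbTE->] //; rewrite orFb => /eqP hx _.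
  by exists false; split => //; rewrite bas_word_end_rcons.
- by case: new => [->|/negbTE->].
Qed.

(** Of the three children of a non-loop, only [l_in] touches the source and only
    [l_out] the target, so a word shrinking to a vertex is eventually
    constant. *)
Lemma bas_ends u x : valid u -> ends u x -> exists w b,
  [/\ decode w, u = pre w (end_tail b) & word_end b w = Some x].
Proof.
move=> uv [N hN].
have [b [ub wb]] := bas_ends_step uv hN (leqnn N).
(* The letter cannot switch: the end opposite to the one kept is newer than x. *)
have cst k : u (N.+1 + k) = end_tail b 0 /\ word_end b (mkseq u (N.+1 + k).+1) = Some x.
  elim: k => [|k [IH1 IH2]]; first by rewrite addn0.
  have [b' [ub' wb']] := bas_ends_step uv hN (leqW (leq_addr k N)).
  rewrite addnS; have [e|ne] := eqVneq b' b; first by rewrite -e.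
  exfalso.
  have dw : decode (mkseq u (N + k).+1) := uv _.
  have dw' : decode (mkseq u (N + k).+2) := uv _.
  have := hN _ (leq_addr k N).
  move: wb'; rewrite (mkseqS u (N + k).+2) bas_word_end_rcons // ub'.
  have -> : word_end b' (mkseq u (N + k).+2) = Some (inr (mkseq u (N + k).+1, tt)).
    rewrite (mkseqS u (N + k).+1) bas_word_end_rcons // -addSn IH1.
    by case: b b' ne {ub wb IH1 IH2 ub'} => -[].
  move=> xE; have {xE} xE : Some x = Some (inr (mkseq u (N + k).+1, tt)).
    by case: b' xE {ub' ne} => /= ->.
  by rewrite inc_word_end xE => /orP[]/eqP/word_end_new; rewrite ltnn.
exists (mkseq u N.+2), b; split; [exact: uv| |exact: wb].
rewrite -{1}(mkseq_suff N.+2 u); congr pre; apply/funext => k.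
by rewrite /suff addSnnS; case: (cst k.+1).
Qed.

End Basilica.

Section BasilicaGroup.
Local Notation B := basilica_system.
Implicit Types (w y : seq (letter basilica_system)) (u v : nat -> letter basilica_system).

Definition loop_tail : nat -> letter B := fun=> l_loop.

Lemma loop_generic w : decode w -> generic (pre w loop_tail).
Proof.
move=> dw; have v : valid (pre w loop_tail) by apply/bas_valid.
split=> // x /(bas_ends v)[w' [b [_ h _]]].
have := congr1 (fun u => u (size w + size w')) h.
rewrite /pre !nth_default ?leq_addl ?leq_addr // /loop_tail /end_tail.
by case: b {h}.
Qed.

Definition bas_point : Omega B := omega (loop_generic (isT : decode ([:: e_p] : seq (letter B)))).1.

Definition loopness : rel (edge B) := fun e e' => is_loop e == is_loop e'.

Lemma is_loop_child (e f : edge B) c : decode (lab e) = Some e -> child e c = Some f ->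
  is_loop f = (c == l_loop).
Proof.
move=> de; rewrite bas_child; case: c => // -[<-]; rewrite /is_loop /=.
- apply/negbTE/eqP => h; have := @decode_new _ _ _ (lab e) tt de.
  by rewrite /incident h mem_head => /(_ isT); rewrite ltnn andbF.
- apply/negbTE/eqP => h; have := @decode_new _ _ _ (lab e) tt de.
  by rewrite /incident -h !inE eqxx orbT => /(_ isT); rewrite ltnn andbF.
- by rewrite eqxx.
Qed.

Lemma loopness_child (e e' : edge B) c f : decode (lab e) = Some e ->
  decode (lab e') = Some e' -> loopness e e' -> child e c = Some f ->
  exists2 f', child e' c = Some f' & loopness f f'.
Proof.
move=> de de' _ ec; have : child e' c by move: ec; rewrite !bas_child; case: c.
case E: child => [f'|] // _; exists f' => //.
by rewrite /loopness (is_loop_child de ec) (is_loop_child de' E).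
Qed.

Lemma loopness_refl : reflexive loopness. Proof. by move=> e; exact: eqxx. Qed.
Lemma loopness_sym : symmetric loopness. Proof. by move=> e e'; exact: eq_sym. Qed.
Lemma loopness_trans : transitive loopness.
Proof. by move=> e e' e'' /eqP h /eqP h'; rewrite /loopness h h'. Qed.

Lemma bas_generic_in w : decode w -> exists2 u : nat -> letter B, generic u & begins u w.
Proof. by move=> dw; exists (pre w loop_tail); [exact: loop_generic|exact: begins_pre]. Qed.

Lemma T_B_subgroup : is_subgroup T_B.
Proof.
exact: (rearrangements_subgroup bas_point loopness_refl loopness_sym loopness_trans
  loopness_child bas_generic_in).
Qed.

Lemma T_BP (f : homeo basilica) :
  T_B f <-> exists n, level_maps bas_point loopness n f.
Proof. exact: (rearrangementP bas_point loopness_child bas_generic_in). Qed.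

End BasilicaGroup.

(** * Words of the airplane *)

Section Airplane.
Local Notation A := airplane_system.
Implicit Types (w y : seq (letter airplane_system)) (u v : nat -> letter airplane_system).

Definition letter_col (c : air_letter) : air_colour :=
  match c with e_U | e_D | r_1 | r_2 | l_u | l_d => Red | _ => Blue end.

Definition follows (k : air_colour) (c : air_letter) : bool :=
  c \in if k is Red then [:: r_1; r_2; l_s] else [:: b_minus; b_plus; l_u; l_d].

Lemma air_child (e : edge A) c : child e c =
  match col e, c with
  | Red, r_1 => Some (Arc (rcons (lab e) r_1) (src e) (inr (lab e, n_m)) Red)
  | Red, r_2 => Some (Arc (rcons (lab e) r_2) (inr (lab e, n_m)) (tgt e) Red)
  | Red, l_s => Some (Arc (rcons (lab e) l_s) (inr (lab e, n_m)) (inr (lab e, n_w)) Blue)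
  | Blue, b_minus => Some (Arc (rcons (lab e) b_minus) (inr (lab e, n_x)) (src e) Blue)
  | Blue, b_plus => Some (Arc (rcons (lab e) b_plus) (inr (lab e, n_y)) (tgt e) Blue)
  | Blue, l_u => Some (Arc (rcons (lab e) l_u) (inr (lab e, n_y)) (inr (lab e, n_x)) Red)
  | Blue, l_d => Some (Arc (rcons (lab e) l_d) (inr (lab e, n_x)) (inr (lab e, n_y)) Red)
  | _, _ => None
  end.
Proof. by rewrite /child; case: (col e); case: c. Qed.

Lemma air_col w e : decode w = Some e -> col e = letter_col (last e_L w).
Proof.
elim/last_ind: w e => [//|w c IH] e; rewrite last_rcons.
case: (eqVneq w [::]) => [->|w0].
  by rewrite /= /base; case: c => //= -[<-].
rewrite decode_rcons //; case: decode => [f|] //=; rewrite air_child.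
by case: (col f); case: c => //= -[<-].
Qed.

Lemma air_decode_rcons w c : w != [::] -> decode (rcons w c : seq (letter A)) =
  (decode w && follows (letter_col (last e_L w)) c) :> bool.
Proof.
move=> w0; rewrite decode_rcons //; case E: decode => [e|] //=.
by rewrite -(air_col E) air_child; case: (col e); case: c.
Qed.

Definition air_tail (k : air_colour) (x : nat -> letter A) :=
  follows k (x 0) /\ forall n, follows (letter_col (x n)) (x n.+1).

Lemma air_valid w x : decode w ->
  valid (pre w x) <-> air_tail (letter_col (last e_L w)) x.
Proof.
move=> dw; have w0 : w != [::] by case: w dw.
have wn n : w ++ mkseq x n != [::].
  exact: cat_neq0.
split=> [v|[h0 hS]].
  have d n : decode (w ++ mkseq x n.+1) by rewrite -mkseq_pre addnS.
  split=> [|n].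
    by have := d 0; rewrite mkseqS -rcons_cat air_decode_rcons // cats0 => /andP[].
  have := d n.+1; rewrite mkseqS -rcons_cat air_decode_rcons // => /andP[_].
  by rewrite mkseqS -rcons_cat last_rcons.
apply: (@valid_far _ _ (size w)) => n hn; rewrite -(subnKC hn) -addnS mkseq_pre.
elim: (n - size w) => [|k IH].
  by rewrite mkseqS -rcons_cat air_decode_rcons // cats0 dw.
rewrite (mkseqS x k.+1) -rcons_cat air_decode_rcons // IH.
by rewrite (mkseqS x k) -rcons_cat last_rcons; exact: hS.
Qed.

(** A tail turning at each step along a red cell, hence shrinking to no
    vertex. *)
Definition winding : nat -> letter A := fun n => if odd n then r_2 else r_1.

Lemma winding_tail : air_tail Red winding.
Proof. by split=> // n; rewrite /winding /=; case: odd. Qed.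

(** The target of the child [r_1] is new and the source of its child [r_2] is
    newer, so a vertex cannot survive the turn. *)
Lemma no_turn u x : valid u -> ends u x ->
  exists N, forall n, N <= n -> ~ (u n.+1 = r_1 /\ u n.+2 = r_2).
Proof.
move=> uv [N hN]; exists N => n Nn [u1 u2].
have := hN _ Nn; have := hN _ (leqW (leqW Nn)); have := uv n; have := uv n.+2.
rewrite (mkseqS u n.+2) (mkseqS u n.+1) u1 u2.
set w := mkseq u n.+1; case E: (decode w) => [e|] //; have [le _] := decode_full E.
rewrite !decode_rcons // ?E /=.
rewrite air_child; case: (col e) => //=; rewrite ?air_child /= => _ _.
have new z k : z = inr (w, k) -> incident e z = false.
  move=> ->; apply/negP => /(decode_new E); rewrite ltnn andbF //.
have new' z k : z = inr (rcons w r_1, k) -> incident e z = false.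
  by move=> ->; apply/negP => /(decode_new E); rewrite size_rcons ltnNge ltnW // andbF.
rewrite {1}/incident !inE /= => /orP[]/eqP->.
  by rewrite (new' _ n_m) // le.
by rewrite (new _ n_m) // le.
Qed.

Lemma winding_generic w : valid (pre w winding) -> generic (pre w winding).
Proof.
move=> v; split=> // x /(no_turn v)[N hN].
have h k : pre w winding (size w + k) = winding k.
  by rewrite /pre nth_default ?leq_addr // addKn.
pose n := size w + N.*2.
have Nn : N <= n by rewrite /n -addnn addnA leq_addl.
apply: (hN n.+1 (leqW Nn)).
by rewrite /n -!addnS !h /winding /= odd_double.
Qed.

(** What to insert after an edge of colour k before [winding] can follow; the
    two choices of b give different next letters. *)
Definition stem (k : air_colour) (b : bool) : seq (letter A) :=
  match k, b with Red, true => [:: r_2] | Red, false => [::]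
                | Blue, true => [:: l_u] | Blue, false => [:: l_d] end.

Lemma stem_decode w b : decode w -> decode (w ++ stem (letter_col (last e_L w)) b).
Proof.
move=> dw; have w0 : w != [::] by case: (w) dw.
by case E: (letter_col (last e_L w)); case: b; rewrite ?cats0 // cats1 air_decode_rcons // dw E.
Qed.

Lemma stem_valid w b : decode w ->
  valid (pre (w ++ stem (letter_col (last e_L w)) b) winding).
Proof.
move=> dw; apply/air_valid; first exact: stem_decode.
have -> : letter_col (last e_L (w ++ stem (letter_col (last e_L w)) b)) = Red.
  by case E: (letter_col (last e_L w)); case: b; rewrite ?cats0 ?cats1 ?last_rcons.
exact: winding_tail.
Qed.

Lemma air_generic_in w : decode w -> exists2 u : nat -> letter A, generic u & begins u w.
Proof.
move=> dw; exists (pre (w ++ stem (letter_col (last e_L w)) true) winding).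
  exact/winding_generic/stem_valid.
by rewrite pre_cat begins_pre.
Qed.

Definition air_point : Omega A :=
  omega (stem_valid true (isT : decode ([:: e_L] : seq (letter A)))).

Lemma same_col_refl : reflexive (@same_col A). Proof. by move=> e; exact: eqxx. Qed.
Lemma same_col_sym : symmetric (@same_col A). Proof. by move=> e e'; exact: eq_sym. Qed.
Lemma same_col_trans : transitive (@same_col A).
Proof. by move=> e e' e'' /eqP h /eqP h'; rewrite /same_col h h'. Qed.

Lemma T_A_subgroup : is_subgroup T_A.
Proof.
exact: (rearrangements_subgroup air_point same_col_refl same_col_sym same_col_trans
  (@same_col_child A) air_generic_in).
Qed.

Lemma T_AP (f : homeo airplane) :
  T_A f <-> exists n, level_maps air_point (@same_col A) n f.
Proof. exact: (rearrangementP air_point (@same_col_child A) air_generic_in). Qed.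

End Airplane.

(** * The generators and their images *)

Section TableLevel.
Context (S : replacement_system) (u0 : Omega S) (R : rel (edge S)).
Hypothesis R_child : forall e e' c f, decode (lab e) = Some e ->
  decode (lab e') = Some e' -> R e e' -> child e c = Some f ->
  exists2 f', child e' c = Some f' & R f f'.

Lemma covering_level_maps N (t : seq (seq (letter S) * seq (letter S))) f :
  covering N t -> (forall p, p \in t -> maps u0 R f p.1 p.2) -> level_maps u0 R N f.
Proof.
move=> /allP cov tm w sw dw.
have /mapP[e en we] := decode_full_mem dw sw.
have /hasP[p pt /prefixP[y wy]] := cov _ en.
exists (p.2 ++ y); rewrite we wy; apply: maps_cat => //; first exact: tm.
by rewrite -wy -we.
Qed.

End TableLevel.

Notation airword := (seq (letter airplane_system)).
Notation basword := (seq (letter basilica_system)).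

(** The reversed entry of alpha is spelled out on the four children. *)
Definition alpha_table : seq (airword * airword) :=
  [:: ([:: e_L; b_plus], [:: e_L]); ([:: e_L; l_d], [:: e_U]); ([:: e_L; l_u], [:: e_D]);
      ([:: e_L; b_minus; b_minus], [:: e_R; b_minus; b_plus]);
      ([:: e_L; b_minus; b_plus], [:: e_R; b_minus; b_minus]);
      ([:: e_L; b_minus; l_u], [:: e_R; b_minus; l_d]);
      ([:: e_L; b_minus; l_d], [:: e_R; b_minus; l_u]);
      ([:: e_U], [:: e_R; l_u]); ([:: e_D], [:: e_R; l_d]); ([:: e_R], [:: e_R; b_plus])].

Definition beta_table : seq (airword * airword) :=
  [:: ([:: e_L], [:: e_U; l_s]); ([:: e_U], [:: e_U; r_1]);
      ([:: e_D; r_1], [:: e_U; r_2]); ([:: e_D; r_2], [:: e_D]);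
      ([:: e_D; l_s], [:: e_L]); ([:: e_R], [:: e_R])].

Definition gamma_table : seq (airword * airword) :=
  [:: ([:: e_L], [:: e_L]); ([:: e_D], [:: e_D]); ([:: e_R], [:: e_R]);
      ([:: e_U; r_1], [:: e_U; r_1; r_1]); ([:: e_U; l_s], [:: e_U; r_1; l_s]);
      ([:: e_U; r_2; r_1], [:: e_U; r_1; r_2]); ([:: e_U; r_2; l_s], [:: e_U; l_s]);
      ([:: e_U; r_2; r_2], [:: e_U; r_2])].

Definition delta_table : seq (airword * airword) :=
  [:: ([:: e_L], [:: e_R]); ([:: e_R], [:: e_L]); ([:: e_U], [:: e_D]); ([:: e_D], [:: e_U])].

Lemma alpha_table_ok : table_ok 2 alpha_table. Proof. by vm_compute. Qed.
Lemma beta_table_ok : table_ok 2 beta_table. Proof. by vm_compute. Qed.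
Lemma gamma_table_ok : table_ok 2 gamma_table. Proof. by vm_compute. Qed.
Lemma delta_table_ok : table_ok 2 delta_table. Proof. by vm_compute. Qed.

(** The image of [alpha_table] under the collapse, without the entries on the
    shrunken segment. *)
Definition alpha_bas : seq (basword * basword) :=
  [:: ([:: e_p; l_loop], [:: e_p]); ([:: e_p; l_in], [:: e_qp]); ([:: e_p; l_out], [:: e_pq]);
      ([:: e_qp], [:: e_q; l_out]); ([:: e_pq], [:: e_q; l_in]); ([:: e_q], [:: e_q; l_loop])].

Definition beta_bas : seq (basword * basword) :=
  [:: ([:: e_p], [:: e_qp; l_loop]); ([:: e_qp], [:: e_qp; l_in]);
      ([:: e_pq; l_in], [:: e_qp; l_out]); ([:: e_pq; l_out], [:: e_pq]);
      ([:: e_pq; l_loop], [:: e_p]); ([:: e_q], [:: e_q])].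

Definition gamma_bas : seq (basword * basword) :=
  [:: ([:: e_p], [:: e_p]); ([:: e_pq], [:: e_pq]); ([:: e_q], [:: e_q]);
      ([:: e_qp; l_in], [:: e_qp; l_in; l_in]); ([:: e_qp; l_loop], [:: e_qp; l_in; l_loop]);
      ([:: e_qp; l_out; l_in], [:: e_qp; l_in; l_out]); ([:: e_qp; l_out; l_loop], [:: e_qp; l_loop]);
      ([:: e_qp; l_out; l_out], [:: e_qp; l_out])].

Definition delta_bas : seq (basword * basword) :=
  [:: ([:: e_p], [:: e_q]); ([:: e_q], [:: e_p]); ([:: e_qp], [:: e_pq]); ([:: e_pq], [:: e_qp])].

Lemma alpha_bas_ok : table_ok 2 alpha_bas. Proof. by vm_compute. Qed.
Lemma beta_bas_ok : table_ok 2 beta_bas. Proof. by vm_compute. Qed.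
Lemma gamma_bas_ok : table_ok 2 gamma_bas. Proof. by vm_compute. Qed.
Lemma delta_bas_ok : table_ok 2 delta_bas. Proof. by vm_compute. Qed.

Definition follows_table S (t : seq (seq (letter S) * seq (letter S)))
    (f : limit_space S -> limit_space S) :=
  forall p, p \in t -> maps_canonically f p.1 p.2.

Lemma is_alphaP f : is_alpha f <-> follows_table alpha_table f.
Proof.
split=> [[[h1 h2 h3 [h4 h5 h6 h7]] h8 h9 h10] p|h].
  by rewrite !inE => /or4P[|||/or4P[|||/or4P[]]] /eqP->.
by split; [split => //; [..|split]|..]; (apply: (h (_, _)); by vm_compute).
Qed.

Lemma is_betaP f : is_beta f <-> follows_table beta_table f.
Proof.
split=> [[h1 h2 [h4 h5 h6] h8] p|h].
  by rewrite !inE => /or4P[|||/or3P[||]] /eqP->.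
by split; [..|split|]; (apply: (h (_, _)); by vm_compute).
Qed.

Lemma is_gammaP f : is_gamma f <-> follows_table gamma_table f.
Proof.
split=> [[h1 h2 h3 [h4 h5 h6 h7 h8]] p|h].
  by rewrite !inE => /or4P[|||/or4P[|||/orP[|]]] /eqP->.
by split; [..|split]; (apply: (h (_, _)); by vm_compute).
Qed.

Lemma is_deltaP f : is_delta f <-> follows_table delta_table f.
Proof.
split=> [[h1 h2 h3 h4] p|h].
  by rewrite !inE => /or4P[] /eqP->.
by split; (apply: (h (_, _)); by vm_compute).
Qed.

Lemma air_table_maps t f : all (@entry_ok _) t -> follows_table t f ->
  forall p, p \in t -> maps air_point (@same_col airplane_system) f p.1 p.2.
Proof.
move=> /allP ok h p pt; apply/mapsP; first exact: same_col_child.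
split; last exact: h.
have := ok _ pt; rewrite /entry_ok; case E: (decode p.1) => [e|] //.
by case E': (decode p.2) => [e'|] // c; exists e, e'.
Qed.

Lemma air_table_T t (f : homeo airplane) : table_ok 2 t -> follows_table t f -> T_A f.
Proof.
move=> /andP[/and3P[ok _ cov] _] h; apply/T_AP; exists 2.
by apply: (covering_level_maps (@same_col_child _) cov); exact: air_table_maps.
Qed.

Definition loop_ok (p : basword * basword) :=
  if (decode p.1, decode p.2) is (Some e, Some e') then loopness e e' else false.

Lemma bas_table_maps t f : all loop_ok t -> follows_table t f ->
  forall p, p \in t -> maps bas_point loopness f p.1 p.2.
Proof.
move=> /allP ok h p pt; apply/mapsP; first exact: loopness_child.
split; last exact: h.
have := ok _ pt; rewrite /loop_ok; case E: (decode p.1) => [e|] //.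
by case E': (decode p.2) => [e'|] // c; exists e, e'.
Qed.

Lemma bas_table_T t (f : homeo basilica) : table_ok 2 t -> all loop_ok t ->
  follows_table t f -> T_B f.
Proof.
move=> /andP[/and3P[_ _ cov] _] ok h; apply/T_BP; exists 2.
by apply: (covering_level_maps loopness_child cov); exact: bas_table_maps.
Qed.

(** * Canonical maps between cells of the basilica *)

Local Notation B := basilica_system.
Notation bpt := (pt bas_point).
Notation bmaps := (maps bas_point loopness).

Section BasilicaCells.
Implicit Types (w y : basword) (u v : nat -> letter basilica_system).
Implicit Types (f g : homeo basilica).

(** The last letter tells whether an edge is a loop; the default [e_p] only
    concerns the empty word, which names no edge. *)
Definition lword w := last e_p w \in [:: e_p; e_q; l_loop].

Lemma is_loop_lword w e : decode w = Some e -> is_loop e = lword w.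
Proof.
elim/last_ind: w e => [//|w c IH] e.
case: (eqVneq w [::]) => [->|w0].
  by rewrite /= /base; case: c => //= -[<-].
rewrite decode_rcons //; case E: decode => [f|] //= ec.
have df : decode (lab f) = Some f by rewrite (decode_lab E).
rewrite (is_loop_child df ec) /lword last_rcons.
by move: ec; rewrite bas_child; case: c.
Qed.

Lemma alike_lword w w' : alike loopness w w' <->
  [/\ decode w, decode w' & lword w = lword w'].
Proof.
split=> [[e [e' [h h' /eqP r]]]|].
  by rewrite h h'; split => //; rewrite -(is_loop_lword h) -(is_loop_lword h').
case; case E: (decode w) => [e|] // _; case E': (decode w') => [e'|] // _ h.
by exists e, e'; split => //; rewrite /loopness (is_loop_lword E) (is_loop_lword E') h.
Qed.

Lemma pt_end_eq b c w y : decode w -> decode y ->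
  bpt (pre w (end_tail b)) = bpt (pre y (end_tail c)) <-> word_end b w = word_end c y.
Proof.
move=> dw dy; have [x hx] := decode_word_end b dw.
have [z hz] := decode_word_end c dy; rewrite hx hz.
rewrite (pt_ends _ (valid_end_tail b dw) (valid_end_tail c dy)
  (ends_end_tail hx) (ends_end_tail hz)).
by split=> [->|[]].
Qed.

Lemma homeo_inj (X : topologicalType) (f : homeo X) : injective f.
Proof. exact: can_inj (@homeo_funK X f). Qed.

Lemma maps_decode f w w' : bmaps f w w' -> decode w /\ decode w'.
Proof. by case=> h _; split; [exact: alike_decode h|exact: alike_decode' h]. Qed.

Lemma maps_end_pt f w w' b : bmaps f w w' ->
  f (bpt (pre w (end_tail b))) = bpt (pre w' (end_tail b)).
Proof. by move=> h; rewrite h.2 //; apply: valid_end_tail; case: (maps_decode h). Qed.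

Lemma maps_end f w w' y y' b c : bmaps f w w' -> bmaps f y y' ->
  word_end b w = word_end c y <-> word_end b w' = word_end c y'.
Proof.
move=> h1 h2; have [d1 d1'] := maps_decode h1; have [d2 d2'] := maps_decode h2.
rewrite -!pt_end_eq // -(maps_end_pt b h1) -(maps_end_pt c h2).
by split=> [->|/homeo_inj].
Qed.

(** A homeomorphism preserves inclusion and disjointness of cells. *)
Lemma maps_prefix f w w' y y' : bmaps f w w' -> bmaps f y y' -> prefix w' y' ->
  prefix w y \/ prefix y w.
Proof.
move=> h1 h2 p; have [dy dy'] := maps_decode h2; have [dw dw'] := maps_decode h1.
have gy := loop_generic dy; have gy' := loop_generic dy'.
have b := prefix_begins p (begins_pre y' loop_tail).
have e := beginsP b; set z := suff _ _ in e.
have vz : valid (pre w z).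
  by apply: (alike_valid loopness_child (alike_sym loopness_sym h1.1)); rewrite -e; case: gy'.
have : bpt (pre y loop_tail) = bpt (pre w z).
  apply: (@homeo_inj _ f); rewrite h2.2; last by case: gy.
  by rewrite h1.2 // -e.
move/(pt_generic gy vz) => ez.
apply: (@begins_comparable _ (pre y loop_tail)); last exact: begins_pre.
by rewrite ez begins_pre.
Qed.

(** Two generic words with different letters right after w force w' to be no
    longer than w. *)
Lemma cell_prefix w w' : decode w ->
  (forall u, generic u -> begins u w -> begins u w') -> prefix w' w.
Proof.
move=> dw h.
have d1 : decode (rcons w l_in) by rewrite bas_decode_rcons ?dw //; case: (w) dw.
have h1 := h _ (loop_generic dw) (begins_pre _ _).
have h2 := h _ (loop_generic d1) (prefix_begins (prefix_rcons _ _) (begins_pre _ _)).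
have b1 : begins (pre w loop_tail) (rcons w l_loop).
  by rewrite -cats1 begins_pre_cat.
case: (leqP (size w') (size w)) => s.
  exact: begins_prefix h1 (begins_pre _ _) s.
have s1 : size (rcons w l_loop) <= size w' by rewrite size_rcons.
have s2 : size (rcons w l_in) <= size w' by rewrite size_rcons.
have := begins_prefix b1 h1 s1.
have := begins_prefix (begins_pre _ _) h2 s2.
rewrite !prefixE !size_rcons => /eqP -> /eqP/rcons_inj[] //.
Qed.

(** Equality of the image of a cell with a cell, base point included, with no
    canonicity; for loops this is how a homeomorphism moves half-spaces. *)
Definition onto f w w' :=
  [/\ forall u, valid u -> begins u w -> cell w' (f (bpt u)),
      forall u, valid u -> begins u w' -> cell w (f^-1%g (bpt u)) &
      f (bpt (pre w (end_tail true))) = bpt (pre w' (end_tail true))].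

Lemma homeo_mulE (X : topologicalType) (f g : homeo X) p : (f * g)%g p = f (g p). Proof. by []. Qed.
Lemma homeo_VK (X : topologicalType) (f : homeo X) p : f^-1%g (f p) = p. Proof. exact: homeo_funK. Qed.
Lemma homeo_KV (X : topologicalType) (f : homeo X) p : f (f^-1%g p) = p. Proof. exact: homeo_invK. Qed.

Lemma maps_mul f g w w' w'' : bmaps g w w' -> bmaps f w' w'' -> bmaps (f * g)%g w w''.
Proof. by move=> h h'; exact: (maps_comp loopness_trans loopness_child h h'). Qed.

Lemma maps_V f w w' : bmaps f w w' -> bmaps f^-1%g w' w.
Proof. exact: (maps_inv loopness_sym loopness_child (@homeo_funK _ f)). Qed.

Lemma maps_1 w : decode w -> bmaps (1%g : homeo basilica) w w.
Proof. exact: (maps_id bas_point loopness_refl). Qed.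

Lemma maps_app f w w' y : bmaps f w w' -> all bas_tail y -> bmaps f (w ++ y) (w' ++ y).
Proof.
move=> h a; apply: (maps_cat loopness_child h).
have [dw _] := maps_decode h; rewrite bas_decode_cat ?dw //; by case: (w) dw.
Qed.

Lemma maps_onto f w w' : bmaps f w w' -> onto f w w'.
Proof.
move=> h; split.
- move=> u uv uw; have [v [vv vw ->]] := maps_cell loopness_child h uv uw.
  exact: cell_pt.
- move=> u uv uw; have [v [vv vw ->]] := maps_cell loopness_child (maps_V h) uv uw.
  exact: cell_pt.
- exact: maps_end_pt.
Qed.

Lemma onto_mul f g w w' w'' : onto g w w' -> onto f w' w'' -> onto (f * g)%g w w''.
Proof.
move=> [h1 h2 h3] [k1 k2 k3]; split=> [u uv uw|u uv uw|].
- by have /(cellP bas_point)[v [vv vw e]] := h1 u uv uw; rewrite homeo_mulE e; exact: k1.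
- have /(cellP bas_point)[v [vv vw e]] := k2 u uv uw.
  by rewrite invgM homeo_mulE e; exact: h2.
- by rewrite homeo_mulE h3.
Qed.

Lemma onto_V f w w' : onto f w w' -> onto f^-1%g w' w.
Proof.
move=> [h1 h2 h3]; split=> //.
by rewrite -h3 homeo_VK.
Qed.

Lemma onto_sub f w w' y y' : onto f w w' -> onto f y y' -> decode y' ->
  prefix w y -> prefix w' y'.
Proof.
move=> [h1 _ _] [_ k2 _] dy p; apply: cell_prefix => // u ug uy.
have /(cellP bas_point)[v [vv vy e]] := k2 u ug.1 uy.
apply: (cell_generic (u0 := bas_point) ug); rewrite -(homeo_KV f (bpt u)) e; apply: h1 => //.
exact: prefix_begins p vy.
Qed.

Lemma prefix_anti (T : eqType) (w w' : seq T) : prefix w w' -> prefix w' w -> w = w'.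
Proof.
move=> h1 h2; have s1 := size_prefix h1; have s2 := size_prefix h2.
by move: h1; rewrite prefixE take_oversize // => /eqP.
Qed.

Lemma onto_uniq f w w' w'' : decode w' -> decode w'' -> onto f w w' -> onto f w w'' -> w' = w''.
Proof.
move=> d d' h h'; apply: prefix_anti.
  by apply: onto_sub h h' d' _; exact: prefix_refl.
by apply: onto_sub h' h d _; exact: prefix_refl.
Qed.

End BasilicaCells.

(** * Half-spaces of the basilica *)

Section HalfSpaces.
Implicit Types (w y t : basword) (u v : nat -> letter basilica_system).
Implicit Types (f g : homeo basilica).

Lemma decode_cons_tail w y : decode w -> all bas_tail y -> decode (w ++ y).
Proof. by move=> dw ay; rewrite bas_decode_cat ?dw //; case: (w) dw. Qed.

Lemma loop_ends w : decode w -> lword w -> word_end false w = word_end true w.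
Proof.
rewrite /word_end; case E: decode => [e|] // _.
by rewrite -(is_loop_lword E) /is_loop /= => /eqP ->.
Qed.

Lemma inside_loop w y b : lword w -> decode (w ++ y) -> w != [::] ->
  word_end b (w ++ y) = word_end true w \/
  exists z, word_end b (w ++ y) = Some (inr (w ++ z, tt)).
Proof.
move=> lw + w0; elim/last_ind: y b => [|y c IH] b.
  by rewrite cats0 => dw; left; case: b; rewrite ?loop_ends.
rewrite -rcons_cat => d.
have wy0 : w ++ y != [::] by exact: cat_neq0.
move: d; rewrite bas_decode_rcons // => /andP[d' tc].
rewrite bas_word_end_rcons //.
have {}IH b' := IH b' d'.
case: c tc => // _.
- by case: b; [exact: IH|right; exists y].
- by case: b; [right; exists y|exact: IH].
- by right; exists y.
Qed.

(** The only vertex joining the inside of a loop to the outside is its base: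
    every other vertex inside was created inside. *)
Lemma same_side w y1 y2 b c : lword w -> decode w -> decode y1 ->
  word_end b y1 = word_end c y2 -> word_end b y1 <> word_end true w ->
  prefix w y1 -> prefix w y2.
Proof.
move=> lw dw dy1 e ne /prefixP[y yE]; rewrite yE in e ne dy1.
have w0 : w != [::] by case: (w) dw.
case: (inside_loop b lw dy1 w0) => [//|[z h]].
rewrite h in e; have [e2 d2 inc2] := word_end_incident (esym e).
have /andP[p _] := decode_new d2 inc2.
exact: prefix_trans (prefix_prefix _ _) p.
Qed.

(** A point with one name inside a loop and another outside is a vertex that
    joins the two sides. *)
Lemma loop_base w u v : lword w -> decode w -> valid u -> valid v ->
  begins u w -> ~~ begins v w -> bpt u = bpt v ->
  bpt u = bpt (pre w (end_tail true)).
Proof.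
move=> lw dw uv vv uw vw /(pt_eq bas_point uv vv)[uv'|]; first by rewrite -uv' uw in vw.
case=> x [ux vx].
have [w1 [b [d1 uE h1]]] := bas_ends uv ux.
have [w2 [c [d2 vE h2]]] := bas_ends vv vx.
have split_end b' w' : pre w' (end_tail b') =
    pre (w' ++ mkseq (end_tail b') (size w)) (end_tail b').
  by rewrite pre_cat; congr pre; exact: (esym (mkseq_suff (size w) _)).
have k1 := word_end_tail b (size w) d1; have k2 := word_end_tail c (size w) d2.
rewrite uE split_end in uw; rewrite vE split_end in vw.
have p1 : prefix w (w1 ++ mkseq (end_tail b) (size w)).
  by apply: begins_prefix uw (begins_pre _ _) _; rewrite size_cat size_mkseq leq_addl.
have p2 : ~~ prefix w (w2 ++ mkseq (end_tail c) (size w)).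
  by apply: contra vw => p; apply: prefix_begins p _; exact: begins_pre.
have [e|ne] := eqVneq (word_end true w) (Some x).
  apply/(pt_ends bas_point uv (valid_end_tail true dw) ux (ends_end_tail e)).
  by [].
case/negP: p2; apply: (same_side (b := b) (c := c) lw dw _ _ _ p1).
- exact: word_end_decode (etrans k1 h1).
- by rewrite k1 k2 h1 h2.
rewrite k1 h1; by move=> e; rewrite -e eqxx in ne.
Qed.

Lemma vertex_loop w b : decode w -> exists y,
  [/\ lword y, decode y & word_end true y = word_end b w].
Proof.
elim/last_ind: w b => [//|w c IH] b.
case: (eqVneq w [::]) => [->|w0].
  by case: c b => // -[] // _; solve [by exists [:: e_p] | by exists [:: e_q]].
rewrite bas_decode_rcons // => /andP[dw tc]; rewrite bas_word_end_rcons //.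
have new : exists y, [/\ lword y, decode y & word_end true y = Some (inr (w, tt))].
  exists (rcons w l_loop); rewrite bas_decode_rcons // dw bas_word_end_rcons //.
  by rewrite /lword last_rcons.
by case: c tc => // _; case: b => //; exact: IH.
Qed.

(** All descendants of an edge at a given level are chained through vertices
    created inside it: by induction the descendants of each child are, and each
    child has a descendant at the new vertex of t. *)
Lemma connected k t (chi : basword -> bool) : decode t ->
  (forall y1 y2 b c z, size y1 = k -> size y2 = k -> all bas_tail y1 -> all bas_tail y2 ->
     word_end b (t ++ y1) = word_end c (t ++ y2) ->
     word_end b (t ++ y1) = Some (inr (t ++ z, tt)) -> chi (t ++ y1) = chi (t ++ y2)) ->
  forall y1 y2, size y1 = k -> size y2 = k -> all bas_tail y1 -> all bas_tail y2 ->
    chi (t ++ y1) = chi (t ++ y2).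
Proof.
elim: k t => [|k IH] t dt h y1 y2; first by move=> /size0nil -> /size0nil ->.
have dc c : bas_tail c -> decode (rcons t c).
  by move=> tc; rewrite bas_decode_rcons ?dt ?tc //; case: (t) dt.
pose side c := if c is l_in then false else true.
pose rep c : basword := c :: mkseq (end_tail (side c)) k.
have hub c : bas_tail c -> word_end (side c) (t ++ rep c) = Some (inr (t ++ [::], tt)).
  move=> tc; rewrite /rep -cat_rcons word_end_tail ?dc // bas_word_end_rcons // cats0.
  by case: c tc.
have repP c : bas_tail c -> size (rep c) = k.+1 /\ all bas_tail (rep c).
  move=> tc; rewrite /= size_mkseq tc; split => //.
  by apply/allP => d /mapP[i _ ->]; exact: end_tailP.
have to_rep y c : bas_tail c -> size y = k -> all bas_tail y ->
    chi (t ++ c :: y) = chi (t ++ rep c).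
  move=> tc sy ay; rewrite /rep -!cat_rcons; apply: IH => //.
  - exact: dc.
  - move=> z1 z2 b d z s1 s2 a1 a2; rewrite !cat_rcons => e hz.
    apply: (h _ _ b d (c :: z)) => //=; rewrite ?s1 ?s2 ?tc //.
  - by rewrite size_mkseq.
  - by apply/allP => d /mapP[i _ ->]; exact: end_tailP.
case: y1 => // c1 y1; case: y2 => // c2 y2 [s1] [s2] /andP[t1 a1] /andP[t2 a2].
rewrite (to_rep _ _ t1 s1 a1) (to_rep _ _ t2 s2 a2).
have [r1 r1'] := repP _ t1; have [r2 r2'] := repP _ t2.
by apply: (h _ _ (side c1) (side c2) [::]) => //; rewrite !hub.
Qed.

(** A tail along the circle that shrinks to no vertex. *)
Definition zigzag : nat -> letter basilica_system := fun n => if odd n then l_out else l_in.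

Lemma zigzag_generic w : decode w -> generic (pre w zigzag).
Proof.
move=> dw; have v : valid (pre w zigzag).
  by apply/bas_valid => // n; rewrite /zigzag; case: odd.
split=> // x /(bas_ends v)[w' [b [_ h _]]].
have E k : zigzag (size w' + k) = if b then l_in else l_out.
  have := congr1 (fun u => u (size w + (size w' + k))) h.
  rewrite /pre nth_default ?leq_addr // addKn => ->.
  by rewrite nth_default // addnCA leq_addr.
have := E 0; have := E 1; rewrite /zigzag addn1 addn0 /=.
by case: odd; case: (b).
Qed.

Lemma zigzag_loop a w : a \in [:: e_pq; e_qp] -> lword w -> decode w ->
  ~~ begins (pre [:: a] zigzag) w.
Proof.
move=> ha lw dw; apply/negP => /eqP h.
have : size w != 0 by rewrite size_eq0; case: (w) dw.
case E: (size w) h => [//|n] h _; move: lw; rewrite -h mkseqS /lword last_rcons.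
case: n {E h} => [|n]; first by move: ha; rewrite !inE => /orP[]/eqP->.
by rewrite /pre nth_default // /zigzag; case: odd.
Qed.

End HalfSpaces.

Section Connectivity.
Context (iota : homeo basilica).
Hypothesis iota_in : bmaps iota [:: e_p; l_in] [:: e_pq].
Hypothesis iota_out : bmaps iota [:: e_p; l_out] [:: e_qp].
Hypothesis iota_loop : bmaps iota [:: e_p; l_loop] [:: e_q].
Hypothesis iota_pq : bmaps iota [:: e_pq] [:: e_p; l_in].
Hypothesis iota_qp : bmaps iota [:: e_qp] [:: e_p; l_out].
Hypothesis iota_q : bmaps iota [:: e_q] [:: e_p; l_loop].
Implicit Types (w y t : basword) (u v : nat -> letter basilica_system).
Implicit Types (f g : homeo basilica).

Definition base_pt := bpt (pre ([:: e_p] : basword) (end_tail true)).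

Lemma valid_head u : valid u -> u 0 \in [:: e_pq; e_qp; e_p; e_q].
Proof. by move/(_ 0) => /=; case: (u 0). Qed.

Lemma valid_tail u n : valid u -> bas_tail (u n.+1).
Proof.
by move/(_ n.+1); rewrite mkseqS bas_decode_rcons // => /andP[].
Qed.

Lemma begins1 u a : begins u ([:: a] : basword) = (u 0 == a).
Proof. by rewrite /begins /= eqseq_cons andbT. Qed.

Lemma begins2 u a b : begins u ([:: a; b] : basword) = (u 0 == a) && (u 1 == b).
Proof. by rewrite /begins /= !eqseq_cons andbT. Qed.

Lemma iota_in_cell u : valid u -> begins u ([:: e_p] : basword) ->
  exists2 v, valid v /\ ~~ begins v ([:: e_p] : basword) & iota (bpt u) = bpt v.
Proof.
rewrite begins1 => uv u0.
have go w w' : bmaps iota w w' -> begins u w -> (head e_p w' != e_p) ->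
    exists2 v, valid v /\ ~~ begins v ([:: e_p] : basword) & iota (bpt u) = bpt v.
  move=> h uw nh; have [v [vv vw e]] := maps_cell loopness_child h uv uw.
  exists v => //; split => //; rewrite begins1; move/eqP: vw.
  have [_ dw'] := maps_decode h.
  by case: w' nh dw' {h} => //= a w' na _ [->].
have := valid_tail 0 uv; rewrite /bas_tail !inE => /or3P[] u1.
- by apply: go iota_in _ _ => //; rewrite begins2 u0.
- by apply: go iota_out _ _ => //; rewrite begins2 u0.
- by apply: go iota_loop _ _ => //; rewrite begins2 u0.
Qed.

Lemma iota_out_cell u : valid u -> ~~ begins u ([:: e_p] : basword) ->
  cell ([:: e_p] : basword) (iota (bpt u)).
Proof.
rewrite begins1 => uv u0.
have go a c : bmaps iota [:: a] [:: e_p; c] -> u 0 == a ->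
    cell ([:: e_p] : basword) (iota (bpt u)).
  move=> h ua; have ub : begins u ([:: a] : basword) by rewrite begins1.
  have [v [vv vw ->]] := maps_cell loopness_child h uv ub.
  apply: cell_pt => //; apply: prefix_begins vw; exact: (@prefix_prefix _ [:: e_p] [:: c]).
have := valid_head uv; rewrite !inE (negbTE u0) orFb => /or3P[] ua.
- exact: go iota_pq ua.
- exact: go iota_qp ua.
- exact: go iota_q ua.
Qed.

Lemma iota_involutive p : iota (iota p) = p.
Proof.
have go a b w u : bmaps iota w [:: a; b] -> bmaps iota [:: a; b] w -> valid u ->
    begins u w -> iota (iota (bpt u)) = bpt u.
  move=> h h' uv uw; move: (suff _ _) (beginsP uw) uv => x -> uv.
  by rewrite h.2 // h'.2 //; exact: (alike_valid loopness_child h.1).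
have go' a b w u : bmaps iota w [:: a; b] -> bmaps iota [:: a; b] w -> valid u ->
    begins u [:: a; b] -> iota (iota (bpt u)) = bpt u.
  move=> h h' uv uw; move: (suff _ _) (beginsP uw) uv => x -> uv.
  by rewrite h'.2 // h.2 //; exact: (alike_valid loopness_child h'.1).
have [u uv ->] := ptP bas_point p.
have := valid_head uv; rewrite !inE => /or4P[] u0.
- by apply: go iota_pq iota_in uv _; rewrite begins1.
- by apply: go iota_qp iota_out uv _; rewrite begins1.
- have := valid_tail 0 uv; rewrite /bas_tail !inE => /or3P[] u1.
  + by apply: go' iota_pq iota_in uv _; rewrite begins2 u0.
  + by apply: go' iota_qp iota_out uv _; rewrite begins2 u0.
  + by apply: go' iota_q iota_loop uv _; rewrite begins2 u0.
- by apply: go iota_q iota_loop uv _; rewrite begins1.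
Qed.

Lemma iota_V : iota^-1%g = iota.
Proof. by apply: homeo_eq => p; rewrite -{1}(iota_involutive p) homeo_VK. Qed.

Lemma base_pt_pq : base_pt = bpt (pre ([:: e_pq] : basword) (end_tail true)).
Proof. by apply/pt_end_eq. Qed.

Lemma iota_base : iota base_pt = base_pt.
Proof.
rewrite {1}base_pt_pq (maps_end_pt _ iota_pq).
by apply/pt_end_eq.
Qed.

(** Removing the base point of [e_p] leaves two connected pieces, and so does
    removing its image, the base of a loop w; hence f matches the pieces.  The
    argument runs on a full expansion where f is canonical: for an edge y, chi y
    tells whether its image lies in the loop w, and chi is constant on either
    side of the base point by [connected] and [same_side]. *)
Lemma half_space f : T_B f -> exists w, [/\ lword w, decode w &
  onto f [:: e_p] w \/ onto (f * iota)%g [:: e_p] w].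
Proof.
move=> /T_BP[n fn].
have /choice[F hF] : forall y : basword, exists y' : basword,
    size y = n.+1 -> decode y -> bmaps f y y'.
  move=> y; have [sy|] := eqVneq (size y) n.+1; last by move/eqP=> ne; exists [::].
  have [dy|] := boolP (isSome (decode y)); last by move/negP=> nd; exists [::].
  by have [y' h] := fn y sy dy; exists y'.
pose y0 : basword := [:: e_p] ++ mkseq (end_tail true) n.
have tl b k : all bas_tail (mkseq (end_tail b) k : basword).
  by apply/allP => d /mapP[i _ ->]; exact: end_tailP.
have dy0 : decode y0 by apply: decode_cons_tail.
have sy0 : size y0 = n.+1 by rewrite /= size_mkseq.
have h0 := hF _ sy0 dy0.
have ey0 : word_end true y0 = word_end true ([:: e_p] : basword) by rewrite word_end_tail.
have [w [lw dw ew]] := vertex_loop true (maps_decode h0).2.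
have fbase : f base_pt = bpt (pre w (end_tail true)).
  have -> : base_pt = bpt (pre y0 (end_tail true)) by apply/pt_end_eq.
  by rewrite (maps_end_pt _ h0); apply/pt_end_eq => //; exact: (maps_decode h0).2.
have w0 : w != [::] by case: (w) dw.
pose chi y := prefix w (F y).
have link y1 y2 b c : size y1 = n.+1 -> size y2 = n.+1 -> decode y1 -> decode y2 ->
    word_end b y1 = word_end c y2 -> word_end b y1 <> word_end true ([:: e_p] : basword) ->
    chi y1 = chi y2.
  move=> s1 s2 d1 d2 e ne.
  have h1 := hF _ s1 d1; have h2 := hF _ s2 d2.
  have e' := (maps_end b c h1 h2).1 e.
  have ne' : word_end b (F y1) <> word_end true w.
    rewrite ew => /(maps_end b true h1 h0).2; rewrite ey0; exact: ne.
  apply/idP/idP; apply: same_side => //.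
  - exact: (maps_decode h1).2.
  - exact: e'.
  - by [].
  - exact: (maps_decode h2).2.
  - exact: esym e'.
  - by rewrite -e'.
have block a y1 y2 : a \in [:: e_pq; e_qp; e_p; e_q] -> size y1 = n -> size y2 = n ->
    all bas_tail y1 -> all bas_tail y2 -> chi ([:: a] ++ y1) = chi ([:: a] ++ y2).
  move=> ha; have da : decode ([:: a] : basword) by case: (a) ha.
  apply: connected => // z1 z2 b c z s1 s2 a1 a2 e hz.
  apply: (@link _ _ b c) => //; rewrite ?size_cat ?s1 ?s2 //; try exact: decode_cons_tail.
  by rewrite hz.
have chi_in u : valid u -> begins u ([:: e_p] : basword) -> chi (mkseq u n.+1) = chi y0.
  move=> uv ub; rewrite -[n.+1]add1n mkseqD /=; move: ub; rewrite begins1 => /eqP ->.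
  apply: (block e_p) => //; rewrite ?size_mkseq //.
  by apply/allP => d /mapP[i _ ->]; rewrite /suff add1n; exact: valid_tail.
pose y1 : basword := [:: e_q] ++ mkseq (end_tail true) n.
have chi_out u : valid u -> ~~ begins u ([:: e_p] : basword) -> chi (mkseq u n.+1) = chi y1.
  move=> uv ub; rewrite -[n.+1]add1n mkseqD /=; move: ub; rewrite begins1 => ua.
  have tu : all bas_tail (mkseq (suff 1 u) n : basword).
    by apply/allP => d /mapP[i _ ->]; rewrite /suff add1n; exact: valid_tail.
  have := valid_head uv; rewrite !inE (negbTE ua) orFb => /or3P[]/eqP ->.
  - rewrite (@block e_pq _ (mkseq (end_tail false) n)) ?size_mkseq //.
    apply: (@link _ _ false true); rewrite ?size_cat /= ?size_mkseq //; try exact: (@decode_cons_tail [:: _]).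
    + by rewrite (@word_end_tail _ [:: e_pq]) // (@word_end_tail _ [:: e_q]).
    + by rewrite (@word_end_tail _ [:: e_pq]).
  - rewrite (@block e_qp _ (mkseq (end_tail true) n)) ?size_mkseq //.
    apply: (@link _ _ true true); rewrite ?size_cat /= ?size_mkseq //; try exact: (@decode_cons_tail [:: _]).
    + by rewrite (@word_end_tail _ [:: e_qp]) // (@word_end_tail _ [:: e_q]).
    + by rewrite (@word_end_tail _ [:: e_qp]).
  - by apply: (block e_q); rewrite ?size_mkseq.
have image u : valid u -> exists2 v, valid v /\ begins v (F (mkseq u n.+1)) & f (bpt u) = bpt v.
  move=> uv; have h := hF _ (size_mkseq _ _) (uv n).
  have [v [vv vb e]] := maps_cell loopness_child h uv (begins_mkseq _ _).
  by exists v.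
(* An image strictly containing the loop w would have the base of w in its
   interior, whereas this base is the image of an end. *)
have not_inner y : size y = n.+1 -> decode y -> prefix (F y) w -> prefix w (F y).
  move=> sy dy /prefixP[z wz]; have h := hF _ sy dy.
  case: (z =P [::]) => [z0|/eqP z0]; first by rewrite wz z0 cats0 prefix_refl.
  have az : all bas_tail z.
    by move: dw; rewrite wz bas_decode_cat => [/andP[]//|]; case: (F y) (maps_decode h).2.
  have hz := maps_app h az; rewrite -wz in hz.
  have ne : word_end true (y ++ z) <> word_end true ([:: e_p] : basword).
    have /alike_lword[_ _ lz] := hz.1; rewrite lw in lz.
    case/lastP: z z0 lz az {wz hz} => // z c _; rewrite -rcons_cat /lword last_rcons all_rcons.
    move=> lc /andP[tc az]; rewrite bas_word_end_rcons ?(decode_cons_tail dy az) //.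
    by case: c lc tc.
  case: ne; apply/pt_end_eq => //; first exact: (maps_decode hz).1.
  by apply: (@homeo_inj _ f); rewrite (maps_end_pt _ hz) -fbase.
have outside u v : valid u -> begins u w -> valid v -> f (bpt v) = bpt u ->
    chi (mkseq v n.+1) = false -> bpt v = base_pt.
  move=> uv uw vv e cv; have [v' [vv' vb] e'] := image v vv.
  apply: (@homeo_inj _ f); rewrite fbase e; apply: (loop_base lw dw uv vv' uw).
    apply/negP => vw; have [p|p] := begins_comparable vw vb; first by rewrite /chi p in cv.
    by move: cv; rewrite /chi (not_inner _ (size_mkseq _ _) (vv n) p).
  by rewrite -e -e'.
have inside v : valid v -> chi (mkseq v n.+1) -> cell w (f (bpt v)).
  move=> vv cv; have [v' [vv' vb] ->] := image v vv.
  by apply: cell_pt => //; exact: prefix_begins cv vb.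
have iota_inside v : valid v -> begins v ([:: e_p] : basword) -> chi y1 ->
    cell w (f (iota (bpt v))).
  move=> vv vb c1; have [v' [vv' vb'] ->] := iota_in_cell vv vb.
  by apply: inside; rewrite ?chi_out.
have base_in : cell ([:: e_p] : basword) base_pt.
  by apply: cell_pt; [exact: valid_end_tail|exact: begins_pre].
have not_both : ~ (chi y0 /\ chi y1).
  move=> [c0 c1].
  have zv : generic (pre ([:: e_pq] : basword) zigzag) by apply: zigzag_generic.
  have [v vv ev] := ptP bas_point (f^-1%g (bpt (pre ([:: e_pq] : basword) zigzag))).
  have fv : f (bpt v) = bpt (pre ([:: e_pq] : basword) zigzag) by rewrite -ev homeo_KV.
  have : cell w (f (bpt v)).
    apply: inside => //; have [b|b] := boolP (begins v ([:: e_p] : basword)).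
      by rewrite chi_in.
    by rewrite chi_out.
  rewrite fv => /(cell_generic zv); apply/negP; exact: zigzag_loop.
(* Surjectivity of f gives an image inside w. *)
have some : chi y0 || chi y1.
  have gw := loop_generic dw; have bw := begins_pre w loop_tail.
  have [v vv ev] := ptP bas_point (f^-1%g (bpt (pre w loop_tail))).
  have fv : f (bpt v) = bpt (pre w loop_tail) by rewrite -ev homeo_KV.
  have [v' [vv' vb] e'] := image v vv.
  have wv' : pre w loop_tail = v' by apply: (pt_generic (u0 := bas_point) gw vv'); rewrite -fv.
  have cv : chi (mkseq v n.+1).
    rewrite -wv' in vb; have [//|p] := begins_comparable bw vb.
    exact: not_inner (size_mkseq _ _) (vv n) p.
  have [b|b] := boolP (begins v ([:: e_p] : basword)).
    by rewrite -(chi_in v vv b) cv.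
  by rewrite -(chi_out v vv b) cv orbT.
exists w; split => //; case c0: (chi y0) some not_both.
  move=> _ nb; have c1 : chi y1 = false by apply/negP => c1; apply: nb.
  left; split=> // [u uv ub|u uv uw].
    by apply: inside; rewrite ?chi_in.
  have [v vv ev] := ptP bas_point (f^-1%g (bpt u)); rewrite ev.
  have [b|b] := boolP (begins v ([:: e_p] : basword)); first exact: cell_pt.
  rewrite (outside u v) //; first by rewrite -ev homeo_KV.
  by rewrite chi_out.
move=> c1 _; right; split=> [u uv ub|u uv uw|].
- by rewrite homeo_mulE; exact: iota_inside.
- rewrite invgM homeo_mulE iota_V.
  have [v vv ev] := ptP bas_point (f^-1%g (bpt u)); rewrite ev.
  have [b|b] := boolP (begins v ([:: e_p] : basword)); last exact: iota_out_cell.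
  rewrite (outside u v) ?iota_base //; first by rewrite -ev homeo_KV.
  by rewrite chi_in.
- by rewrite homeo_mulE iota_base fbase.
Qed.

End Connectivity.

(** * The group generated by the four images *)

Lemma nseqS (T : Type) n (x : T) : nseq n.+1 x = rcons (nseq n x) x.
Proof. by elim: n => //= n <-. Qed.

Section Subgroups.
Local Open Scope group_scope.

Lemma generated_subgroup (G : groupType) (X : set G) : is_subgroup (generated X).
Proof.
split.
  apply/mem_set => K [[K1 _] _]; exact: set_mem K1.
move=> x y /set_mem hx /set_mem hy; apply/mem_set => K [[K1 Kd] XK].
by apply/set_mem/Kd; apply/mem_set; [apply: hx|apply: hy].
Qed.

Lemma subgroupM (G : groupType) (K : set G) x y : is_subgroup K -> K x -> K y -> K (x * y).
Proof.
move=> sK hx hy; apply/set_mem; apply: (group_closedM sK); exact/mem_set.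
Qed.

Lemma subgroupV (G : groupType) (K : set G) x : is_subgroup K -> K x -> K x^-1.
Proof. by move=> sK hx; apply/set_mem; apply: (group_closedV sK); exact/mem_set. Qed.

Lemma subgroup1 (G : groupType) (K : set G) : is_subgroup K -> K 1.
Proof. by case=> /set_mem. Qed.

End Subgroups.

Section Generators.
Context (al be ga de : homeo basilica).
Hypothesis al_tab : follows_table alpha_bas al.
Hypothesis be_tab : follows_table beta_bas be.
Hypothesis ga_tab : follows_table gamma_bas ga.
Hypothesis de_tab : follows_table delta_bas de.
Implicit Types (w y s : basword) (u v : nat -> letter basilica_system).
Implicit Types (f g h : homeo basilica).
Local Open Scope group_scope.

Let H : set (homeo basilica) := generated [set al; be; ga; de].

Lemma H_subgroup : is_subgroup H. Proof. exact: generated_subgroup. Qed.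
Lemma HM f g : H f -> H g -> H (f * g). Proof. exact: subgroupM H_subgroup. Qed.
Lemma HV f : H f -> H f^-1. Proof. exact: subgroupV H_subgroup. Qed.
Lemma H1 : H 1. Proof. exact: subgroup1 H_subgroup. Qed.

Lemma H_gen f : [set al; be; ga; de] f -> H f.
Proof. exact: sub_gen_smallest. Qed.

Lemma H_al : H al. Proof. by apply: H_gen; left; left; left. Qed.
Lemma H_be : H be. Proof. by apply: H_gen; left; left; right. Qed.
Lemma H_ga : H ga. Proof. by apply: H_gen; left; right. Qed.
Lemma H_de : H de. Proof. by apply: H_gen; right. Qed.

Lemma H_sub_T_B : H `<=` T_B.
Proof.
apply: smallest_sub; first exact: T_B_subgroup.
move=> f [[[]|]|] ->.
- exact: bas_table_T alpha_bas_ok _ al_tab.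
- exact: bas_table_T beta_bas_ok _ be_tab.
- exact: bas_table_T gamma_bas_ok _ ga_tab.
- exact: bas_table_T delta_bas_ok _ de_tab.
Qed.

Lemma al_maps w w' : (w, w') \in alpha_bas -> bmaps al w w'.
Proof. exact: (@bas_table_maps alpha_bas al isT al_tab (w, w')). Qed.
Lemma be_maps w w' : (w, w') \in beta_bas -> bmaps be w w'.
Proof. exact: (@bas_table_maps beta_bas be isT be_tab (w, w')). Qed.
Lemma ga_maps w w' : (w, w') \in gamma_bas -> bmaps ga w w'.
Proof. exact: (@bas_table_maps gamma_bas ga isT ga_tab (w, w')). Qed.
Lemma de_maps w w' : (w, w') \in delta_bas -> bmaps de w w'.
Proof. exact: (@bas_table_maps delta_bas de isT de_tab (w, w')). Qed.

(** Images of words under products of generators are computed, so that a claim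
    such as [bmaps (gen_prod l) w w'] reduces to an evaluation. *)
Definition table_word (t : seq (basword * basword)) (w : basword) : basword :=
  let p := nth ([::], [::]) t (find (fun p => prefix p.1 w) t) in
  p.2 ++ drop (size p.1) w.

Definition table_hit (t : seq (basword * basword)) (w : basword) : bool :=
  has (fun p => prefix p.1 w) t && decode w.

Lemma table_word_maps t f w : (forall p, p \in t -> bmaps f p.1 p.2) ->
  table_hit t w -> bmaps f w (table_word t w).
Proof.
move=> tm /andP[h dw]; rewrite /table_word.
have pt := mem_nth ([::], [::]) (ltac:(by rewrite -has_find) : find (fun p => prefix p.1 w) t < size t).
have /prefixP[y wy] := nth_find ([::], [::]) h.
set p := nth _ _ _ in pt wy *; rewrite wy drop_size_cat //.
have m := tm _ pt; apply: maps_app => //.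
have [d _] := maps_decode m.
by move: dw; rewrite wy bas_decode_cat => [/andP[]//|]; case: (p.1) d.
Qed.

Inductive gen := Gal | Gbe | Gga | Gde.
Definition gen_elt c := match c with Gal => al | Gbe => be | Gga => ga | Gde => de end.
Definition gen_tab c := match c with Gal => alpha_bas | Gbe => beta_bas
  | Gga => gamma_bas | Gde => delta_bas end.
Definition gen_prod (l : seq gen) : homeo basilica := foldr (fun c f => gen_elt c * f) 1 l.
Fixpoint gen_word (l : seq gen) (w : basword) : option basword :=
  if l is c :: l' then
    if gen_word l' w is Some w' then
      if table_hit (gen_tab c) w' then Some (table_word (gen_tab c) w') else None
    else None
  else if decode w then Some w else None.

Lemma gen_tab_maps c p : p \in gen_tab c -> bmaps (gen_elt c) p.1 p.2.
Proof.
case: c p => -[w w'].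
- exact: al_maps.
- exact: be_maps.
- exact: ga_maps.
- exact: de_maps.
Qed.

Lemma gen_word_maps l w w' : gen_word l w = Some w' -> bmaps (gen_prod l) w w'.
Proof.
elim: l w' => [|c l IH] w' /=.
  by case E: decode => [e|] // [<-]; apply: maps_1; rewrite E.
case: gen_word IH => [w1|] // IH; case: ifP => // h [<-].
exact: maps_mul (IH _ erefl) (table_word_maps (@gen_tab_maps c) h).
Qed.

Lemma gen_prod_H l : H (gen_prod l).
Proof.
elim: l => [|c l IH] /=; first exact: H1.
by apply: HM => //; case: c; [exact: H_al|exact: H_be|exact: H_ga|exact: H_de].
Qed.

(** delta alpha, the involution exchanging the two sides of the vertex p. *)
Definition iota := gen_prod [:: Gde; Gal].

Lemma H_iota : H iota. Proof. exact: gen_prod_H. Qed.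

Lemma iota_in : bmaps iota [:: e_p; l_in] [:: e_pq].
Proof. by apply: (@gen_word_maps [:: Gde; Gal]); vm_compute. Qed.
Lemma iota_out : bmaps iota [:: e_p; l_out] [:: e_qp].
Proof. by apply: (@gen_word_maps [:: Gde; Gal]); vm_compute. Qed.
Lemma iota_loop : bmaps iota [:: e_p; l_loop] [:: e_q].
Proof. by apply: (@gen_word_maps [:: Gde; Gal]); vm_compute. Qed.
Lemma iota_pq : bmaps iota [:: e_pq] [:: e_p; l_in].
Proof. by apply: (@gen_word_maps [:: Gde; Gal]); vm_compute. Qed.
Lemma iota_qp : bmaps iota [:: e_qp] [:: e_p; l_out].
Proof. by apply: (@gen_word_maps [:: Gde; Gal]); vm_compute. Qed.
Lemma iota_q : bmaps iota [:: e_q] [:: e_p; l_loop].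
Proof. by apply: (@gen_word_maps [:: Gde; Gal]); vm_compute. Qed.

(** iota (delta beta delta) iota and iota gamma iota: the inverses of the tree
    rotations at the root and at its right child, which generate Thompson's
    group F on the circle of the loop [e_p] cut open at its base. *)
Definition unrotate0_gens := [:: Gde; Gal; Gde; Gbe; Gde; Gde; Gal].
Definition unrotate1_gens := [:: Gde; Gal; Gga; Gde; Gal].
Definition unrotate0 := gen_prod unrotate0_gens.
Definition unrotate1 := gen_prod unrotate1_gens.

Definition fixes_off f (w : basword) := forall u, valid u -> ~~ begins u w -> f (bpt u) = bpt u.

Lemma fixes_off_V f w : fixes_off f w -> fixes_off f^-1 w.
Proof. by move=> h u uv uw; rewrite -{1}(h u uv uw) homeo_VK. Qed.

Lemma fixes_off_M f g w : fixes_off f w -> fixes_off g w -> fixes_off (f * g) w.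
Proof. by move=> h k u uv uw; rewrite homeo_mulE k // h. Qed.

Lemma off_ep f : bmaps f [:: e_pq] [:: e_pq] -> bmaps f [:: e_qp] [:: e_qp] ->
  bmaps f [:: e_q] [:: e_q] -> fixes_off f [:: e_p].
Proof.
move=> h1 h2 h3 u uv; rewrite begins1 => u0.
have go a : bmaps f [:: a] [:: a] -> u 0 == a -> f (bpt u) = bpt u.
  move=> h ua; have ub : begins u ([:: a] : basword) by rewrite begins1.
  by rewrite (beginsP ub) h.2 // -(beginsP ub).
have := valid_head uv; rewrite !inE (negbTE u0) orFb => /or3P[].
- exact: go.
- exact: go.
- exact: go.
Qed.

(** After [e_p], such a word names an arc of the circle of the loop [e_p], seen
    as a node of the binary tree of subdivisions of that circle. *)
Definition spinal (s : basword) := all (fun c => c \in [:: l_in; l_out]) s.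

Lemma spinal_tail s : spinal s -> all bas_tail s.
Proof. by apply: sub_all => c; rewrite !inE => /orP[]/eqP->. Qed.

Definition spine_loop s : basword := e_p :: rcons s l_loop.

Definition loops_to_loops f :=
  forall s, spinal s -> exists2 s', spinal s' & bmaps f (spine_loop s) (spine_loop s').

(** The elements acting only on the circle of the loop [e_p], carrying the
    half-spaces attached to it canonically.  The last condition is not a formal
    consequence of the third: it says that every attached loop is reached. *)
Definition circular f := [/\ H f, fixes_off f [:: e_p], loops_to_loops f & loops_to_loops f^-1].

Lemma circular1 : circular 1.
Proof.
have l1 : loops_to_loops 1.
  move=> s hs; exists s => //; apply: maps_1.
  by apply: (@decode_cons_tail [:: e_p]); rewrite // all_rcons spinal_tail.
by split => //; exact: H1.
Qed.

Lemma circularV f : circular f -> circular f^-1.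
Proof.
move=> [h o l l']; split; [exact: HV|exact: fixes_off_V|by []|].
by rewrite invgK.
Qed.

Lemma loops_to_loopsM f g : loops_to_loops f -> loops_to_loops g -> loops_to_loops (f * g).
Proof.
move=> hf hg s /hg[s1 h1 m1]; have [s2 h2 m2] := hf _ h1.
by exists s2 => //; exact: maps_mul m1 m2.
Qed.

Lemma circularM f g : circular f -> circular g -> circular (f * g).
Proof.
move=> [h o l l'] [k p m m']; split.
- exact: HM.
- exact: fixes_off_M.
- exact: loops_to_loopsM.
- by rewrite invgM; exact: loops_to_loopsM.
Qed.

Lemma gen_maps l w w' : gen_word l w = Some w' -> forall y, all bas_tail y ->
  bmaps (gen_prod l) (w ++ y) (w' ++ y).
Proof. by move=> h y hy; apply: maps_app => //; exact: gen_word_maps. Qed.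

Lemma spine_tail s : spinal s -> all bas_tail (rcons s l_loop).
Proof. by move=> h; rewrite all_rcons spinal_tail. Qed.

Lemma spine_step l a b y : gen_word l (e_p :: a) = Some (e_p :: b : basword) ->
  spinal y -> spinal b ->
  exists2 s, spinal s & bmaps (gen_prod l) (spine_loop (a ++ y)) (spine_loop s).
Proof.
move=> h hy hb; exists (b ++ y); first by rewrite /spinal all_cat; apply/andP.
by rewrite /spine_loop !rcons_cat; apply: (gen_maps h); exact: spine_tail.
Qed.

Lemma spine_step_V l a b y : gen_word l (e_p :: b) = Some (e_p :: a : basword) ->
  spinal y -> spinal b ->
  exists2 s, spinal s & bmaps (gen_prod l)^-1%g (spine_loop (a ++ y)) (spine_loop s).
Proof.
move=> h hy hb; exists (b ++ y); first by rewrite /spinal all_cat; apply/andP.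
by apply: maps_V; rewrite /spine_loop !rcons_cat; apply: (gen_maps h); exact: spine_tail.
Qed.

Lemma spine_hit l a b : gen_word l (spine_loop a) = Some (spine_loop b) -> spinal b ->
  exists2 s, spinal s & bmaps (gen_prod l) (spine_loop a) (spine_loop s).
Proof. by move=> h hb; exists b => //; exact: gen_word_maps. Qed.

Lemma spine_hit_V l a b : gen_word l (spine_loop b) = Some (spine_loop a) -> spinal b ->
  exists2 s, spinal s & bmaps (gen_prod l)^-1%g (spine_loop a) (spine_loop s).
Proof. by move=> h hb; exists b => //; apply: maps_V; exact: gen_word_maps. Qed.

Lemma unrotate0_circular : circular unrotate0.
Proof.
split; first exact: gen_prod_H.
- by apply: off_ep; apply: (@gen_word_maps unrotate0_gens); vm_compute.
- case=> [|[] // s hs]; first by move=> _; apply: (@spine_hit unrotate0_gens _ [:: l_in]); vm_compute.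
    by apply: (@spine_step unrotate0_gens [:: l_in] [:: l_in; l_in] s) => //; vm_compute.
  case: s hs => [|[] // s hs]; first by move=> _; apply: (@spine_hit unrotate0_gens _ [::]); vm_compute.
    by apply: (@spine_step unrotate0_gens [:: l_out; l_in] [:: l_in; l_out] s) => //; vm_compute.
  by apply: (@spine_step unrotate0_gens [:: l_out; l_out] [:: l_out] s) => //; vm_compute.
- case=> [|[] // s hs]; first by move=> _; apply: (@spine_hit_V unrotate0_gens _ [:: l_out]); vm_compute.
    case: s hs => [|[] // s hs]; first by move=> _; apply: (@spine_hit_V unrotate0_gens _ [::]); vm_compute.
      by apply: (@spine_step_V unrotate0_gens [:: l_in; l_in] [:: l_in] s) => //; vm_compute.
    by apply: (@spine_step_V unrotate0_gens [:: l_in; l_out] [:: l_out; l_in] s) => //; vm_compute.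
  by apply: (@spine_step_V unrotate0_gens [:: l_out] [:: l_out; l_out] s) => //; vm_compute.
Qed.

Lemma unrotate1_circular : circular unrotate1.
Proof.
split; first exact: gen_prod_H.
- by apply: off_ep; apply: (@gen_word_maps unrotate1_gens); vm_compute.
- case=> [|[] // s hs]; first by move=> _; apply: (@spine_hit unrotate1_gens _ [::]); vm_compute.
    by apply: (@spine_step unrotate1_gens [:: l_in] [:: l_in] s) => //; vm_compute.
  case: s hs => [|[] // s hs].
  + by move=> _; apply: (@spine_hit unrotate1_gens _ [:: l_out; l_in]); vm_compute.
  + by apply: (@spine_step unrotate1_gens [:: l_out; l_in] [:: l_out; l_in; l_in] s) => //; vm_compute.
  case: s hs => [|[] // s hs].
  + by move=> _; apply: (@spine_hit unrotate1_gens _ [:: l_out]); vm_compute.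
  + by apply: (@spine_step unrotate1_gens [:: l_out; l_out; l_in] [:: l_out; l_in; l_out] s) => //; vm_compute.
  + by apply: (@spine_step unrotate1_gens [:: l_out; l_out; l_out] [:: l_out; l_out] s) => //; vm_compute.
- case=> [|[] // s hs]; first by move=> _; apply: (@spine_hit_V unrotate1_gens _ [::]); vm_compute.
    by apply: (@spine_step_V unrotate1_gens [:: l_in] [:: l_in] s) => //; vm_compute.
  case: s hs => [|[] // s hs].
  + by move=> _; apply: (@spine_hit_V unrotate1_gens _ [:: l_out; l_out]); vm_compute.
  + case: s hs => [|[] // s hs].
    * by move=> _; apply: (@spine_hit_V unrotate1_gens _ [:: l_out]); vm_compute.
    * by apply: (@spine_step_V unrotate1_gens [:: l_out; l_in; l_in] [:: l_out; l_in] s) => //; vm_compute.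
    * by apply: (@spine_step_V unrotate1_gens [:: l_out; l_in; l_out] [:: l_out; l_out; l_in] s) => //; vm_compute.
  by apply: (@spine_step_V unrotate1_gens [:: l_out; l_out] [:: l_out; l_out; l_out] s) => //; vm_compute.
Qed.

Definition ones k : basword := nseq k l_out.

(** The rotation of binary trees at the node [ones k]: its subtrees 00, 01, 1
    become 0, 10, 11, and the loops between them follow. *)
Definition rotates k f := [/\ circular f,
  forall j, j < k -> bmaps f (e_p :: ones j ++ [:: l_in]) (e_p :: ones j ++ [:: l_in]),
  bmaps f (e_p :: ones k ++ [:: l_in; l_in]) (e_p :: ones k ++ [:: l_in]) /\
  bmaps f (e_p :: ones k ++ [:: l_in; l_out]) (e_p :: ones k ++ [:: l_out; l_in]),
  bmaps f (e_p :: ones k ++ [:: l_out]) (e_p :: ones k ++ [:: l_out; l_out]) &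
  bmaps f (e_p :: ones k ++ [:: l_in; l_loop]) (e_p :: ones k ++ [:: l_loop])].

Lemma rotates0 : rotates 0 unrotate0^-1.
Proof.
split=> //; first exact/circularV/unrotate0_circular.
- by split; apply: maps_V; apply: (@gen_word_maps unrotate0_gens); vm_compute.
- by apply: maps_V; apply: (@gen_word_maps unrotate0_gens); vm_compute.
- by apply: maps_V; apply: (@gen_word_maps unrotate0_gens); vm_compute.
Qed.

Lemma rotates1 : rotates 1 unrotate1^-1.
Proof.
split=> //; first exact/circularV/unrotate1_circular.
- by case=> // _; apply: maps_V; apply: (@gen_word_maps unrotate1_gens); vm_compute.
- by split; apply: maps_V; apply: (@gen_word_maps unrotate1_gens); vm_compute.
- by apply: maps_V; apply: (@gen_word_maps unrotate1_gens); vm_compute.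
- by apply: maps_V; apply: (@gen_word_maps unrotate1_gens); vm_compute.
Qed.

Lemma ones_tail k : all bas_tail (ones k). Proof. by elim: k. Qed.

(** As in Thompson's group F, conjugation by the first generator moves the
    second generator down the right spine of the tree. *)
Lemma rotatesS k f : rotates k.+1 f -> rotates k.+2 (unrotate0^-1 * (f * unrotate0)).
Proof.
have unrotate0out y : all bas_tail y -> bmaps unrotate0 (e_p :: l_out :: l_out :: y) (e_p :: l_out :: y).
  move=> hy; apply: (@maps_app unrotate0 [:: e_p; l_out; l_out] [:: e_p; l_out]) => //.
  by apply: (@gen_word_maps unrotate0_gens); vm_compute.
have conj y y' : all bas_tail y -> all bas_tail y' -> bmaps f (e_p :: l_out :: y) (e_p :: l_out :: y') ->
    bmaps (unrotate0^-1 * (f * unrotate0))%g (e_p :: l_out :: l_out :: y) (e_p :: l_out :: l_out :: y').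
  move=> hy hy' h; apply: maps_mul (maps_V (unrotate0out _ hy')).
  exact: maps_mul (unrotate0out _ hy) h.
move=> [c fx [h1 h2] h3 h4].
have f0 : bmaps f [:: e_p; l_in] [:: e_p; l_in] by exact: (fx 0).
split.
- apply: circularM; first exact/circularV/unrotate0_circular.
  by apply: circularM => //; exact: unrotate0_circular.
- case=> [_|[_|j jk]].
  + have v : bmaps unrotate0 [:: e_p; l_in] [:: e_p; l_in; l_in] by apply: (@gen_word_maps unrotate0_gens); vm_compute.
    apply: maps_mul (maps_V v); apply: maps_mul v _.
    exact: (@maps_app f [:: e_p; l_in] [:: e_p; l_in] [:: l_in]).
  + have v : bmaps unrotate0 [:: e_p; l_out; l_in] [:: e_p; l_in; l_out].
      by apply: (@gen_word_maps unrotate0_gens); vm_compute.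
    apply: maps_mul (maps_V v); apply: maps_mul v _.
    exact: (@maps_app f [:: e_p; l_in] [:: e_p; l_in] [:: l_out]).
  + by apply: conj; rewrite ?all_cat ?ones_tail //; exact: (fx j.+1).
- by split; apply: conj; rewrite ?all_cat ?ones_tail.
- by apply: conj; rewrite ?all_cat ?ones_tail.
- by apply: conj; rewrite ?all_cat ?ones_tail.
Qed.

Lemma exists_rotation k : exists f, rotates k f.
Proof.
case: k => [|k]; first by exists unrotate0^-1; exact: rotates0.
elim: k => [|k [f hf]]; first by exists unrotate1^-1; exact: rotates1.
by exists (unrotate0^-1 * (f * unrotate0))%g; exact: rotatesS.
Qed.

(** * Chains of arcs and tree rotations *)

Definition incomparable w y := ~~ prefix w y && ~~ prefix y w.

(** The arc y starts where the arc w stops. *)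
Definition adj_at (r : basword) : rel basword :=
  fun w y => word_end false (r ++ w) == word_end true (r ++ y).

Local Notation adj := (adj_at [:: e_p]).

(** The leaves, from left to right, of the tree with m carets that grows along
    the right spine below [ones k]. *)
Fixpoint vine k m : seq basword :=
  if m is m'.+1 then (ones k ++ [:: l_in]) :: vine k.+1 m' else [:: ones k].

(** The rotation at [ones k] as a map on the nodes below [ones k] other than
    its left child. *)
Definition rotate_word k w : basword := ones k ++
  match drop k w with
  | l_in :: l_in :: y => l_in :: y
  | l_in :: l_out :: y => l_out :: l_in :: y
  | l_out :: y => l_out :: l_out :: y
  | y => y
  end.

Lemma size_ones k : size (ones k) = k. Proof. exact: size_nseq. Qed.

Lemma spinal_cat x y : spinal (x ++ y) = spinal x && spinal y.
Proof. exact: all_cat. Qed.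

Lemma spinal_ones k : spinal (ones k). Proof. by elim: k. Qed.

Lemma rotate_word_maps k f y : rotates k f -> spinal y -> 
  y <> [::] -> y <> [:: l_in] ->
  [/\ bmaps f (e_p :: ones k ++ y) (e_p :: rotate_word k (ones k ++ y)),
     spinal (rotate_word k (ones k ++ y)) &
     prefix (ones k) (rotate_word k (ones k ++ y))].
Proof.
move=> [_ _ [h1 h2] h3 _] sy y0 y1; rewrite /rotate_word drop_size_cat ?size_ones //.
rewrite spinal_cat spinal_ones prefix_prefix.
have go a b z : bmaps f (e_p :: ones k ++ a) (e_p :: ones k ++ b) -> spinal z ->
    bmaps f (e_p :: ones k ++ (a ++ z)) (e_p :: ones k ++ (b ++ z)).
  move=> h hz; rewrite !catA -!cat_cons; apply: maps_app => //; exact: spinal_tail.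
case: y sy y0 y1 => [//|[] // [|[] // y]] //= hy _ _; split => //.
- exact: (go [:: l_in; l_in] [:: l_in]).
- exact: (go [:: l_in; l_out] [:: l_out; l_in]).
- exact: (go [:: l_out] [:: l_out; l_out] (l_in :: y)).
- exact: (go [:: l_out] [:: l_out; l_out] (l_out :: y)).
Qed.

Lemma incomparable_maps f w w' y y' : bmaps f w w' -> bmaps f y y' ->
  incomparable w y -> incomparable w' y'.
Proof.
move=> h h' /andP[n1 n2]; apply/andP; split; apply/negP.
  by move/(maps_prefix h h')=> []; apply/negP.
by move/(maps_prefix h' h)=> []; apply/negP.
Qed.

Lemma pairwise_image f (phi : basword -> basword) cs :
  {in cs, forall w, bmaps f (e_p :: w) (e_p :: phi w)} ->
  pairwise incomparable cs -> pairwise incomparable (map phi cs).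
Proof.
elim: cs => [//|w cs IH] h /= /andP[/allP a p]; apply/andP; split.
  apply/allP => _ /mapP[y yc ->].
  have hw := h w (mem_head _ _); have hy : y \in w :: cs by rewrite in_cons yc orbT.
  have := incomparable_maps hw (h _ hy).
  by rewrite /incomparable /= => /(_ (a _ yc)).
by apply: IH => // y yc; apply: h; rewrite in_cons yc orbT.
Qed.

Lemma path_image f (phi : basword -> basword) w cs :
  {in w :: cs, forall y, bmaps f (e_p :: y) (e_p :: phi y)} ->
  path adj w cs -> path adj (phi w) (map phi cs).
Proof.
elim: cs w => [//|y cs IH] w h /= /andP[a p]; apply/andP; split; last first.
  by apply: IH => // z zc; apply: h; rewrite in_cons zc orbT.
apply/eqP/(maps_end _ _ (h w _) (h y _)); rewrite ?in_cons ?eqxx ?orbT //.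
exact/eqP.
Qed.

Lemma spine_start_new r y : spinal y ->
  word_end true (e_p :: y : basword) = Some (inr (e_p :: r : basword, tt)) ->
  exists b, y = r ++ l_out :: nseq b l_in.
Proof.
elim/last_ind: y => [//|y c IH]; rewrite /spinal all_rcons => /andP[hc hy].
have dy : decode (e_p :: y : basword).
  by apply: (@decode_cons_tail [:: e_p]) => //; exact: spinal_tail.
rewrite -rcons_cons bas_word_end_rcons //; case: c hc => // _.
  by move=> /(IH hy)[b ->]; exists b.+1; rewrite rcons_cat rcons_cons -nseqS.
by case=> ->; exists 0; rewrite cats1.
Qed.

Lemma spine_start_base y : spinal y ->
  word_end true (e_p :: y : basword) = Some (inl v_p) -> y = nseq (size y) l_in.
Proof.
elim/last_ind: y => [//|y c IH]; rewrite /spinal all_rcons => /andP[hc hy].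
have dy : decode (e_p :: y : basword).
  by apply: (@decode_cons_tail [:: e_p]) => //; exact: spinal_tail.
rewrite -rcons_cons bas_word_end_rcons //; case: c hc => // _ /(IH hy) {1}->.
by rewrite size_rcons nseqS.
Qed.

Lemma spine_decode y : spinal y -> decode (e_p :: y : basword).
Proof. by move=> hy; apply: (@decode_cons_tail [:: e_p]) => //; exact: spinal_tail. Qed.

(** A chain of arcs from the start of the node [ones k] to the end of the circle
    is carried to the vine.  If its first arc is the left child of [ones k], that
    arc is already in place and the spine continues at [ones k.+1]; if it is
    deeper, a rotation at [ones k] shortens it by one; if it is [ones k] itself,
    nothing is left. *)
Lemma normalize m a k rest : let w := ones k ++ nseq a l_in in
  size rest = m -> all spinal (w :: rest) -> all (prefix (ones k)) rest ->
  pairwise incomparable (w :: rest) -> path adj w rest ->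
  word_end false (e_p :: last w rest : basword) = Some (inl v_p) ->
  exists f, [/\ circular f,
    forall j, j < k -> bmaps f (e_p :: ones j ++ [:: l_in]) (e_p :: ones j ++ [:: l_in]) &
    forall i, i <= m -> bmaps f (e_p :: nth [::] (w :: rest) i) (e_p :: nth [::] (vine k m) i)].
Proof.
elim: m a k rest => [|m IHm]; elim=> [|a IHa] k rest w sz sp pr inc pth lst.
- exists 1; split; first exact: circular1.
    move=> j _; apply: maps_1; apply: spine_decode; rewrite spinal_cat spinal_ones //.
  case=> // _; rewrite /= /w cats0; apply: maps_1; apply: spine_decode; exact: spinal_ones.
- exfalso; move: lst; rewrite (size0nil sz) /= /w nseqS -cats1 catA cats1 -rcons_cons.
  rewrite bas_word_end_rcons //; apply: spine_decode.
  by rewrite spinal_cat spinal_ones; apply/allP => c /nseqP[->].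
- exfalso; case: rest sz sp pr inc {pth lst} => // y rest _ _ /= /andP[p _].
  by rewrite /w cats0 /incomparable p.
- have wr y : y \in rest -> exists2 y', y = ones k ++ y' & spinal y' /\ incomparable w y.
    move=> yr; have /allP/(_ _ yr)/prefixP[y' yE] := pr; exists y' => //.
    have /allP/(_ y) := sp; rewrite in_cons yr orbT yE spinal_cat => /(_ isT)/andP[_ sy'].
    by split => //; move: inc => /= /andP[/allP/(_ _ yr)]; rewrite yE.
  case: a IHa @w sz sp pr inc pth lst wr => [|a] IHa w sz sp pr inc pth lst wr.
    have tk x : ones k ++ l_out :: x = ones k.+1 ++ x by rewrite /ones nseqS cat_rcons.
    have dw : decode (e_p :: ones k : basword) by apply: spine_decode; exact: spinal_ones.
    case: rest sz sp pr inc pth lst wr => // y rest [sz] sp pr inc pth lst wr.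
    have [b yE] : exists b, y = ones k ++ l_out :: nseq b l_in.
      have [|y' _ [_ _]] := wr y; first exact: mem_head.
      apply: spine_start_new; first by case/and3P: sp.
      move: pth => /= /andP[/eqP/esym + _]; rewrite /adj_at /= => ->.
      by rewrite /w cats1 -rcons_cons bas_word_end_rcons.
    rewrite tk in yE.
    have [||||||f [cf fx fm]] := IHm b k.+1 rest; rewrite -?yE //.
    - by case/andP: sp.
    - apply/allP => z zr; have [|z' zE [sz' iz]] := wr z; first by rewrite in_cons zr orbT.
      case: z' zE sz' iz => [|[] // z'] -> _; last by rewrite tk prefix_prefix.
        by rewrite cats0 /incomparable andbC prefix_prefix.
      by rewrite /incomparable -[l_in :: z']cat1s catA prefix_prefix.
    - by case/andP: inc.
    - by case/andP: pth.
    exists f; split => // [j jk|[_|i i_m]]; first by apply: fx; exact: leqW.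
      exact: (fx k).
    by have := fm i i_m; rewrite -yE.
  have [f rf] := exists_rotation k.
  pose phi := rotate_word k.
  have phiP y : y \in w :: rest -> [/\ bmaps f (e_p :: y) (e_p :: phi y),
      spinal (phi y) & prefix (ones k) (phi y)].
    rewrite in_cons => /predU1P[->|/wr[y' -> [sy' iy]]].
      apply: rotate_word_maps => //.
      by move: sp => /= /andP[]; rewrite /w spinal_cat => /andP[].
    apply: rotate_word_maps => // y'E; move: iy; rewrite y'E /incomparable /w.
      by rewrite cats0 prefix_prefix andbF.
    by rewrite (_ : nseq a.+2 l_in = [:: l_in] ++ nseq a.+1 l_in) // catA prefix_prefix andbF.
  have phiw : phi w = ones k ++ nseq a.+1 l_in.
    by rewrite /phi /rotate_word /w drop_size_cat ?size_ones.
  have [||||||g [cg gx gm]] := IHa k (map phi rest); rewrite -?phiw.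
  - by rewrite size_map.
  - apply/allP => y; rewrite -map_cons => /mapP[z zc ->].
    by have [] := phiP _ zc.
  - apply/allP => _ /mapP[z zc ->].
    by have [] := phiP z _; rewrite ?in_cons ?zc ?orbT.
  - rewrite -map_cons; apply: (@pairwise_image f) => // z zc.
    by have [] := phiP z zc.
  - by apply: (@path_image f) => // z zc; have [] := phiP z zc.
  - rewrite last_map.
    have lr : last w rest \in w :: rest by rewrite mem_last.
    have [ml _ _] := phiP _ lr.
    have [_ off _ _] : circular f by case: rf.
    have d : decode ([:: e_pq] : basword) by [].
    have mp : bmaps f [:: e_pq] [:: e_pq].
      split=> [|x vx]; first exact: (alike_refl loopness_refl).
      by apply: off => //; rewrite begins1.
    have := (maps_end false true ml mp).1; rewrite lst; exact.
  exists (g * f)%g; split; first by apply: circularM => //; case: rf.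
    move=> j jk; apply: maps_mul (gx _ jk); case: rf => _ fx _ _ _; exact: fx.
  move=> i i_m; have i_s : i < size (w :: rest) by rewrite /= sz.
  have [mi _ _] := phiP _ (mem_nth [::] i_s).
  apply: maps_mul mi _; have := gm _ i_m.
  by rewrite -phiw -map_cons (nth_map [::]).
Qed.

Fixpoint levels k : seq basword :=
  if k is k'.+1 then map (cons l_in) (levels k') ++ map (cons l_out) (levels k')
  else [:: [::]].

Lemma levelsP k y : reflect (spinal y /\ size y = k) (y \in levels k).
Proof.
elim: k y => [|k IH] y /=.
  by rewrite inE; apply: (iffP eqP) => [->|[_ /size0nil]].
rewrite mem_cat; apply: (iffP orP) => [[]/mapP[z /IH[sz <-] ->] //|[]].
case: y => [|[] y] //= hy [sy]; [left|right]; apply/mapP; exists y => //;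
  by apply/IH; split.
Qed.

Lemma levels_incomparable k : pairwise incomparable (levels k).
Proof.
have u : uniq (levels k).
  elim: k => //= k IH; rewrite cat_uniq !map_inj_uniq ?IH; try by move=> x y [].
  rewrite andbT; apply/hasPn => _ /mapP[y _ ->]; apply/mapP => -[z _] //.
rewrite uniq_pairwise in u; apply: (@sub_in_pairwise _ (mem (levels k))) u; last exact/allP.
move=> x y /levelsP[_ sx] /levelsP[_ sy] /= xy; rewrite /incomparable !prefixE sx sy !take_oversize ?sx ?sy //.
by rewrite eq_sym xy.
Qed.

(** The complete subdivision is a chain from the start of r to its end. *)
Lemma levels_path k r : decode r -> exists rest, [/\ levels k = nseq k l_in :: rest,
  path (adj_at r) (nseq k l_in) rest & last (nseq k l_in) rest = nseq k l_out].
Proof.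
elim: k r => [|k IH] r dr; first by exists [::].
have r0 : r != [::] by case: (r) dr.
have d c : bas_tail c -> decode (rcons r c) by move=> tc; rewrite bas_decode_rcons // dr tc.
have [rest [E p l]] := IH _ (d l_in isT); have [rest' [E' p' l']] := IH _ (d l_out isT).
have rr : rest' = rest by move: E'; rewrite E => -[].
rewrite rr in p' l'.
exists (map (cons l_in) rest ++ (l_out :: nseq k l_in) :: map (cons l_out) rest); split.
- by rewrite /= E.
- rewrite cat_path /=; apply/and3P; split.
  + rewrite path_map; apply: sub_path p => x y; rewrite /adj_at /= !cat_rcons //.
  + rewrite (last_map (cons l_in)) l /adj_at -!cat_rcons.
    have -> : nseq k l_out = mkseq (end_tail false) k :> basword.
      by elim: (k) => // n IHn; rewrite nseqS mkseqS IHn.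
    have -> : nseq k l_in = mkseq (end_tail true) k :> basword.
      by elim: (k) => // n IHn; rewrite nseqS mkseqS IHn.
    by rewrite !word_end_tail ?d // !bas_word_end_rcons.
  + rewrite path_map; apply: sub_path p' => x y; rewrite /adj_at /= !cat_rcons //.
- by rewrite last_cat /= (last_map (cons l_out)) l'.
Qed.

Local Notation base_pt := base_pt.

Lemma base_end b y (g : homeo basilica) y' : g base_pt = base_pt ->
  bmaps g (e_p :: y) (e_p :: y' : basword) ->
  word_end b (e_p :: y : basword) = Some (inl v_p) ->
  word_end b (e_p :: y' : basword) = Some (inl v_p).
Proof.
move=> gb h e; have [d d'] := maps_decode h.
have : bpt (pre (e_p :: y : basword) (end_tail b)) = base_pt by apply/pt_end_eq.
move/(congr1 g); rewrite gb (maps_end_pt b h) => /pt_end_eq -> //.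
Qed.

(** Both the complete subdivision and its image under g are chains of the same
    length, so both are carried to the same vine. *)
Lemma spine_match k (g : homeo basilica) (sg : basword -> basword) : g base_pt = base_pt ->
  {in levels k, forall y, spinal (sg y) /\ bmaps g (e_p :: y) (e_p :: sg y)} ->
  exists2 h, circular h & {in levels k, forall y, bmaps h (e_p :: y) (e_p :: sg y)}.
Proof.
move=> gb hs.
have [rest [E p l]] := levels_path k (isT : decode ([:: e_p] : basword)).
have inc := levels_incomparable k.
have sp : all spinal (levels k) by apply/allP => y /levelsP[].
have tail_out n : nseq n l_out = mkseq (end_tail false) n :> basword.
  by elim: n => // n IHn; rewrite nseqS mkseqS IHn.
have endl : word_end false (e_p :: last (nseq k l_in) rest : basword) = Some (inl v_p).
  rewrite l tail_out; exact: (@word_end_tail false [:: e_p]).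
have tail_in n : nseq n l_in = mkseq (end_tail true) n :> basword.
  by elim: n => // n IHn; rewrite nseqS mkseqS IHn.
have in1 : nseq k l_in \in levels k by rewrite E mem_head.
have [s1 m1] := hs _ in1.
have start : sg (nseq k l_in) = nseq (size (sg (nseq k l_in))) l_in.
  apply: spine_start_base => //; apply: base_end gb m1 _.
  rewrite tail_in; exact: (@word_end_tail true [:: e_p]).
have lin : last (nseq k l_in) rest \in levels k by rewrite E mem_last.
rewrite E in inc sp hs in1 lin.
have [|f [cf _ fm]] := @normalize (size rest) k 0 rest erefl sp _ inc p endl.
  by apply/allP => y _; exact: prefix0s.
have [||||||g2 [cg _ gm]] := @normalize (size rest) (size (sg (nseq k l_in))) 0 (map sg rest).
- by rewrite size_map.
- rewrite -[ones 0 ++ _]/(nseq _ _) -start -map_cons; apply/allP => _ /mapP[y yc ->]; by case: (hs y yc).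
- by apply/allP => y _; exact: prefix0s.
- rewrite -[ones 0 ++ _]/(nseq _ _) -start -map_cons; apply: (@pairwise_image g) => // y yc; by case: (hs y yc).
- rewrite -[ones 0 ++ _]/(nseq _ _) -start; apply: (@path_image g) => // y yc; by case: (hs y yc).
- rewrite -[ones 0 ++ _]/(nseq _ _) -start last_map; have [_ ml] := hs _ lin; exact: base_end gb ml endl.
exists (g2^-1 * f)%g; first by apply: circularM => //; exact: circularV.
move=> y; rewrite E => yc.
have iy : index y (nseq k l_in :: rest) <= size rest by move: yc; rewrite -index_mem.
have := fm _ iy; rewrite (nth_index [::] yc) => m.
apply: maps_mul m _; apply: maps_V.
have := gm _ iy; rewrite -[ones 0 ++ _]/(nseq _ _) -start -map_cons (nth_map [::]) ?nth_index //.
Qed.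

(** * Transitivity on half-spaces *)

(** Rotations move the dyadic point of t to the right spine: the part of the
    word that follows its leading [l_out] letters shrinks at each rotation. *)
Lemma loop_to_vine n t k : size t <= n -> spinal t -> exists f k', circular f /\
  bmaps f (spine_loop (ones k ++ t)) (spine_loop (ones k')).
Proof.
have sl s : spinal s -> decode (spine_loop s).
  by move=> hs; apply: (@decode_cons_tail [:: e_p]) => //; exact: spine_tail.
have tk j x : ones j ++ l_out :: x = ones j.+1 ++ x by rewrite /ones nseqS cat_rcons.
elim: n t k => [|n IH] t k.
  rewrite leqn0 size_eq0 => /eqP -> _; exists 1, k; rewrite cats0; split; first exact: circular1.
  by apply/maps_1/sl/spinal_ones.
case: t => [|[] // t] st ht.
- exists 1, k; rewrite cats0; split; first exact: circular1.
  by apply/maps_1/sl/spinal_ones.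
- have [f [cf _ [h1 h2] h3 h4]] := exists_rotation k.
  have app a b z : bmaps f (e_p :: ones k ++ a) (e_p :: ones k ++ b) -> spinal z ->
      bmaps f (spine_loop (ones k ++ (a ++ z))) (spine_loop (ones k ++ (b ++ z))).
    move=> h hz; rewrite /spine_loop !catA !rcons_cat -!cat_cons.
    by apply: maps_app => //; exact: spine_tail.
  case: t st ht => [|[] // t] st ht.
  + exists f, k; split => //; rewrite /spine_loop rcons_cat -[ones k in X in bmaps _ _ X]cats0 rcons_cat.
    exact: h4.
  + have [g [k' [cg gm]]] := IH (l_in :: t) k st ht.
    exists (g * f)%g, k'; split; first exact: circularM.
    apply: maps_mul gm; exact: (app [:: l_in; l_in] [:: l_in]).
  + have [g [k' [cg gm]]] := IH (l_in :: t) k.+1 st ht.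
    exists (g * f)%g, k'; split; first exact: circularM.
    apply: maps_mul gm; rewrite -tk; exact: (app [:: l_in; l_out] [:: l_out; l_in]).
- rewrite tk; exact: IH.
Qed.

Lemma to_vine_loop k : exists2 h, H h & bmaps h [:: e_p] (spine_loop (ones k)).
Proof.
elim: k => [|k [h hh hm]].
  exists (gen_prod [:: Gde; Gal; Gde]); first exact: gen_prod_H.
  by apply: (@gen_word_maps [:: Gde; Gal; Gde]); vm_compute.
exists (unrotate0^-1 * h)%g; first exact: HM (HV (gen_prod_H unrotate0_gens)) hh.
apply: maps_mul hm _; apply: maps_V.
case: k => [|k]; first by apply: (@gen_word_maps unrotate0_gens); vm_compute.
have h' : bmaps unrotate0 [:: e_p; l_out; l_out] [:: e_p; l_out] by apply: (@gen_word_maps unrotate0_gens); vm_compute.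
by apply: (maps_app h' (y := rcons (ones k) l_loop)); rewrite all_rcons ones_tail.
Qed.

Lemma to_spine_loop s : spinal s -> exists2 h, H h & bmaps h [:: e_p] (spine_loop s).
Proof.
move=> hs; have [f [k [[hf _ _ _] fm]]] := loop_to_vine 0 (leqnn _) hs.
have [h hh hm] := to_vine_loop k; exists (f^-1 * h)%g; first by apply: HM => //; exact: HV.
by apply: maps_mul hm _; apply: maps_V.
Qed.

Lemma loop_split y : all bas_tail y -> ~~ spinal y ->
  exists s z, [/\ spinal s, all bas_tail z & y = s ++ l_loop :: z].
Proof.
elim: y => //= c y IH /andP[tc ty]; case: c tc => // _.
- move=> /(IH ty)[s [z [hs hz ->]]]; by exists (l_in :: s), z.
- move=> /(IH ty)[s [z [hs hz ->]]]; by exists (l_out :: s), z.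
- by move=> _; exists [::], y.
Qed.

Lemma lword_cons y : lword (e_p :: y) -> y <> [::] -> ~~ spinal y.
Proof.
case/lastP: y => // y c; rewrite -rcons_cons /lword last_rcons => h _.
by rewrite /spinal all_rcons negb_and; case: c h.
Qed.

Lemma to_ep_loop n y : size y <= n -> all bas_tail y -> lword (e_p :: y) ->
  exists2 h, H h & bmaps h [:: e_p] (e_p :: y).
Proof.
elim: n y => [|n IH] y.
  by rewrite leqn0 size_eq0 => /eqP -> _ _; exists 1; [exact: H1|exact: maps_1].
case: (y =P [::]) => [-> _ _ _|y0 sy ty ly]; first by exists 1; [exact: H1|exact: maps_1].
have [s [z [hs hz yE]]] := loop_split ty (lword_cons ly y0).
have [h hh hm] := to_spine_loop hs.
have [||h' hh' hm'] := IH z _ hz.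
- by move: sy; rewrite yE size_cat /= addnS ltnS => /(leq_trans (leq_addl _ _)).
- move: ly; rewrite yE /lword /= last_cat /=; case: (z) => //=.
exists (h * h')%g; first exact: HM.
apply: maps_mul hm' _; rewrite yE -cat_rcons.
exact: (maps_app hm hz).
Qed.

Lemma to_loop w : lword w -> decode w -> exists2 h, H h & bmaps h [:: e_p] w.
Proof.
case: w => // a y lw dw.
have [da ty] : decode ([:: a] : basword) /\ all bas_tail y.
  by move: dw; rewrite -cat1s bas_decode_cat // => /andP[].
have go c : bmaps iota [:: e_p; c] [:: a] -> bas_tail c -> lword (e_p :: c :: y) ->
    exists2 h, H h & bmaps h [:: e_p] (a :: y).
  move=> h tc ly; have [|h' hh' hm'] := to_ep_loop (leqnn _) _ ly; first by rewrite /= tc.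
  exists (iota * h')%g; first by apply: HM => //; exact: H_iota.
  by apply: maps_mul hm' _; exact: (maps_app h ty).
have last_eq c : y <> [::] -> lword (a :: y) -> lword (e_p :: c :: y).
  by rewrite /lword /=; case: (y).
case: a da dw lw go last_eq => // _ dw lw go le.
- by apply: go iota_in _ _ => //; apply: le => // y0; move: lw; rewrite y0.
- by apply: go iota_out _ _ => //; apply: le => // y0; move: lw; rewrite y0.
- exact: to_ep_loop (leqnn _) ty lw.
- apply: go iota_loop _ _ => //; case: (y =P [::]) => [->//|y0]; exact: le.
Qed.

(** * Generation of T_B *)

Lemma T_B_M f g : T_B f -> T_B g -> T_B (f * g)%g.
Proof. exact: subgroupM T_B_subgroup. Qed.
Lemma T_B_V f : T_B f -> T_B f^-1%g.
Proof. exact: subgroupV T_B_subgroup. Qed.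

Local Notation half_space := (half_space iota_in iota_out iota_loop iota_pq iota_qp iota_q).
Local Notation iota_involutive := (iota_involutive iota_in iota_out iota_loop iota_pq iota_qp iota_q).
Local Notation iota_in_cell := (iota_in_cell iota_in iota_out iota_loop).
Local Notation iota_out_cell := (iota_out_cell iota_pq iota_qp iota_q).
Local Notation iota_base := (iota_base iota_pq).

Lemma base_begins w : decode w -> cell w (bpt (pre w (end_tail true))).
Proof. by move=> dw; apply: cell_pt; [exact: valid_end_tail|exact: begins_pre]. Qed.

(** By transitivity the loop w is the image of [e_p], so [half_space] applies to
    it.  Its image is not the complement of a loop inside [e_p]: a point of the
    central circle would lie in a loop. *)
Lemma image_loop g w : T_B g -> onto g [:: e_p] [:: e_p] -> lword w -> decode w ->
  prefix ([:: e_p] : basword) w ->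
  exists w', [/\ lword w', decode w', prefix ([:: e_p] : basword) w' & onto g w w'].
Proof.
move=> gT go lw dw pw; have [t ht tm] := to_loop lw dw.
have to := maps_onto tm.
have [w' [lw' dw' [h|h]]] := half_space (T_B_M gT (H_sub_T_B ht)); exists w'.
  have h' : onto g w w' by have := onto_mul (onto_V to) h; rewrite mulgK.
  by split=> //; exact: onto_sub go h' dw' pw.
exfalso.
have zg : generic (pre ([:: e_pq] : basword) zigzag) by exact: zigzag_generic.
have nz x : lword x -> decode x -> ~ cell x (bpt (pre ([:: e_pq] : basword) zigzag)).
  by move=> lx dx /(cell_generic zg); apply/negP; exact: zigzag_loop.
have [v vv ev] := ptP bas_point (g^-1%g (bpt (pre ([:: e_pq] : basword) zigzag))).
have gv : g (bpt v) = bpt (pre ([:: e_pq] : basword) zigzag) by rewrite -ev homeo_KV.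
have nv : ~ cell ([:: e_p] : basword) (bpt v).
  move=> /(cellP bas_point)[v1 [vv1 b1 e1]]; case: go => /(_ _ vv1 b1) + _ _.
  by rewrite -e1 gv; exact: nz.
have [v2 vv2 ev2] := ptP bas_point (t^-1%g (bpt v)).
have tv : t (bpt v2) = bpt v by rewrite -ev2 homeo_KV.
have [b|b] := boolP (begins v2 ([:: e_p] : basword)).
  apply: nv; case: to => /(_ _ vv2 b) + _ _; rewrite tv => /(cellP bas_point)[v3 [vv3 b3 ->]].
  by apply: cell_pt => //; exact: prefix_begins pw b3.
have /(cellP bas_point)[v4 [vv4 b4 e4]] := iota_out_cell vv2 b.
case: h => /(_ _ vv4 b4) + _ _.
rewrite (homeo_mulE _ iota) -e4 iota_involutive homeo_mulE tv gv; exact: nz.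
Qed.

Lemma lword_spine s : lword (spine_loop s).
Proof. by rewrite /lword /spine_loop -rcons_cons last_rcons. Qed.

Lemma decode_spine s : spinal s -> decode (spine_loop s).
Proof. by move=> hs; apply: (@decode_cons_tail [:: e_p]) => //; exact: spine_tail. Qed.

Lemma prefix_spine_loop s w : spinal s -> lword w -> decode w -> prefix w (spine_loop s) ->
  w = [:: e_p] \/ w = spine_loop s.
Proof.
move=> hs lw dw /prefixP[z]; case: w dw lw => // a w dw lw [<- E].
case/lastP: w dw lw E => [|w c] dv; [by left|rewrite -rcons_cons /lword last_rcons => lc E; right].
have tc : c = l_loop.
  have : bas_tail c.
    move: dv; rewrite -[_ :: _]/([:: a] ++ _) bas_decode_cat // all_rcons.
    by case/and3P.
  by case: c lc {E dv}.
case/lastP: z E => [|z d]; first by rewrite cats0 /spine_loop => ->.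
rewrite -rcons_cat => /rcons_inj[E _]; exfalso.
by move: hs; rewrite E tc !spinal_cat /spinal all_rcons.
Qed.

(** The loops attached to the circle of [e_p] are the maximal ones inside it,
    and both g and its inverse preserve inclusion of loops. *)
Lemma image_spine_loop g s : T_B g -> onto g [:: e_p] [:: e_p] -> spinal s ->
  exists2 s', spinal s' & onto g (spine_loop s) (spine_loop s').
Proof.
move=> gT go hs.
have pre_ep y : prefix ([:: e_p] : basword) (spine_loop y).
  by rewrite -[spine_loop y]/([:: e_p] ++ _) prefix_prefix.
have dep : decode ([:: e_p] : basword) by [].
have nep y : spine_loop y <> [:: e_p] by case: y.
have [w' [lw' dw' /prefixP[y wE] h]] :=
  image_loop gT go (lword_spine s) (decode_spine hs) (pre_ep s).
have ty : all bas_tail y by move: dw'; rewrite wE bas_decode_cat.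
have y0 : y <> [::].
  move=> y0; rewrite wE y0 cats0 in h.
  exact: nep (onto_uniq (decode_spine hs) dep (onto_V h) (onto_V go)).
rewrite wE in lw'.
have [s' [z [hs' hz yE]]] := loop_split ty (lword_cons lw' y0).
exists s' => //.
have [v [lv dv pv hv]] := image_loop (T_B_V gT) (onto_V go) (lword_spine s') (decode_spine hs') (pre_ep s').
have pvs : prefix v (spine_loop s).
  apply: onto_sub hv (onto_V h) (decode_spine hs) _.
  by rewrite wE yE -cat_rcons -[spine_loop s']/([:: e_p] ++ _) catA prefix_prefix.
case: (prefix_spine_loop hs lv dv pvs) => vE; rewrite vE in hv.
  by case: (nep s'); exact: onto_uniq (decode_spine hs') dep (onto_V hv) go.
by have := onto_V hv; rewrite invgK.
Qed.

Lemma fixes_off_base h : fixes_off h [:: e_p] -> h base_pt = base_pt.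
Proof. by move=> o; rewrite base_pt_pq; apply: o; [exact: valid_end_tail|rewrite begins1]. Qed.

Lemma fixes_off_onto h : fixes_off h [:: e_p] -> onto h [:: e_p] [:: e_p].
Proof.
have aux f u : fixes_off f [:: e_p] -> valid u -> begins u ([:: e_p] : basword) ->
    cell ([:: e_p] : basword) (f (bpt u)).
  move=> o uv ub; have [v vv ev] := ptP bas_point (f (bpt u)); rewrite ev.
  have [b|b] := boolP (begins v ([:: e_p] : basword)); first exact: cell_pt.
  have : bpt v = bpt u by apply: (@homeo_inj _ f); rewrite o // ev.
  by move=> ->; exact: cell_pt.
move=> o; split=> [u|u|]; [exact: aux|apply: aux; exact: fixes_off_V|].
exact: fixes_off_base.
Qed.

(** The element h is the action of g inside the half-space of [e_p], extended by
    the identity; the induction is on the depth k at which g becomes canonical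
    there. *)
Lemma localize k g : T_B g -> onto g [:: e_p] [:: e_p] ->
  (forall z, size z = k -> all bas_tail z -> exists w', bmaps g (e_p :: z) w') ->
  exists h, [/\ H h, fixes_off h [:: e_p] &
    forall u, valid u -> begins u ([:: e_p] : basword) -> h (bpt u) = g (bpt u)].
Proof.
elim/ltn_ind: k g => k IH g gT go gk.
case: k IH gk => [|k'] IH gk.
  have [w' h] := gk [::] erefl isT.
  have dep : decode ([:: e_p] : basword) by [].
  have w'E := onto_uniq (maps_decode h).2 dep (maps_onto h) go; rewrite w'E in h.
  exists 1; split=> [|//|u uv ub]; first exact: H1.
  by rewrite (beginsP ub) h.2 // -(beginsP ub).
set k := k'.+1 in IH gk *.
have [_ _ gb] := go.
have /choice[sg hsg] : forall y : basword, exists y' : basword,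
    y \in levels k -> spinal y' /\ bmaps g (e_p :: y) (e_p :: y').
  move=> y; have [yl|/negP yl] := boolP (y \in levels k); last by exists [::].
  have [sy szy] := levelsP _ _ yl.
  have [w' h] := gk y szy (spinal_tail sy).
  have hl := maps_app h (isT : all bas_tail [:: l_loop]).
  have [y' hy' oy'] := image_spine_loop gT go sy.
  have oy : onto g (spine_loop y) (w' ++ [:: l_loop]).
    by have := maps_onto hl; rewrite cat_cons cats1.
  have := onto_uniq (maps_decode hl).2 (decode_spine hy') oy oy'.
  rewrite cats1 /spine_loop -rcons_cons => /rcons_inj[w'E].
  by exists y' => _; rewrite -w'E.
(* h0 agrees with g on the arcs of level k, and g2 is g corrected by it. *)
have [h0 ch0 m0] := spine_match gb (fun y yl => hsg y yl).
have [hh0 off0 _ ll0] := ch0.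
have on0 := onto_V (fixes_off_onto off0).
pose g2 := (h0^-1 * g)%g.
have g2T : T_B g2 by apply: T_B_M => //; exact/T_B_V/H_sub_T_B.
have g2o : onto g2 [:: e_p] [:: e_p] := onto_mul go on0.
have g2arc y : y \in levels k -> bmaps g2 (e_p :: y) (e_p :: y).
  by move=> yl; apply: maps_mul (hsg y yl).2 (maps_V (m0 y yl)).
have g2loop s : spinal s -> size s < k -> onto g2 (spine_loop s) (spine_loop s).
  move=> hs sk; have [s' hs' o] := image_spine_loop g2T g2o hs.
  pose y : basword := rcons s l_in ++ mkseq (end_tail false) (k - (size s).+1).
  have yl : y \in levels k.
    apply/levelsP; split; last by rewrite size_cat size_rcons size_mkseq subnKC.
    rewrite spinal_cat; apply/andP; split; first by rewrite /spinal all_rcons.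
    by apply/allP => c /mapP[i _ ->].
  have ds := spine_decode hs; have ds' := spine_decode hs'.
  have dsl : decode (rcons (e_p :: s : basword) l_in) by rewrite bas_decode_rcons // ds.
  have endy : word_end false (e_p :: y : basword) = word_end true (spine_loop s).
    rewrite -[e_p :: y]/(rcons (e_p :: s : basword) l_in ++ _) word_end_tail // bas_word_end_rcons //.
    by rewrite -[spine_loop s]/(rcons (e_p :: s : basword) l_loop) bas_word_end_rcons.
  have [_ _ ob] := o.
  have [dy _] := maps_decode (g2arc y yl).
  have e1 := (pt_end_eq false true dy (decode_spine hs)).2 endy.
  have := ob; rewrite -e1 (maps_end_pt false (g2arc y yl)) e1.
  move/(pt_end_eq true true (decode_spine hs) (decode_spine hs')).
  rewrite -[spine_loop s]/(rcons (e_p :: s : basword) l_loop).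
  rewrite -[spine_loop s']/(rcons (e_p :: s' : basword) l_loop).
  rewrite !bas_word_end_rcons // => -[ss].
  by move: o; rewrite -ss.
(* The part of g2 inside one attached half-space, obtained by induction from
   its conjugate g3, which is canonical at depth k - (size s).+1. *)
have piece s : spinal s -> size s < k -> exists h, [/\ H h, fixes_off h (spine_loop s) &
    forall u, valid u -> begins u (spine_loop s) -> h (bpt u) = g2 (bpt u)].
  move=> hs sk; have [t ht tm] := to_spine_loop hs; have ton := maps_onto tm.
  have o2 := g2loop s hs sk.
  pose g3 := (t^-1 * (g2 * t))%g.
  have g3T : T_B g3.
    by apply: T_B_M; [exact/T_B_V/H_sub_T_B|apply: T_B_M => //; exact: H_sub_T_B].
  have g3o : onto g3 [:: e_p] [:: e_p].
    by apply: onto_mul (onto_V ton); apply: onto_mul ton o2.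
  have [||h3 [hh3 off3 eq3]] := IH (k - (size s).+1) _ g3 g3T g3o.
  - by rewrite ltn_subrL.
  - move=> z sz tz; have m1 := maps_app tm tz.
    have sz1 : size (rcons s l_loop ++ z) = k by rewrite size_cat size_rcons sz subnKC.
    have tz1 : all bas_tail (rcons s l_loop ++ z) by rewrite all_cat spine_tail.
    have [w1 m2] := gk _ sz1 tz1.
    have [s2 hs2 os2] := image_spine_loop gT go hs.
    have [dw1' dw1] := maps_decode m2.
    have /prefixP[z1 w1E] : prefix (spine_loop s2) w1.
      apply: onto_sub os2 (maps_onto m2) dw1 _.
      by rewrite -[e_p :: _]/(spine_loop s ++ z) prefix_prefix.
    have tz' : all bas_tail z1 by move: dw1; rewrite w1E bas_decode_cat // => /andP[].
    have [s3 hs3 m3] := ll0 _ hs2.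
    have m4 : bmaps g2 (spine_loop s ++ z) (spine_loop s3 ++ z1).
      by apply: maps_mul m2 _; rewrite w1E; exact: maps_app.
    have /prefixP[z2 zE] : prefix (spine_loop s) (spine_loop s3 ++ z1).
      apply: onto_sub o2 (maps_onto m4) (maps_decode m4).2 _; exact: prefix_prefix.
    have tz2 : all bas_tail z2.
      by move: (maps_decode m4).2; rewrite zE bas_decode_cat // => /andP[].
    exists ([:: e_p] ++ z2).
    apply: maps_mul (maps_V (maps_app tm tz2)).
    by rewrite -zE; exact: maps_mul m1 m4.
  have tb : t base_pt = bpt (pre (spine_loop s) (end_tail true)) by exact: maps_end_pt tm.
  exists (t * (h3 * t^-1))%g; split.
  - by apply: HM => //; apply: HM => //; exact: HV.
  - move=> u uv ub; rewrite !homeo_mulE.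
    have [v vv ev] := ptP bas_point (t^-1%g (bpt u)).
    suff -> : h3 (t^-1%g (bpt u)) = t^-1%g (bpt u) by rewrite homeo_KV.
    rewrite ev; have [b|b] := boolP (begins v ([:: e_p] : basword)); last exact: off3.
    have : cell (spine_loop s) (bpt u).
      by case: ton => /(_ _ vv b) + _ _; rewrite -ev homeo_KV.
    move/(cellP bas_point) => [u' [uv' ub' e]].
    have ub2 : bpt u = bpt (pre (spine_loop s) (end_tail true)).
      rewrite e; apply: (loop_base (lword_spine s) (decode_spine hs) uv' uv ub' ub).
      by rewrite -e.
    by rewrite -ev ub2 -tb homeo_VK fixes_off_base.
  - move=> u uv ub; rewrite !homeo_mulE.
    have /(cellP bas_point)[v [vv vb ev]] : cell ([:: e_p] : basword) (t^-1%g (bpt u)).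
      by case: ton => _ /(_ _ uv ub).
    by rewrite ev eq3 // !homeo_mulE homeo_KV -ev homeo_KV.
have disjoint_loops s s' u : spinal s -> spinal s' -> begins u (spine_loop s) ->
    begins u (spine_loop s') -> s = s'.
  move=> hs hs' b b'.
  have aux x y : spinal x -> spinal y -> prefix (spine_loop x) (spine_loop y) -> x = y.
    move=> hx hy p; case: (prefix_spine_loop hy (lword_spine x) (decode_spine hx) p).
      by case: (x).
    by move=> [/rcons_inj[]].
  case: (begins_comparable b b') => p; [exact: aux|exact/esym/aux].
(* Distinct attached half-spaces are disjoint, so the pieces multiply
   independently. *)
have all_pieces (l : seq basword) : (forall s, s \in l -> spinal s /\ size s < k) ->
    exists h, [/\ H h,
      forall u, valid u -> (forall s, s \in l -> ~~ begins u (spine_loop s)) -> h (bpt u) = bpt u &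
      forall s u, s \in l -> valid u -> begins u (spine_loop s) -> h (bpt u) = g2 (bpt u)].
  elim: l => [|s l IHl] hl; first by exists 1; split=> //; exact: H1.
  have [|h [hh hf he]] := IHl; first by move=> x xl; apply: hl; rewrite in_cons xl orbT.
  have [sl|sl] := boolP (s \in l).
    exists h; split=> // [u uv nu|x u].
      by apply: hf => // x xl; apply: nu; rewrite in_cons xl orbT.
    rewrite in_cons => /predU1P[->|]; exact: he.
  have [hs sk] := hl s (mem_head _ _).
  have [f [hf1 ff fe]] := piece s hs sk.
  exists (f * h)%g; split; first exact: HM.
    move=> u uv nu; rewrite homeo_mulE hf //; first by apply: ff => //; apply: nu; exact: mem_head.
    by move=> x xl; apply: nu; rewrite in_cons xl orbT.
  move=> x u; rewrite in_cons homeo_mulE => /predU1P[->|xl] uv ub.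
    rewrite hf ?fe // => y yl; apply/negP => uy.
    have [hy _] := hl y ltac:(by rewrite in_cons yl orbT).
    by move: sl; rewrite (disjoint_loops _ _ _ hs hy ub uy) yl.
  rewrite (he x) //; have [hx xk] := hl x ltac:(by rewrite in_cons xl orbT).
  have : cell (spine_loop x) (g2 (bpt u)) by case: (g2loop x hx xk) => /(_ _ uv ub).
  move/(cellP bas_point) => [v [vv vb ->]]; apply: ff => //; apply/negP => vs.
  by move: sl; rewrite (disjoint_loops _ _ _ hs hx vs vb) xl.
pose l := flatten [seq levels j | j <- seq.iota 0 k].
have lP s : reflect (spinal s /\ size s < k) (s \in l).
  apply: (iffP flatten_mapP) => [[j]|[hs sk]].
    by rewrite mem_iota add0n => /andP[_ jk] /levelsP[hs ->].
  by exists (size s); [rewrite mem_iota add0n|apply/levelsP].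
have [h1 [hh1 f1 e1]] := all_pieces l (fun s sl => lP s sl).
exists (h0 * h1)%g; split; first exact: HM.
  move=> u uv nu; rewrite homeo_mulE f1 //; first exact: off0.
  move=> s _; apply: contra nu; apply: prefix_begins.
  by rewrite -[spine_loop s]/([:: e_p] ++ _) prefix_prefix.
move=> u uv ub; rewrite homeo_mulE.
have back p : h0 (g2 p) = g p by rewrite homeo_mulE homeo_KV.
have [/hasP[s sl us]|no] := boolP (has (fun s => begins u (spine_loop s)) l).
  by rewrite (e1 s) // back.
rewrite f1 //; last by move=> s sl; apply: contra no => us; apply/hasP; exists s.
rewrite -[RHS]back; congr (h0 _).
have tu : all bas_tail (mkseq (suff 1 u) k : basword).
  by apply/allP => d /mapP[i _ ->]; rewrite /suff add1n; exact: valid_tail.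
have uE : mkseq u k.+1 = e_p :: mkseq (suff 1 u) k.
  by rewrite -[k.+1]add1n mkseqD /=; move: ub; rewrite begins1 => /eqP ->.
have yl : mkseq (suff 1 u) k \in levels k.
  apply/levelsP; rewrite size_mkseq; split => //; apply: contraT => ns.
  have [s [z [hs hz E]]] := loop_split tu ns.
  case/hasP: no; exists s.
    apply/lP; split => //.
    by have := congr1 size E; rewrite size_mkseq size_cat /= addnS => ->; rewrite ltnS leq_addr.
  apply: (@prefix_begins _ u _ (mkseq u k.+1)); last exact: begins_mkseq.
  by rewrite uE E -cat_rcons -cat_cons prefix_prefix.
have m := g2arc _ yl; rewrite -uE in m.
by rewrite {2}(beginsP (begins_mkseq u k.+1)) m.2 -(beginsP (begins_mkseq u k.+1)).
Qed.

(** The complement of the half-space is preserved as well, up to the common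
    base point. *)
Lemma outer_image g u : onto g [:: e_p] [:: e_p] -> valid u ->
  ~~ begins u ([:: e_p] : basword) ->
  g (bpt u) = base_pt \/
  exists v, [/\ valid v, ~~ begins v ([:: e_p] : basword) & g (bpt u) = bpt v].
Proof.
move=> go uv ub; have [v vv ev] := ptP bas_point (g (bpt u)); rewrite ev.
have [b|b] := boolP (begins v ([:: e_p] : basword)); last by right; exists v.
left; case: go => _ /(_ _ vv b) + gb; rewrite -ev homeo_VK.
move=> /(cellP bas_point)[u' [uv' ub' e]].
have e' : bpt u' = bpt u by [].
by rewrite -e' (loop_base _ _ uv' uv ub' ub e').
Qed.

Lemma iota_conj_onto g : onto g [:: e_p] [:: e_p] ->
  onto (iota * (g * iota))%g [:: e_p] [:: e_p].
Proof.
have half f u : onto f [:: e_p] [:: e_p] -> valid u -> begins u ([:: e_p] : basword) ->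
    cell ([:: e_p] : basword) (iota (f (iota (bpt u)))).
  move=> fo uv ub; have [v [vv vb] ->] := iota_in_cell uv ub.
  case: (outer_image fo vv vb) => [->|[t [tv tb ->]]]; last exact: iota_out_cell.
  by rewrite iota_base; exact: base_begins.
move=> go; split=> [u uv ub|u uv ub|].
- by rewrite (homeo_mulE iota) (homeo_mulE g); exact: half.
- have := half _ _ (onto_V go) uv ub.
  rewrite !invgM (homeo_mulE _ iota^-1) (homeo_mulE iota^-1).
  by rewrite (iota_V iota_in iota_out iota_loop iota_pq iota_qp iota_q).
- have [_ _ gb] := go; have ib := iota_base.
  by rewrite (homeo_mulE iota) (homeo_mulE g) -/base_pt ib gb ib.
Qed.

(** [localize] applies to g inside the half-space of [e_p], and to the conjugate
    of g by iota outside it. *)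
Lemma onto_H g : T_B g -> onto g [:: e_p] [:: e_p] -> H g.
Proof.
have canon f : T_B f -> exists k, forall z, size z = k -> all bas_tail z ->
    exists w', bmaps f (e_p :: z) w'.
  move=> /T_BP[k fk]; exists k => z sz tz; apply: fk; first by rewrite /= sz.
  exact: (@decode_cons_tail [:: e_p]).
move=> gT go; have [k gk] := canon _ gT.
have [h1 [hh1 f1 e1]] := localize gT go gk.
have iT := H_sub_T_B H_iota.
have giT : T_B (iota * (g * iota))%g by apply: T_B_M => //; exact: T_B_M.
have [k2 gk2] := canon _ giT.
have [h2 [hh2 f2 e2]] := localize giT (iota_conj_onto go) gk2.
suff -> : g = (h1 * (iota * (h2 * iota)))%g.
  by apply: HM => //; apply: HM; [exact: H_iota|apply: HM => //; exact: H_iota].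
apply: homeo_eq => p; have [u uv ->] := ptP bas_point p.
rewrite (homeo_mulE h1) (homeo_mulE iota) (homeo_mulE h2).
have [ub|ub] := boolP (begins u ([:: e_p] : basword)).
  have [v [vv vb] ev] := iota_in_cell uv ub.
  by rewrite ev f2 // -ev iota_involutive e1.
have /(cellP bas_point)[v [vv vb ev]] := iota_out_cell uv ub.
rewrite ev e2 // -ev (homeo_mulE iota) (homeo_mulE g) !iota_involutive.
case: (outer_image go uv ub) => [->|[t [tv tb ->]]]; first by rewrite fixes_off_base.
by rewrite f1.
Qed.

Theorem T_B_generated : T_B `<=` H.
Proof.
move=> f fT; have [w [lw dw hw]] := half_space fT.
have [t ht tm] := to_loop lw dw.
have tV := maps_onto (maps_V tm).
have tT : T_B t^-1%g by apply/H_sub_T_B; exact: HV.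
case: hw => h.
  have := onto_H (T_B_M tT fT) (onto_mul h tV).
  by move=> /(HM ht); rewrite mulgA mulgV mul1g.
have iT := H_sub_T_B H_iota.
have := onto_H (T_B_M tT (T_B_M fT iT)) (onto_mul h tV).
move=> /(HM ht); rewrite mulgA mulgV mul1g => hfi.
have := HM hfi (HV H_iota); by rewrite mulgK.
Qed.

End Generators.

(** * Collapsing the segments of the airplane *)

Notation apt := (pt air_point).
Notation amaps := (maps air_point (@same_col airplane_system)).

Section Collapse.
Local Notation A := airplane_system.
Implicit Types (w y : airword) (u v : nat -> letter airplane_system).

Definition collapse_letter (c : air_letter) : bas_letter :=
  match c with
  | e_D => e_pq | e_U => e_qp | e_L => e_p | e_R => e_q
  | r_1 | l_d | b_minus => l_in | r_2 | l_u => l_out | l_s | b_plus => l_loop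
  end.

(** The word enters a shrunken segment. *)
Definition dead w := b_minus \in w.

(** The segment [b_minus] of a blue edge shrinks to the vertex from which the
    edge hangs.  This vertex is named by the tail of [l_in], so the letter
    [b_minus] and all that follow it become [l_in]. *)
Definition collapse_seq u : nat -> letter basilica_system :=
  fun n => if dead (mkseq u n) then l_in else collapse_letter (u n).

Fixpoint collapse_word w : basword :=
  if w is c :: w' then
    collapse_letter c :: (if c == b_minus then nseq (size w') l_in else collapse_word w')
  else [::].

Lemma dead_cat w y : dead (w ++ y) = dead w || dead y.
Proof. exact: mem_cat. Qed.

Lemma dead_rcons w c : dead (rcons w c) = dead w || (c == b_minus).
Proof. by rewrite /dead mem_rcons in_cons orbC eq_sym. Qed.

Lemma collapse_rcons w c : collapse_word (rcons w c) =
  rcons (collapse_word w) (if dead w then l_in else collapse_letter c).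
Proof.
elim: w => [|a w IH] /=; first by case: eqP.
have -> : dead (a :: w) = (a == b_minus) || dead w by rewrite /dead in_cons eq_sym.
case: eqP => _ /=; first by rewrite size_rcons nseqS.
by rewrite IH.
Qed.

Lemma size_collapse w : size (collapse_word w) = size w.
Proof. by elim/last_ind: w => // w c IH; rewrite collapse_rcons !size_rcons IH. Qed.

Lemma mkseq_collapse u n : mkseq (collapse_seq u) n = collapse_word (mkseq u n).
Proof. by elim: n => // n IH; rewrite !mkseqS collapse_rcons IH. Qed.

Lemma collapse_pre_dead w u : dead w ->
  collapse_seq (pre w u) = pre (collapse_word w) (end_tail true).
Proof.
move=> dw; have b : begins (collapse_seq (pre w u)) (collapse_word w).
  by rewrite /begins size_collapse mkseq_collapse (eqP (begins_pre w u)).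
rewrite (beginsP b); congr pre; apply/funext => n.
rewrite /suff size_collapse /collapse_seq /end_tail.
have -> : dead (mkseq (pre w u) (size w + n)) by rewrite mkseq_pre dead_cat dw.
by [].
Qed.

Lemma collapse_cat w y : ~~ dead w ->
  collapse_word (w ++ y) = collapse_word w ++ collapse_word y.
Proof.
elim: w => //= c w IH; rewrite /dead in_cons negb_or eq_sym => /andP[/negbTE -> dw].
by rewrite IH.
Qed.

Lemma collapse_pre w u : ~~ dead w ->
  collapse_seq (pre w u) = pre (collapse_word w) (collapse_seq u).
Proof.
move=> dw; apply/funext => n; have := mkseq_collapse (pre w u) (size w + n.+1).
rewrite mkseq_pre collapse_cat // -mkseq_collapse -size_collapse -mkseq_pre.
by move/mkseq_eq; apply; rewrite addnS ltnS leq_addl.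
Qed.

Definition is_tip (x : air_base + airword * air_new) : bool :=
  match x with inl v_l | inl v_r | inr (_, n_w) => true | _ => false end.

Definition collapse_vertex (x : air_base + airword * air_new) : bas_base + basword * unit :=
  match x with
  | inl v_b => inl v_q
  | inl _ => inl v_p
  | inr (w, k) => if dead w || (k == n_x)
      then odflt (inl v_p) (word_end true (collapse_word w)) else inr (collapse_word w, tt)
  end.

Arguments collapse_vertex : simpl never.
Local Notation cv := collapse_vertex.
Local Notation cw := collapse_word.

(** The invariant tying an edge to its image: the ends of a red edge go to the
    corresponding ends, a blue edge becomes a loop at the image of its source
    while its target is a tip, and an edge of a segment goes to the single
    vertex to which the segment shrinks. *)
Definition collapses w (e : edge A) :=
  [/\ decode (cw w), ~~ is_tip (src e), col e = Red -> ~~ is_tip (tgt e) &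
    if dead w then word_end true (cw w) = Some (cv (src e)) /\ word_end true (cw w) = Some (cv (tgt e))
    else if col e is Red then word_end true (cw w) = Some (cv (src e)) /\ word_end false (cw w) = Some (cv (tgt e))
    else is_tip (tgt e) /\ forall b, word_end b (cw w) = Some (cv (src e))].

Lemma decode_collapses w e : decode w = Some e -> collapses w e.
Proof.
elim/last_ind: w e => [//|w c IH] e.
case: (eqVneq w [::]) => [->|w0].
  by case: c => // -[<-]; split => //; split => // -[].
rewrite decode_rcons //; case E: decode => [f|] //= ec.
have [d ns nt h] := IH _ E; have lf := decode_lab E.
have c0 : cw w != [::] by rewrite -size_eq0 size_collapse size_eq0.
rewrite /collapses collapse_rcons bas_decode_rcons // d dead_rcons.
have fx : cv (inr (w, n_x)) = odflt (inl v_p) (word_end true (cw w)).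
  by rewrite /cv eqxx orbT.
have fdead k : dead w -> cv (inr (w, k)) = odflt (inl v_p) (word_end true (cw w)).
  by rewrite /cv => ->.
case dw: (dead w) h => h.
  have [h1 h2] := h.
  have nv k : cv (inr (w, k)) = cv (src f) by rewrite fdead // h1.
  have ts : cv (tgt f) = cv (src f) by move: h1; rewrite h2 => -[].
  move: ec; rewrite air_child lf; case fc: (col f) nt; case: c => // nt -[<-];
    split => //=; rewrite ?(nt erefl) // ?bas_word_end_rcons // h1 ?nv ?ts //.
have live k : k != n_x -> cv (inr (w, k)) = inr (cw w, tt).
  by rewrite /cv dw => /negbTE ->.
move: ec; rewrite air_child lf; case fc: (col f) nt h => nt h; case: c => // -[<-];
  rewrite ?bas_word_end_rcons // orFb /=.
- by case: h => h1 h2; split => //; rewrite ?bas_word_end_rcons // h1 live.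
- by case: h => h1 h2; split => //; rewrite ?nt // ?h2 ?live.
- by split => //; split => // b; rewrite ?bas_word_end_rcons // live.
- case: h => _ h; split => //; rewrite ?bas_word_end_rcons // fx (h true) //.
- by case: h => h1 h; split => //; split => // b; rewrite ?bas_word_end_rcons // live.
- by case: h => _ h; split => //; rewrite ?bas_word_end_rcons // fx !h live.
- by case: h => _ h; split => //; rewrite ?bas_word_end_rcons // fx !h live.
Qed.

Lemma collapse_valid u : valid u -> valid (collapse_seq u).
Proof.
move=> uv n; rewrite mkseq_collapse; have := uv n.
by case E: decode => [e|] // _; case: (decode_collapses E).
Qed.

Lemma collapse_ends u x : valid u -> ends u x -> ~~ is_tip x ->
  ends (collapse_seq u) (cv x).
Proof.
move=> uv [N hN] nx; exists N => n Nn; have := hN _ Nn; have := uv n.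
rewrite mkseq_collapse; move: (mkseq u n.+1) => w.
case E: (decode w) => [e|] // _; rewrite [inc (Some e) x]/=.
have [d ns nt h] := decode_collapses E.
rewrite inc_word_end /incident !inE.
case: (dead _) h => [[h1 h2]|].
  by move=> /orP[]/eqP xE; apply/orP; left; apply/eqP; rewrite xE.
case: (col e) => [[h1 h2]|[tt h]].
  by move=> /orP[]/eqP xE; apply/orP; [left|right]; apply/eqP; rewrite xE.
by move=> /orP[]/eqP xE; [apply/orP; left; apply/eqP; rewrite xE|rewrite xE tt in nx].
Qed.

Definition tip_word (x : air_base + airword * air_new) : airword :=
  match x with
  | inl v_l => [:: e_L] | inl _ => [:: e_R] | inr (w, _) => rcons w l_s
  end.

(** Only the child [b_plus] keeps the tip of a blue edge, so at each level a
    single edge reaches a given tip. *)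
Lemma tip_shape w e x : decode w = Some e -> incident e x -> is_tip x ->
  exists k, w = tip_word x ++ nseq k b_plus.
Proof.
elim/last_ind: w e => [//|w c IH] e de xe tx.
have [_ ns nt _] := decode_collapses de.
have xt : x = tgt e.
  by move: xe; rewrite /incident !inE => /orP[]/eqP // xE; rewrite xE (negbTE ns) in tx.
have ce : col e <> Red by move=> ce; move: tx; rewrite xt (negbTE (nt ce)).
move: de; case: (eqVneq w [::]) => [->|w0].
  case: c => // -[eE]; move: ce xt tx; rewrite -eE //= => _ -> //= _; by exists 0.
rewrite decode_rcons //; case E: decode => [f|] //= ec.
have [_ nsf ntf _] := decode_collapses E; have lf := decode_lab E.
move: ec; rewrite air_child lf; case fc: (col f) ntf => ntf; case: c => // -[eE];
  move: ce xt tx; rewrite -eE //= => _ xE tx.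
- by exists 0; rewrite xE cats0.
- by rewrite xE (negbTE nsf) in tx.
have [|k wE] := IH _ E _ tx; first by rewrite xE /incident !inE eqxx orbT.
by exists k.+1; rewrite {1}wE rcons_cat -nseqS.
Qed.

(** Two names glued at a tip are equal; gluing at any other vertex is carried
    over by [collapse_vertex]. *)
Lemma collapse_eqv u v : valid u -> valid v -> apt u = apt v ->
  bpt (collapse_seq u) = bpt (collapse_seq v).
Proof.
move=> uv vv /(pt_eq air_point uv vv)[->//|[x [ux vx]]].
have [tx|nx] := boolP (is_tip x); last first.
  apply/pt_eq; try exact: collapse_valid.
  by right; exists (cv x); split; exact: collapse_ends.
have [[N hN] [M hM]] := (ux, vx).
suff -> : u = v by [].
apply/funext => i.
pose n := maxn i (maxn N M).
have Nn : N <= n by rewrite !leq_max leqnn orbT.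
have Mn : M <= n by rewrite !leq_max leqnn !orbT.
have hu := hN _ Nn; have hv := hM _ Mn.
case E: (decode (mkseq v n.+1)) hv => [e|] // ex.
case F: (decode (mkseq u n.+1)) hu => [f|] // fx.
have [k vk] := tip_shape E ex tx; have [j uj] := tip_shape F fx tx.
have kj : j = k.
  have := congr1 size uj; have := congr1 size vk.
  by rewrite !size_mkseq !size_cat !size_nseq => -> /addnI.
by apply: (@mkseq_eq _ u v n.+1); [rewrite uj vk kj|rewrite ltnS leq_max leqnn].
Qed.

Definition collapse (p : airplane) : basilica :=
  bpt (collapse_seq (letter_at (repr (p : {eq_quot glue_equiv A})))).

Lemma collapse_pt u : valid u -> collapse (apt u) = bpt (collapse_seq u).
Proof.
move=> uv; apply: collapse_eqv => //; first exact: letter_valid.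
by rewrite pt_letter /point_of reprK.
Qed.

(** The colour of the preceding edge, which decides between the two letters
    over d, is read off the preceding basilica letter c. *)
Definition lift_letter (c d : bas_letter) : air_letter :=
  if c \in [:: e_p; e_q; l_loop] then
    match d with l_in => l_d | l_out => l_u | _ => b_plus end
  else match d with l_in => r_1 | l_out => r_2 | _ => l_s end.

Definition lift_base (c : bas_letter) : air_letter :=
  match c with e_pq => e_D | e_qp => e_U | e_p => e_L | _ => e_R end.

Definition lift_seq (u : nat -> letter basilica_system) : nat -> letter A :=
  fun n => if n is m.+1 then lift_letter (u m) (u n) else lift_base (u 0).

Lemma lift_live (u : nat -> letter basilica_system) n : ~~ dead (mkseq (lift_seq u) n).
Proof.
apply/negP => /mapP[i _]; case: i => [|i] /=; first by case: (u 0).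
by rewrite /lift_letter; case: ifP => _; case: (u i.+1).
Qed.

Lemma lift_valid (u : nat -> letter basilica_system) : valid u -> valid (lift_seq u).
Proof.
move=> uv; have h0 := valid_head uv; have hS n := valid_tail n uv.
have lc n : letter_col (lift_seq u n) =
    if u n \in [:: e_p; e_q; l_loop] then Blue else Red.
  case: n => [|n] /=; first by case: (u 0) h0.
  by have := hS n; rewrite /lift_letter; case: ifP => _; case: (u n.+1).
elim=> [|n IH]; first by rewrite /=; case: (u 0) h0.
rewrite mkseqS air_decode_rcons // IH mkseqS last_rcons lc /= /lift_letter.
by have := hS n; case: ifP => _; case: (u n.+1).
Qed.

Lemma collapse_lift (u : nat -> letter basilica_system) : valid u ->
  collapse_seq (lift_seq u) = u.
Proof.
move=> uv; have h0 := valid_head uv; have hS n := valid_tail n uv.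
apply/funext => n; rewrite /collapse_seq (negbTE (lift_live _ _)).
case: n => [|n] /=; first by case: (u 0) h0.
by have := hS n; rewrite /lift_letter; case: ifP => _; case: (u n.+1).
Qed.

Lemma collapse_surj q : exists p, collapse p = q.
Proof.
have [u uv ->] := ptP bas_point q; exists (apt (lift_seq u)).
by rewrite collapse_pt ?collapse_lift //; exact: lift_valid.
Qed.

Lemma collapse_word_inj w y : decode w -> decode y -> ~~ dead w -> ~~ dead y ->
  cw w = cw y -> w = y.
Proof.
elim/last_ind: w y => [//|w c IH] y dw; case/lastP: y => // y d.
rewrite !dead_rcons !negb_or => dy /andP[lw cb] /andP[ly db].
rewrite !collapse_rcons (negbTE lw) (negbTE ly) => /rcons_inj[E cd].
case: (eqVneq w [::]) dw => [w0|w0].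
  have y0 : y = [::] by apply/size0nil; rewrite -size_collapse -E w0.
  by rewrite w0 y0 in dy *; move: cd cb db dy; case: c => //; case: d.
have y0 : y != [::].
  by move: w0; rewrite -!size_eq0 -size_collapse E size_collapse.
rewrite air_decode_rcons // => /andP[dw fc].
move: dy; rewrite air_decode_rcons // => /andP[dy fd].
have wy := IH _ dw dy lw ly E; rewrite -wy in fd *.
congr rcons; move: fc fd cd cb db; case: letter_col; case: c => //; case: d => //.
Qed.

Lemma collapse_seq_inj u v : valid u -> valid v -> (forall n, ~~ dead (mkseq u n)) ->
  (forall n, ~~ dead (mkseq v n)) -> collapse_seq u = collapse_seq v -> u = v.
Proof.
move=> uv vv lu lv h; apply/funext => n.
apply: (@mkseq_eq _ u v n.+1); last exact: ltnSn.
by apply: collapse_word_inj; rewrite // -!mkseq_collapse h.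
Qed.

End Collapse.

(** * Rigid homeomorphisms and the kernel *)

Section Lifts.
Local Notation A := airplane_system.
Local Notation cw := collapse_word.
Implicit Types (w y c : airword) (u v : nat -> letter airplane_system).
Implicit Types (f g h : homeo airplane).
Local Open Scope group_scope.

Lemma amaps_mul f g w w' w'' : amaps g w w' -> amaps f w' w'' -> amaps (f * g) w w''.
Proof.
move=> h h'.
exact: (maps_comp (@same_col_trans) (@same_col_child A) h h').
Qed.

Lemma amaps_V f w w' : amaps f w w' -> amaps f^-1%g w' w.
Proof. exact: (maps_inv same_col_sym (@same_col_child A) (@homeo_funK _ f)). Qed.

Lemma amaps_decode f w w' : amaps f w w' -> decode w /\ decode w'.
Proof. by case=> h _; split; [exact: alike_decode h|exact: alike_decode' h]. Qed.

Lemma amaps_app f w w' y : amaps f w w' -> decode (w ++ y) -> amaps f (w ++ y) (w' ++ y).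
Proof. by move=> h; apply: (maps_cat (@same_col_child A) h). Qed.

Lemma alike_col w w' : alike (@same_col A) w w' <->
  [/\ decode w, decode w' & letter_col (last e_L w) = letter_col (last e_L w')].
Proof.
split=> [[e [e' [E E' /eqP r]]]|].
  by rewrite E E' -(air_col E) -(air_col E').
case; case E: (decode w) => [e|] // _; case E': (decode w') => [e'|] // _ r.
by exists e, e'; split => //; rewrite /same_col (air_col E) (air_col E') r.
Qed.

Definition main_blue c := [&& isSome (decode c), ~~ dead c & letter_col (last e_L c) == Blue].

Definition amaps_rev f w w' :=
  [/\ amaps f (rcons w b_minus) (rcons w' b_plus), amaps f (rcons w b_plus) (rcons w' b_minus),
      amaps f (rcons w l_u) (rcons w' l_d) & amaps f (rcons w l_d) (rcons w' l_u)].

Definition segment_to f c c' :=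
  amaps f (rcons c b_minus) (rcons c' b_minus) \/
  amaps_rev f (rcons c b_minus) (rcons c' b_minus).

(** Collapsing forgets the action on segments; rigidity is the condition that
    allows it to be recovered. *)
Definition rigid f := forall c, main_blue c -> exists2 c', main_blue c' & segment_to f c c'.

(** Two reversals compose to a canonical map on each child of the segment, and
    every word through the segment passes through one of these children. *)
Lemma segment_to_mul f g c c' c'' : segment_to g c c' -> segment_to f c' c'' ->
  segment_to (f * g) c c''.
Proof.
have rev_dir g1 f1 x y z : amaps_rev g1 x y -> amaps f1 y z -> amaps_rev (f1 * g1) x z.
  move=> [h1 h2 h3 h4] h; rewrite -!cats1 in h1 h2 h3 h4.
  have [_ d1] := amaps_decode h1; have [_ d2] := amaps_decode h2.
  have [_ d3] := amaps_decode h3; have [_ d4] := amaps_decode h4.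
  by split; rewrite -!cats1; [apply: amaps_mul h1 _|apply: amaps_mul h2 _|
    apply: amaps_mul h3 _|apply: amaps_mul h4 _]; exact: amaps_app.
have dir_rev g1 f1 x y z : amaps g1 x y -> amaps_rev f1 y z -> amaps_rev (f1 * g1) x z.
  move=> h [h1 h2 h3 h4]; rewrite -!cats1 in h1 h2 h3 h4.
  have dx b : decode (y ++ [:: b]) -> decode (x ++ [:: b]).
    by move=> d; exact: (alike_decode' (alike_cat (@same_col_child A) (alike_sym same_col_sym h.1) d)).
  have [d1 _] := amaps_decode h1; have [d2 _] := amaps_decode h2.
  have [d3 _] := amaps_decode h3; have [d4 _] := amaps_decode h4.
  by split; rewrite -!cats1; [apply: amaps_mul _ h1|apply: amaps_mul _ h2|
    apply: amaps_mul _ h3|apply: amaps_mul _ h4]; apply: amaps_app; rewrite ?dx.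
move=> [h|h] [k|k].
- by left; exact: amaps_mul h k.
- by right; exact: dir_rev h k.
- by right; exact: rev_dir h k.
- left; case: h => h1 h2 h3 h4; case: k => k1 k2 k3 k4.
  have m1 := amaps_mul h1 k2; have m2 := amaps_mul h2 k1.
  have m3 := amaps_mul h3 k4; have m4 := amaps_mul h4 k3.
  have p (z : airword) b : decode (rcons (rcons z b_minus) b) -> decode (rcons z b_minus).
    by rewrite -[rcons (rcons z b_minus) b]cats1; apply: decode_prefix; case: (z).
  have [d d'] := amaps_decode m1.
  have al : alike (@same_col A) (rcons c b_minus) (rcons c'' b_minus).
    by apply/alike_col; split; [exact: p d|exact: p d'|rewrite !last_rcons].
  split=> // x vx.
  have x0 : x = pre [:: x 0] (suff 1 x) by rewrite -{1}(mkseq_suff 1 x).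
  have go b : x 0 = b -> amaps (f * g) (rcons (rcons c b_minus) b) (rcons (rcons c'' b_minus) b) ->
      (f * g) (apt (pre (rcons c b_minus) x)) = apt (pre (rcons c'' b_minus) x).
    move=> xb m; rewrite x0 xb -!pre_cat !cats1; apply: m.2.
    by rewrite -cats1 pre_cat -xb -x0.
  have := (air_valid x (p _ _ d)).1 vx; rewrite last_rcons => -[/= + _].
  rewrite /follows !inE => /or4P[]/eqP xb.
  + exact: go m1.
  + exact: go m2.
  + exact: go m3.
  + exact: go m4.
Qed.

Lemma rigidM f g : rigid f -> rigid g -> rigid (f * g).
Proof.
move=> hf hg c /hg[c' /hf[c'' mc m2] m1].
by exists c'' => //; exact: segment_to_mul m1 m2.
Qed.

Lemma rigid1 : rigid 1.
Proof.
move=> c mc; exists c => //; left; case/and3P: (mc) => dc _ bc.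
apply: (maps_id air_point same_col_refl).
by rewrite air_decode_rcons ?dc ?(eqP bc) //; case: (c) dc.
Qed.

(** Rigidity of the inverse is asked separately because the segment reached in
    [rigid] need not range over all segments. *)
Definition descends h := [/\ T_A h, rigid h, rigid h^-1 &
  exists2 f : homeo basilica, T_B f & forall p, collapse (h p) = f (collapse p)].

Lemma descends_subgroup : is_subgroup descends.
Proof.
split.
  apply/mem_set; split; [exact: subgroup1 T_A_subgroup|exact: rigid1|exact: rigid1|].
  by exists 1 => //; exact: subgroup1 T_B_subgroup.
move=> f g /set_mem[fT fr fr' [f' f'T fE]] /set_mem[gT gr gr' [g' g'T gE]].
apply/mem_set; split.
- by apply: subgroupM T_A_subgroup _ _ => //; exact: subgroupV T_A_subgroup _.
- exact: rigidM.
- rewrite invgM; apply: rigidM => //; by rewrite invgK.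
exists (f' / g'); first by apply: subgroupM T_B_subgroup _ _ => //; exact: subgroupV T_B_subgroup _.
move=> p; rewrite (homeo_mulE f) fE (homeo_mulE f'); congr (f' _).
by apply: (@homeo_inj _ g'); rewrite homeo_KV -gE homeo_KV.
Qed.

Lemma collapse_winding : collapse_seq winding = zigzag.
Proof.
apply/funext => n; rewrite /collapse_seq.
have -> : dead (mkseq winding n) = false.
  by apply/negP => /mapP[i _]; rewrite /winding; case: ifP.
by rewrite /winding /zigzag; case: odd.
Qed.

Lemma stem_live k b : ~~ dead (stem k b). Proof. by case: k; case: b. Qed.

Lemma live_prefix w y : prefix w y -> ~~ dead y -> ~~ dead w.
Proof. by case/prefixP=> z ->; rewrite dead_cat negb_or => /andP[]. Qed.

Lemma mkseq_live w u : ~~ dead w -> (forall n, ~~ dead (mkseq u n)) ->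
  forall n, ~~ dead (mkseq (pre w u) n).
Proof.
move=> lw lu n; apply: (@live_prefix _ (mkseq (pre w u) (size w + n))).
  by rewrite addnC mkseqD prefix_prefix.
by rewrite mkseq_pre dead_cat negb_or lw lu.
Qed.

Lemma winding_live n : ~~ dead (mkseq winding n).
Proof. by apply/negP => /mapP[i _]; rewrite /winding; case: ifP. Qed.

(** The collapse is injective on words that avoid the segments.  Two such words
    that differ in the first letter after w bound the length of w'. *)
Lemma kernel_prefix f w w' : (forall p, collapse (f p) = collapse p) ->
  amaps f w w' -> ~~ dead w -> prefix w' w.
Proof.
move=> fE m lw; have [dw dw'] := amaps_decode m.
have /alike_col[_ _ col_eq] := m.1.
have eq_ray b : begins (pre (w ++ stem (letter_col (last e_L w)) b) winding) w'.
  set k := letter_col _; have v := stem_valid b dw; rewrite -/k in v.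
  have v' : valid (pre (w' ++ stem k b) winding) by rewrite /k col_eq; exact: stem_valid.
  have := fE (apt (pre (w ++ stem k b) winding)).
  rewrite {1}pre_cat m.2 -?pre_cat // !collapse_pt // => e.
  have ls : ~~ dead (w ++ stem k b) by rewrite dead_cat negb_or lw stem_live.
  have dc : decode (cw (w ++ stem k b)).
    have := stem_decode b dw; rewrite -/k; case E: decode => [e0|] // _.
    by case: (decode_collapses E).
  have cE : collapse_seq (pre (w ++ stem k b) winding) = pre (cw (w ++ stem k b)) zigzag.
    by rewrite collapse_pre // collapse_winding.
  have zg := zigzag_generic dc; rewrite -cE in zg.
  have e' := pt_generic zg (collapse_valid v') (esym e).
  have lw' : ~~ dead w'.
    apply/negP => dd.
    have : collapse_seq (pre (w' ++ stem k b) winding) =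
        pre (cw (w' ++ stem k b)) (end_tail true).
      by rewrite collapse_pre_dead // dead_cat dd.
    move=> h; have [_] := zg; rewrite e' h.
    have d' : decode (cw (w' ++ stem k b)).
      have := stem_decode b dw'; rewrite -col_eq -/k; case E: decode => [e0|] // _.
      by case: (decode_collapses E).
    have [x hx] := decode_word_end true d'.
    by move/(_ x); apply; exact: ends_end_tail.
  have -> : pre (w ++ stem k b) winding = pre (w' ++ stem k b) winding.
    apply: collapse_seq_inj => //; apply: mkseq_live; rewrite ?dead_cat ?negb_or ?lw ?lw' ?stem_live //;
      exact: winding_live.
  by rewrite pre_cat begins_pre.
have first_letter b : begins (pre (w ++ stem (letter_col (last e_L w)) b) winding)
    (rcons w (match letter_col (last e_L w), b with Red, true => r_2 | Red, false => r_1
      | Blue, true => l_u | Blue, false => l_d end)).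
  rewrite pre_cat -cats1 begins_pre_cat /begins.
  by case: letter_col; case: b.
case: (leqP (size w') (size w)) => s.
  apply: (begins_prefix (eq_ray true)) s.
  by rewrite pre_cat begins_pre.
exfalso.
have st a : size (rcons w a) <= size w' by rewrite size_rcons.
have := begins_prefix (first_letter true) (eq_ray true) (st _).
have := begins_prefix (first_letter false) (eq_ray false) (st _).
by rewrite !prefixE !size_rcons => /eqP -> /eqP/rcons_inj[]; case: letter_col.
Qed.

Lemma kernel_live f w w' : (forall p, collapse (f p) = collapse p) ->
  amaps f w w' -> ~~ dead w -> w' = w.
Proof.
move=> fE m lw; have p := kernel_prefix fE m lw.
apply: (prefix_anti p); apply: (kernel_prefix _ (amaps_V m) (live_prefix p lw)).
by move=> q; rewrite -fE homeo_KV.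
Qed.

Lemma dead_split w : dead w -> exists c z, ~~ dead c /\ w = rcons c b_minus ++ z.
Proof.
move=> dw; exists (take (index b_minus w) w), (drop (index b_minus w).+1 w); split.
  by rewrite /dead in_take_leq ?ltnn // index_size.
rewrite -{1}(cat_take_drop (index b_minus w) w) (drop_nth b_minus) ?index_mem //.
by rewrite nth_index // cat_rcons.
Qed.

Lemma minus_blue c z : decode (rcons c b_minus ++ z) -> ~~ dead c -> main_blue c.
Proof.
have r0 : rcons c b_minus != [::] by case: (c).
move/(decode_prefix r0) => d lc; have c0 : c != [::] by case: (c) d.
move: d; rewrite air_decode_rcons // => /andP[dc fc].
by rewrite /main_blue dc lc; case: letter_col fc.
Qed.

Definition word_tail (b : air_letter) : nat -> letter A := fun=> b.

Lemma ends_word_tail w a b x : decode w -> (forall n, decode (w ++ mkseq (word_tail a) n)) ->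
  (forall n, word_end b (w ++ mkseq (word_tail a) n) = Some x) ->
  valid (pre w (word_tail a)) /\ ends (pre w (word_tail a)) x.
Proof.
move=> dw d h; have v : valid (pre w (word_tail a)).
  apply: (@valid_far _ _ (size w)) => n hn; rewrite -(subnKC hn) -addnS mkseq_pre.
  exact: d.
split => //; apply: ends_limit => // n; rewrite inc_word_end.
by case: b h => h; rewrite h eqxx ?orbT.
Qed.

Lemma air_tail_end (a : air_letter) (b : bool) w : decode w ->
  (a == r_1) && b && (letter_col (last e_L w) == Red) ||
  (a == b_plus) && ~~ b && (letter_col (last e_L w) == Blue) ->
  forall n, decode (w ++ mkseq (word_tail a) n) /\
    word_end b (w ++ mkseq (word_tail a) n) = word_end b w.
Proof.
move=> dw h; have w0 : w != [::] by case: (w) dw.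
have wn n : w ++ mkseq (word_tail a) n != [::].
  exact: cat_neq0.
have lc n : letter_col (last e_L (w ++ mkseq (word_tail a) n)) = letter_col (last e_L w).
  case: n => [|n]; first by rewrite cats0.
  rewrite mkseqS -rcons_cat last_rcons.
  by case/orP: h => /andP[/andP[/eqP -> _] /eqP ->].
elim=> [|n [IH1 IH2]]; first by rewrite cats0.
rewrite mkseqS -rcons_cat air_decode_rcons // IH1 lc; split.
  by case/orP: h => /andP[/andP[/eqP -> _] /eqP ->].
rewrite -IH2 /word_end decode_rcons //.
case E: decode IH1 (lc n) => [e|] // _; rewrite -(air_col E) /= air_child => ce.
by case/orP: h => /andP[/andP[/eqP -> hb] /eqP k]; rewrite ce k /=; move: hb; case: (b).
Qed.

(** The only blue edge with source the vertex [n_x] of an edge is the segment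
    of that edge. *)
Lemma source_x c (x : airword) : main_blue c -> word_end true c <> Some (inr (x, n_x)).
Proof.
case/and3P; case/lastP: c => // w a dw la /eqP bl.
case: (eqVneq w [::]) dw bl la => [->|w0]; first by case: a.
rewrite last_rcons dead_rcons negb_or /word_end decode_rcons //.
case E: decode => [e|] //= ; rewrite air_child.
by case: (col e); case: a => //= _ _ /andP[_ ].
Qed.

(** The vertex [n_x] of a blue edge c lies both on the circle of c, where f is
    already known to be the identity, and at the end of the segment of c.  So f
    fixes it, and the segment of c goes to itself without reversal: a reversal
    would send [n_x] to the source of a blue edge. *)
Lemma kernel_trivial f : T_A f -> rigid f -> (forall p, collapse (f p) = collapse p) -> f = 1.
Proof.
move=> /T_AP[n fn] fr fE.
have live u : valid u -> ~~ dead (mkseq u n.+1) -> f (apt u) = apt u.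
  move=> uv lu; have [w' m] := fn _ (size_mkseq _ _) (uv n).
  have e := kernel_live fE m lu; rewrite e in m.
  have b := beginsP (begins_mkseq u n.+1); set x := suff _ _ in b.
  by rewrite {1}b m.2 -?b.
have seg c : main_blue c -> amaps f (rcons c b_minus) (rcons c b_minus).
  move=> mc; have [c' mc' h] := fr c mc.
  case/and3P: (mc) => dc lc /eqP bc; case/and3P: (mc') => dc' lc' /eqP bc'.
  have c0 : c != [::] by case: (c) dc.
  have c0' : c' != [::] by case: (c') dc'.
  have dx y a : decode y -> letter_col (last e_L y) = Blue -> a \in [:: b_minus; b_plus; l_u; l_d] ->
      decode (rcons y a) by move=> dy hy ha; rewrite air_decode_rcons ?dy ?hy //; case: (y) dy.
  have [e E] : exists e, decode c = Some e by case: decode dc => [e|] //; exists e.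
  have [e' E'] : exists e', decode c' = Some e' by case: decode dc' => [e'|] //; exists e'.
  have ce : col e = Blue by rewrite (air_col E).
  have ce' : col e' = Blue by rewrite (air_col E').
  have r0 (y : airword) a : rcons y a != [::] by case: y.
  have xd : word_end true (rcons c l_d) = Some (inr (c, n_x)).
    by rewrite /word_end decode_rcons // E /= air_child ce /= (decode_lab E).
  have xm y ey : y != [::] -> decode y = Some ey -> col ey = Blue ->
      word_end false (rcons (rcons y b_minus) b_minus) = Some (inr (y, n_x)).
    move=> y0 Ey cy; rewrite /word_end !decode_rcons // Ey /= air_child cy /=.
    by rewrite (decode_lab Ey).
  have xp : word_end false (rcons (rcons c' b_minus) b_plus) = word_end true c'.
    by rewrite /word_end !decode_rcons // E' /= air_child ce' /=.
  have dcd := dx c l_d dc bc isT.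
  have dcm := dx _ b_minus (dx c b_minus dc bc isT) ltac:(by rewrite last_rcons) isT.
  have dcm' a := dx _ a (dx c' b_minus dc' bc' isT) ltac:(by rewrite last_rcons).
  have t1 := air_tail_end (a := r_1) (b := true) dcd ltac:(by rewrite last_rcons).
  have [v1 e1] := ends_word_tail dcd (fun n => (t1 n).1) (fun n => etrans (t1 n).2 xd).
  have t2 := air_tail_end (a := b_plus) (b := false) dcm ltac:(by rewrite last_rcons).
  have [v2 e2] := ends_word_tail dcm (fun n => (t2 n).1) (fun n => etrans (t2 n).2 (xm _ _ c0 E ce)).
  have fix2 : f (apt (pre (rcons (rcons c b_minus) b_minus) (word_tail b_plus))) =
      apt (pre (rcons (rcons c b_minus) b_minus) (word_tail b_plus)).
    have -> : apt (pre (rcons (rcons c b_minus) b_minus) (word_tail b_plus)) =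
        apt (pre (rcons c l_d) (word_tail r_1)) by apply/(pt_ends air_point v2 v1 e2 e1).
    apply: live => //; apply: mkseq_live; first by rewrite dead_rcons negb_or lc.
    by move=> m; apply/negP => /mapP[].
  case: h => [h|[h _ _ _]].
    have d2 := dcm' b_minus isT.
    have t3 := air_tail_end (a := b_plus) (b := false) d2 ltac:(by rewrite last_rcons).
    have [v3 e3] := ends_word_tail d2 (fun n => (t3 n).1) (fun n => etrans (t3 n).2 (xm _ _ c0' E' ce')).
    have : f (apt (pre (rcons (rcons c b_minus) b_minus) (word_tail b_plus))) =
        apt (pre (rcons (rcons c' b_minus) b_minus) (word_tail b_plus)).
      by rewrite -!(cats1 _ b_minus) !(pre_cat (_ ++ _)) cats1 h.2 ?cats1 // -pre_cat cats1.
    rewrite fix2 => /(pt_ends air_point v2 v3 e2 e3) [cc].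
    by rewrite -cc in h.
  exfalso.
  have d2 := dcm' b_plus isT.
  have [x hx] := decode_word_end true dc'.
  have t3 := air_tail_end (a := b_plus) (b := false) d2 ltac:(by rewrite last_rcons).
  have [v3 e3] := ends_word_tail d2 (fun n => (t3 n).1) (fun n => etrans (t3 n).2 (etrans xp hx)).
  have := h.2 _ v2; rewrite fix2 => /(pt_ends air_point v2 v3 e2 e3) xE.
  by apply: (source_x (x := c) mc'); rewrite hx -xE.
apply: homeo_eq => p; have [u uv ->] := ptP air_point p.
rewrite [RHS]/=; have [du|lu] := boolP (dead (mkseq u n.+1)); last exact: live.
have [c [z [lc uE]]] := dead_split du.
have mc : main_blue c by apply: (minus_blue (z := z)) => //; rewrite -uE; exact: uv.
have b : begins u (rcons c b_minus).
  by apply: prefix_begins (begins_mkseq u n.+1); rewrite uE prefix_prefix.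
have := beginsP b; set x := suff _ _ => ux.
by rewrite {1}ux (seg c mc).2 -?ux.
Qed.

End Lifts.

(** * The generators descend to the basilica *)

Section GeneratorsDescend.
Local Notation A := airplane_system.
Local Notation cw := collapse_word.
Implicit Types (w y c : airword) (u v : nat -> letter airplane_system).
Implicit Types (h : homeo airplane) (f : homeo basilica).
Implicit Types (t : seq (airword * airword)) (s : seq (basword * basword)).

(** An entry either avoids the segments and collapses to an entry of s, or takes
    place inside the segments of the edges a and a'. *)
Definition descends_entry s (a a' : air_letter) (p : airword * airword) :=
  [&& ~~ dead p.1, ~~ dead p.2 & (cw p.1, cw p.2) \in s] ||
  (prefix [:: a; b_minus] p.1 && prefix [:: a'; b_minus] p.2).

Lemma collapse_segment_head (a : air_letter) (x : nat -> letter A) : a != b_minus ->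
  begins x ([:: a; b_minus] : airword) ->
  collapse_seq x = pre ([:: collapse_letter a] : basword) (end_tail true).
Proof.
move=> ab bx; have b := beginsP bx; set z := suff _ _ in b.
rewrite {1}b collapse_pre_dead; last by rewrite /dead !inE orbT.
have -> : cw [:: a; b_minus] = [:: collapse_letter a] ++ [:: l_in].
  by rewrite /= (negbTE ab).
rewrite pre_cat.
by congr pre; exact: (mkseq_suff 1 (end_tail true)).
Qed.

Lemma table_descends t s (a a' : air_letter) h f : table_ok 2 t -> follows_table t h ->
  all loop_ok s -> follows_table s f -> all (descends_entry s a a') t ->
  a \in [:: e_L; e_R] -> a' \in [:: e_L; e_R] ->
  (has (fun p => dead p.1) t ->
    f (bpt (pre ([:: collapse_letter a] : basword) (end_tail true))) =
    bpt (pre ([:: collapse_letter a'] : basword) (end_tail true))) ->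
  forall p, collapse (h p) = f (collapse p).
Proof.
move=> tok tf sok sf /allP de ha ha' fb p.
have [u uv ->] := ptP air_point p.
have /andP[/and3P[eok _ _] _] := tok; have /andP[hok _] := tok.
have [q [x [qt uE _]]] := exchangeP hok uv.
have m := air_table_maps eok tf qt.
rewrite uE in uv *; rewrite m.2 //.
have v' : valid (pre q.2 x) := alike_valid (@same_col_child A) m.1 uv.
rewrite !collapse_pt //.
case/orP: (de _ qt) => [/and3P[l1 l2 qs]|/andP[p1 p2]].
  have ms := bas_table_maps sok sf qs.
  have cv := collapse_valid uv; rewrite collapse_pre // in cv.
  by rewrite !collapse_pre // ms.2.
have b1 := prefix_begins p1 (begins_pre q.1 x); have b2 := prefix_begins p2 (begins_pre q.2 x).
have dq : dead q.1 by case/prefixP: p1 => z ->; rewrite /dead !inE orbT.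
have ab : a != b_minus by move: ha; rewrite !inE => /orP[]/eqP->.
have ab' : a' != b_minus by move: ha'; rewrite !inE => /orP[]/eqP->.
rewrite (collapse_segment_head ab b1) (collapse_segment_head ab' b2).
by rewrite fb //; apply/hasP; exists q.
Qed.

Lemma main_blue_app w y w' : alike (@same_col A) w w' -> ~~ dead w -> ~~ dead w' ->
  main_blue (w ++ y) -> main_blue (w' ++ y).
Proof.
move=> al lw lw' /and3P[d l /eqP b]; have al' := alike_cat (@same_col_child A) al d.
have /alike_col[_ d' e] := al'; rewrite /main_blue d' -e b eqxx andbT /=.
by move: l; rewrite !dead_cat (negbTE lw) (negbTE lw').
Qed.

(** A segment whose blue edge lies in the cell of an entry follows that entry;
    only the segment of the edge a may be cut by the table. *)
Lemma table_rigid t (a : air_letter) h : table_ok 2 t -> follows_table t h ->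
  all (fun p => if dead p.1 then prefix [:: a; b_minus] p.1 else ~~ dead p.2) t ->
  (has (fun p => dead p.1) t -> exists2 c', main_blue c' & segment_to h [:: a] c') ->
  rigid h.
Proof.
move=> tok tf /allP de sa c mc; have /and3P[dc lc /eqP bc] := mc.
have c0 : c != [::] by case: (c) dc.
have dm : decode (rcons c b_minus) by rewrite air_decode_rcons // dc bc.
have [u ug ub] := air_generic_in dm.
have /andP[/and3P[eok _ _] _] := tok; have /andP[hok _] := tok.
have [q [x [qt uE _]]] := exchangeP hok ug.1.
have m := air_table_maps eok tf qt.
have uq : begins u q.1 by rewrite uE begins_pre.
have := de _ qt; case dq: (dead q.1) => hq.
  have ba := prefix_begins hq uq.
  have cE : c = [:: a].
    have pc : prefix c (rcons c b_minus) := prefix_rcons c b_minus.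
    have [p|p] := begins_comparable ba (prefix_begins pc ub).
      by case/negP: lc; case/prefixP: p => z ->; rewrite /dead !inE orbT.
    case/prefixP: p => z; case: (c) c0 lc => // c1 [|c2 [|c3 r]] _ lc //.
    + by case=> ->.
    + by case=> _ c2E _; move: lc; rewrite -c2E /dead !inE orbT.
  by rewrite cE; apply: sa; apply/hasP; exists q.
have [p|p] := begins_comparable uq ub; last first.
  by have := live_prefix p (negbT dq); rewrite dead_rcons eqxx orbT.
case/prefixP: p => z; case/lastP: z => [|z d].
  by rewrite cats0 => e; move: dq; rewrite -e dead_rcons eqxx orbT.
rewrite -rcons_cat => /rcons_inj[cE dE].
exists (q.2 ++ z); first by rewrite cE in mc; exact: main_blue_app m.1 (negbT dq) hq mc.
by left; rewrite cE !rcons_cat; apply: amaps_app m _; rewrite -rcons_cat -cE.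
Qed.

Lemma follows_swap t h : follows_table t h -> table_ok 2 t -> follows_table (swap t) h^-1%g.
Proof.
move=> tf tok _ /mapP[p pt ->]; have /andP[/and3P[eok _ _] _] := tok.
have m := air_table_maps eok tf pt.
by have /(mapsP _ (@same_col_child A))[] := amaps_V m.
Qed.

Lemma swap_ok t : table_ok 2 t -> table_ok 2 (swap t).
Proof. by rewrite /table_ok swapK andbC. Qed.

Lemma live_table_descends t s h f : table_ok 2 t -> follows_table t h ->
  table_ok 2 s -> all loop_ok s -> follows_table s f ->
  all (fun p => [&& ~~ dead p.1, ~~ dead p.2 & (cw p.1, cw p.2) \in s]) t ->
  descends h /\ forall p, collapse (h p) = f (collapse p).
Proof.
move=> tok tf sok lok sf live.
have E : forall p, collapse (h p) = f (collapse p).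
  apply: (@table_descends t s e_L e_L) => //.
    by apply: sub_all live => p l; apply/orP; left.
  by case/hasP=> p /(allP live)/and3P[/negP].
split=> //; split.
- exact: air_table_T tok tf.
- apply: (table_rigid (a := e_L) tok tf).
    by apply: sub_all live => p /and3P[/negbTE -> -> _].
  by case/hasP=> p /(allP live)/and3P[/negP].
- apply: (table_rigid (a := e_L) (swap_ok tok) (follows_swap tf tok)).
    by rewrite all_map; apply: sub_all live => p /and3P[l1 /negbTE /= -> _].
  by rewrite has_map; case/hasP=> p /(allP live)/and3P[_ /negP].
- by exists f => //; exact: bas_table_T sok lok sf.
Qed.

(** alpha reverses the segment of [e_L] onto that of [e_R]; after collapsing, both
    are single vertices. *)
Lemma alpha_descends h f : follows_table alpha_table h -> follows_table alpha_bas f ->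
  descends h /\ forall p, collapse (h p) = f (collapse p).
Proof.
move=> tf sf; have tok := alpha_table_ok.
have lok : all loop_ok alpha_bas by vm_compute.
have E : forall p, collapse (h p) = f (collapse p).
  have de : all (descends_entry alpha_bas e_L e_R) alpha_table by vm_compute.
  apply: (table_descends tok tf lok sf de isT isT) => _.
  have m := bas_table_maps lok sf (isT : ([:: e_p; l_in], [:: e_qp]) \in alpha_bas).
  have -> : bpt (pre ([:: collapse_letter e_L] : basword) (end_tail true)) =
      bpt (pre ([:: e_p; l_in] : basword) (end_tail true)) by apply/pt_end_eq.
  by rewrite (maps_end_pt true m); apply/pt_end_eq.
have eok : all (@entry_ok _) alpha_table by vm_compute.
have am p : p \in alpha_table -> amaps h p.1 p.2 := air_table_maps eok tf (p := p).
have m1 : amaps h [:: e_L; b_minus; b_minus] [:: e_R; b_minus; b_plus] by apply: (am (_, _)); vm_compute.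
have m2 : amaps h [:: e_L; b_minus; b_plus] [:: e_R; b_minus; b_minus] by apply: (am (_, _)); vm_compute.
have m3 : amaps h [:: e_L; b_minus; l_u] [:: e_R; b_minus; l_d] by apply: (am (_, _)); vm_compute.
have m4 : amaps h [:: e_L; b_minus; l_d] [:: e_R; b_minus; l_u] by apply: (am (_, _)); vm_compute.
split=> //; split.
- exact: air_table_T tok tf.
- apply: (table_rigid (a := e_L) tok tf); first by vm_compute.
  by move=> _; exists [:: e_R] => //; right.
- apply: (table_rigid (a := e_R) (swap_ok tok) (follows_swap tf tok)); first by vm_compute.
  move=> _; exists [:: e_L] => //; right.
  by split; [exact: amaps_V m2|exact: amaps_V m1|exact: amaps_V m4|exact: amaps_V m3].
- by exists f => //; exact: bas_table_T alpha_bas_ok lok sf.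
Qed.

End GeneratorsDescend.

(** * The isomorphism *)

Theorem theorem9p1 :
  (exists alpha beta gamma delta : homeo airplane,
     [/\ is_alpha alpha, is_beta beta, is_gamma gamma & is_delta delta]) /\
  (forall alpha beta gamma delta : homeo airplane,
     is_alpha alpha -> is_beta beta -> is_gamma gamma -> is_delta delta ->
     let H := generated [set alpha; beta; gamma; delta] in
     [/\ subgroup_iso T_B H, is_subgroup T_A & H `<=` T_A]).
Proof.
split.
  have [a ha] := table_homeo air_point alpha_table_ok.
  have [b hb] := table_homeo air_point beta_table_ok.
  have [c hc] := table_homeo air_point gamma_table_ok.
  have [d hd] := table_homeo air_point delta_table_ok.
  exists a, b, c, d; split; [exact/is_alphaP|exact/is_betaP|exact/is_gammaP|exact/is_deltaP].
move=> al be ga de /is_alphaP ha /is_betaP hb /is_gammaP hc /is_deltaP hd H.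
have [a' ha'] := table_homeo bas_point alpha_bas_ok.
have [b' hb'] := table_homeo bas_point beta_bas_ok.
have [c' hc'] := table_homeo bas_point gamma_bas_ok.
have [d' hd'] := table_homeo bas_point delta_bas_ok.
have [ka Ea] := alpha_descends ha ha'.
have [kb Eb] := live_table_descends beta_table_ok hb beta_bas_ok isT hb' isT.
have [kc Ec] := live_table_descends gamma_table_ok hc gamma_bas_ok isT hc' isT.
have [kd Ed] := live_table_descends delta_table_ok hd delta_bas_ok isT hd' isT.
have sH : is_subgroup H := generated_subgroup _.
have HK : H `<=` descends.
  apply: smallest_sub; first exact: descends_subgroup.
  by move=> x [[[]|]|] ->.
have HA : H `<=` T_A by move=> x /HK[].
have gen x : [set al; be; ga; de] x -> H x by exact: sub_gen_smallest.
pose lifts (f : homeo basilica) h := forall p, collapse (h p) = f (collapse p).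
have lift_ex f : T_B f -> exists2 h, H h & lifts f h.
  pose K := [set f | exists2 h, H h & lifts f h].
  have sK : is_subgroup K.
    split.
      by apply/mem_set; exists 1%g => //; exact: subgroup1 sH.
    move=> x y /set_mem[hx Hx lx] /set_mem[hy Hy ly]; apply/mem_set.
    exists (hx * hy^-1)%g; first exact: (subgroupM sH Hx (subgroupV sH Hy)).
    move=> p; rewrite (homeo_mulE hx) lx (homeo_mulE x); congr (x _).
    by apply: (@homeo_inj _ y); rewrite homeo_KV -ly homeo_KV.
  move=> fT; have hgen := T_B_generated ha' hb' hc' hd' fT; apply: (hgen K); split => //.
  move=> x [[[]|]|] ->.
  - by exists al => //; apply: gen; left; left; left.
  - by exists be => //; apply: gen; left; left; right.
  - by exists ga => //; apply: gen; left; right.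
  - by exists de => //; apply: gen; right.
(* Two lifts of f differ by an element of the kernel. *)
have lift_uniq f h1 h2 : H h1 -> H h2 -> lifts f h1 -> lifts f h2 -> h1 = h2.
  move=> H1 H2 l1 l2.
  have H12 : H (h1^-1 * h2)%g := subgroupM sH (subgroupV sH H1) H2.
  have [kT kr _ _] := HK _ H12.
  have : (h1^-1 * h2)%g = 1%g.
    apply: kernel_trivial kT kr _ => p.
    rewrite (homeo_mulE h1^-1%g); set q := h1^-1%g _.
    have hq : h1 q = h2 p by rewrite /q homeo_KV.
    by apply: (@homeo_inj _ f); rewrite -l1 hq l2.
  by move/(congr1 (fun z => (h1 * z)%g)); rewrite mulgA mulgV mul1g mulg1.
have /choice[phi phiP] : forall f, exists h, T_B f -> H h /\ lifts f h.
  move=> f; have [/lift_ex[h Hh lh]|nf] := pselect (T_B f); first by exists h.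
  by exists 1%g.
split=> //; last exact: T_A_subgroup.
split=> //; first exact: T_B_subgroup.
exists phi; split; last first.
  move=> x y /set_mem xT /set_mem yT /=.
  have xyT : T_B (x * y)%g := subgroupM T_B_subgroup xT yT.
  have [[hx lx] [hy ly]] := (phiP _ xT, phiP _ yT); have [hxy lxy] := phiP _ xyT.
  apply: (lift_uniq _ _ _ hxy (subgroupM sH hx hy) lxy) => p.
  by rewrite (homeo_mulE (phi x)) lx ly.
split.
- by move=> f /phiP[].
- move=> x y /set_mem/phiP[hx lx] /set_mem/phiP[hy ly] e.
  apply: homeo_eq => q; have [p <-] := collapse_surj q.
  by rewrite -lx -ly e.
- move=> h Hh; have [_ _ _ [f fT fl]] := HK _ Hh; exists f => //.
  have [hf lf] := phiP _ fT; exact: lift_uniq lf fl.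
Qed.
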